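(* Let $K\in L^2([0,1]^2)$ be a square integrable kernel. Assume that the co-ordinate process $X\colon\Omega\to L^2([0,1])$ satisfies $X\in L^2(\mathrm{d}t\otimes\mathbb{P})$, i.e. $$\int_0^1\mathbb{E}\left[X_t^2\right]\mathrm{d}t<\infty.$$ Then $X$ is a centered Gaussian process with Fredholm kernel $K$ if and only if $$ \mathbb{E}\left[\int_0^1X_t\,\mathrm{D}_tf(X)\,\mathrm{d}t\right]=\mathbb{E}\left[\int_0^1\!\!\int_0^1K(t,s)\,\mathrm{K}^*\!\left[\mathrm{D}^2_{t,\,\cdot\,}f(X)\right](s)\,\mathrm{d}s\,\mathrm{d}t\right] $$ for all smooth functionals $f\in\mathcal{S}$.
   Context: Setting: $\Omega=L^2=L^2([0,1])$ with its Borel $\sigma$-field, $\mathbb{P}$ is a probability measure on $\Omega$, $\mathbb{E}$ its expectation, and $X=(X_t)_{t\in[0,1]}$ is the co-ordinate process $X_t(\omega)=\omega(t)$. Fredholm kernel: $X$ is a centered Gaussian process with Fredholm kernel $K\in L^2([0,1]^2)$ if it is a centered Gaussian process with covariance $R(t,s)=\mathbb{E}[X_tX_s]=\int_0^1K(t,u)K(s,u)\,\mathrm{d}u$ (equivalently $X_t=\int_0^1K(t,s)\,\mathrm{d}W_s$ for some Brownian motion $W$). Step functions: $\mathbf{1}_t=\mathbf{1}_{[0,t)}$. $\mathcal{E}\subset L^2$ is the set of right-continuous step functions, i.e. finite linear combinations $e=\sum_j a_j\mathbf{1}_{u_j}$ with $u_j\in(0,1]$. For a path $x$ put $\int_0^1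 e(t)\,\mathrm{d}x(t)=\sum_j a_j x(u_j)$, so that $\int_0^1\mathbf{1}_u(t)\,\mathrm{d}x(t)=x(u)$. Smooth functionals: $\mathcal{S}$ is the set of functionals $f\colon L^2\to\mathbb{C}$ of the form $f(x)=g(z_1,\dots,z_n)$, $z_k=\int_0^1e_k(t)\,\mathrm{d}x(t)$, where $n\in\mathbb{N}$, $e_k\in\mathcal{E}$, and $g\in\mathcal{C}^\infty_p(\mathbb{R}^n)$, i.e. $g$ is smooth and it and all its partial derivatives of all orders are polynomially bounded. Pathwise Malliavin derivatives: for such $f$, $\mathrm{D}_tf(x)=\sum_{k=1}^n\frac{\partial g}{\partial z_k}(z_1,\dots,z_n)\,e_k(t)$ and $\mathrm{D}^2_{t,s}f(x)=\sum_{k,l=1}^n\frac{\partial^2g}{\partial z_k\partial z_l}(z_1,\dots,z_n)\,e_k(t)e_l(s)$. Associated adjoint operator: $\mathrm{K}^*$ is defined by linearly extending $\mathrm{K}^*\mathbf{1}_t(s)=K(t,s)$; its domain $\mathrm{dom}(\mathrm{K}^* )$ is the Hilbert space generated by the indicators $\mathbf{1}_t$, closed under the inner product $\langle\mathbf{1}_t,\mathbf{1}_s\rangle=\int_0^1K(t,u)K(s,u)\,\mathrm{d}u$. In particular, for $e=\sum_ja_j\mathbf{1}_{u_j}\in\mathcal{E}$, $\mathrm{K}^*e=\sum_ja_jK(u_j,\cdot)$. In the formula $\mathrm{K}^*$ acts, for fixed $t$ and $\omega$, on the step function $s\mapsto\mathrm{D}^2_{t,s}f(X)$.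
   Formalization: Since X_t and K(t,·) are undefined at a single t for L² classes, ''Gaussian with kernel K'' and the jump times of f in S are read on a set of times of full measure; X is any jointly measurable version. Pointwise, ''if'' fails (add 1 to X_{1/2}); ''only if'' is also proved at all times. *)

(* Defs.v *)
From HB Require Import structures.
From mathcomp Require Import all_boot all_order all_algebra.
From mathcomp Require Import complex.
From mathcomp Require Import all_classical all_reals all_analysis.
From mathcomp Require Import measurable_realfun.

Set Implicit Arguments.
Unset Strict Implicit.
Unset Printing Implicit Defensive.

Import Order.TTheory GRing.Theory Num.Theory.
Import numFieldNormedType.Exports.

Local Open Scope classical_set_scope.
Local Open Scope ring_scope.

(** ** Integrals of complex-valued functions *)

Definition cintegrable d (T : measurableType d) (R : realType)
    (mu : {measure set T -> \bar R}) (F : T -> R[i]) : Prop :=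
  mu.-integrable setT (fun x => (complex.Re (F x))%:E) /\
  mu.-integrable setT (fun x => (complex.Im (F x))%:E).

Definition cintegral d (T : measurableType d) (R : realType)
    (mu : {measure set T -> \bar R}) (F : T -> R[i]) : R[i] :=
  Complex (\int[mu]_x complex.Re (F x)) (\int[mu]_x complex.Im (F x)).

(** ** The space L^2([0,1]) and its Borel sigma-field *)

(* Lebesgue measure on [0,1], as a measure on R that vanishes outside [0,1]:
   functions on [0,1] are represented by functions on R whose values outside
   [0,1] are irrelevant. *)
Definition leb01 (R : realType) : set (measurableTypeR R) -> \bar R :=
  mrestr (@lebesgue_measure R) (measurable_itv `[(0:R), 1]).

HB.instance Definition _ (R : realType) :=
  Measure.copy (@leb01 R)
    (mrestr (@lebesgue_measure R) (measurable_itv `[(0:R), 1])).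

Lemma leb01_setT (R : realType) : leb01 [set: measurableTypeR R] = 1%E.
Proof. by rewrite /leb01 /mrestr setTI lebesgue_measure_itv /= lte01 oppr0 adde0. Qed.

HB.instance Definition _ (R : realType) :=
  Measure_isProbability.Build _ _ _ (@leb01 R) (@leb01_setT R).

Definition L2 (R : realType) : Type := LspaceType2 (@leb01 R).

(* A representative of the class w. *)
Definition L2fun (R : realType) (w : L2 R) : R -> R :=
  (w : LspaceType2 (@leb01 R)) : _ -> _.

Section L2_pointed.
Variable R : realType.
Let mu : {measure set (measurableTypeR R) -> \bar R} := @leb01 R.

Let zeroM : {mfun_ mu, measurableTypeR R >-> measurableTypeR R} :=
  (\pi_({mfun_ mu, measurableTypeR R >-> measurableTypeR R})
     (cst 0 : {mfun measurableTypeR R >-> measurableTypeR R}))%qT.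

Let zeroM_fin : finite_norm mu 2%:E zeroM.
Proof.
have z0 : zeroM = cst 0 %[ae mu].
  apply/asboolP; rewrite -/(ae_eq_op _ _ _).
  by apply/eqmodP; rewrite reprK.
rewrite /finite_norm unlock /Lnorm.
rewrite (@ae_eq_integral _ _ _ _ _ (cst 0%E)) //.
- by rewrite integral0 poweR0r // invr_eq0 pnatr_eq0.
- apply/measurable_EFinP.
  apply: (@measurableT_comp _ _ _ _ _ _ (fun x : R => x `^ 2)) => //.
  by apply: measurableT_comp => //; exact: measurable_funPT.
- apply: filterS z0 => x /= /(_ I) + _ => ->.
  by rewrite normr0 powR0 ?pnatr_eq0.
Qed.

HB.instance Definition _ :=
  isFinLebesgue.Build _ _ R mu 2%:E (@lee1n R 2) zeroM zeroM_fin.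

Definition L2_zero : L2 R := (zeroM : LspaceType2 mu).

End L2_pointed.

HB.instance Definition _ (R : realType) := gen_eqMixin (L2 R).
HB.instance Definition _ (R : realType) := gen_choiceMixin (L2 R).
HB.instance Definition _ (R : realType) := isPointed.Build (L2 R) (L2_zero R).

Definition L2_open (R : realType) (U : set (L2 R)) : Prop :=
  forall f, U f -> exists2 r : R, 0 < r &
    forall g, (Lnorm (@leb01 R) 2%:E (fun t => (L2fun g t - L2fun f t)%:E) < r%:E)%E -> U g.

(* L^2([0,1]) with its Borel sigma-field. *)
Definition Omega (R : realType) := g_sigma_algebraType [set U | @L2_open R U].

Arguments Omega R : clear implicits.

(* The elements of Omega are classes of functions, so X_t(w) = w(t) makes sense
   only up to dt (x) P-null sets; a coordinate process is a jointly measurable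
   choice of representatives. *)
Definition coordinate_process (R : realType) (X : R -> Omega R -> R) : Prop :=
  measurable_fun [set: measurableTypeR R * Omega R] (fun p => X p.1 p.2) /\
  forall w : Omega R,
    {ae @leb01 R, forall t, X t w = L2fun (w : L2 R) t}.

(** ** Gaussian processes with a Fredholm kernel *)

(* normal_prob 0 0 is not a Dirac mass but the uniform law on [0,1]. *)
Definition centered_normal (R : realType) (s : R) :
    set (measurableTypeR R) -> \bar R :=
  if s == 0 then \d_(0 : measurableTypeR R) else normal_prob 0 s.

Definition centered_gaussian_on d (T : measurableType d) (R : realType)
    (P : probability T R) (X : R -> T -> R) (I : set R) : Prop :=
  forall (m : nat) (a t : 'I_m -> R), (forall i, I (t i)) ->
    exists s : R, forall A : set (measurableTypeR R), measurable A ->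
      P ((fun w => \sum_(i < m) a i * X (t i) w) @^-1` A) = centered_normal s A.

Definition fredholm_gaussian_on d (T : measurableType d) (R : realType)
    (P : probability T R) (X : R -> T -> R) (K : R * R -> R) (I : set R) :
    Prop :=
  centered_gaussian_on P X I /\
  forall t s, I t -> I s ->
    (\int[P]_w (X t w * X s w)%:E =
     \int[@leb01 R]_u (K (t, u) * K (s, u))%:E)%E.

(** ** Step functions *)

(* [:: (a_1, u_1); ...; (a_m, u_m)] stands for \sum_j a_j 1_[0, u_j[.  The
   indicators 1_[0, u[, u in ]0, 1], are linearly independent, so nothing below
   depends on the choice of the representation of a step function. *)
Definition step (C : Type) (R : realType) : Type := seq (C * R).

Definition step_on (R : realType) (I : set R) (e : step R R) : Prop :=
  forall p, p \in e -> 0 < p.2 <= 1 /\ I p.2.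

Definition step_fun (R : realType) (e : step R R) (t : R) : R :=
  \sum_(p <- e) p.1 * \1_(`[0, p.2[) t.

Definition cstep_fun (R : realType) (e : step R[i] R) (t : R) : R[i] :=
  \sum_(p <- e) p.1 * (\1_(`[0, p.2[) t)%:C%C.

(* \int_0^1 e(t) dx(t) *)
Definition step_int (R : realType) (e : step R R) (x : R -> R) : R :=
  \sum_(p <- e) p.1 * x p.2.

(* c *: e *)
Definition step_scale (R : realType) (c : R[i]) (e : step R R) : step R[i] R :=
  [seq (c * (p.1)%:C%C, p.2) | p <- e].

(* The operator K^* on step functions. *)
Definition Kstar (R : realType) (K : R * R -> R) (e : step R[i] R) (s : R) :
    R[i] :=
  \sum_(p <- e) p.1 * (K (p.2, s))%:C%C.

(** ** Smooth functionals and their Malliavin derivatives *)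

Definition partial (R : realType) n (k : 'I_n) (h : 'rV[R]_n -> R) :
    'rV[R]_n -> R :=
  fun z => 'D_(delta_mx 0 k) h z.

(* Smoothness: the iterated partial derivatives of all orders exist and are
   Frechet differentiable (hence continuous) everywhere. *)
Definition Cpinf (R : realType) n (h : 'rV[R]_n -> R) : Prop :=
  forall ks : seq 'I_n,
    let dh := foldr (@partial R n) h ks in
    (forall z, differentiable dh z) /\
    exists (C : R) (m : nat), forall z, `|dh z| <= C * (1 + `|z|) ^+ m.

Definition cCpinf (R : realType) n (g : 'rV[R]_n -> R[i]) : Prop :=
  Cpinf (fun z => complex.Re (g z)) /\ Cpinf (fun z => complex.Im (g z)).

Definition cpartial (R : realType) n (k : 'I_n) (g : 'rV[R]_n -> R[i]) :
    'rV[R]_n -> R[i] :=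
  fun z => Complex (partial k (fun y => complex.Re (g y)) z)
                   (partial k (fun y => complex.Im (g y)) z).

(* The functionals f(x) = g(z_1, ..., z_n), z_k = \int_0^1 e_k(t) dx(t), in the
   class S whose step functions e_k only jump at times in I; I = [0, 1] gives
   the whole of S. *)
Record smooth_functional (R : realType) (I : set R) := SmoothFunctional {
  sf_n : nat ;
  sf_e : 'I_sf_n -> step R R ;
  sf_g : 'rV[R]_sf_n -> R[i] ;
  sf_e_on : forall k, step_on I (sf_e k) ;
  sf_g_smooth : cCpinf sf_g
}.

Arguments sf_n {R I} s.
Arguments sf_e {R I} s _.
Arguments sf_g {R I} s _.

Section malliavin.
Context (R : realType) (I : set R) (f : smooth_functional I).

Definition sf_z (x : R -> R) : 'rV[R]_(sf_n f) :=
  \row_(k < sf_n f) step_int (sf_e f k) x.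

Definition sf_eval (x : R -> R) : R[i] := sf_g f (sf_z x).

Definition malliavinD (t : R) (x : R -> R) : R[i] :=
  \sum_(k < sf_n f)
    cpartial k (sf_g f) (sf_z x) * (step_fun (sf_e f k) t)%:C%C.

(* The step function s |-> D^2_{t,s} f(x). *)
Definition malliavinD2 (t : R) (x : R -> R) : step R[i] R :=
  \big[cat/[::]]_(k < sf_n f) \big[cat/[::]]_(l < sf_n f)
    step_scale (cpartial k (cpartial l (sf_g f)) (sf_z x)
                * (step_fun (sf_e f k) t)%:C%C)
               (sf_e f l).

Lemma malliavinD2E t x s :
  cstep_fun (malliavinD2 t x) s =
  \sum_(k < sf_n f) \sum_(l < sf_n f)
    cpartial k (cpartial l (sf_g f)) (sf_z x)
    * (step_fun (sf_e f k) t)%:C%C * (step_fun (sf_e f l) s)%:C%C.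
Proof.
have s0 : cstep_fun [::] s = 0 :> R[i] by rewrite /cstep_fun big_nil.
have sD : {morph (fun e => cstep_fun e s) : e1 e2 / e1 ++ e2 >-> e1 + e2}.
  by move=> e1 e2; rewrite /cstep_fun big_cat.
rewrite /malliavinD2 (big_morph _ sD s0); apply: eq_bigr => k _.
rewrite (big_morph _ sD s0); apply: eq_bigr => l _; rewrite /cstep_fun.
set c := (X in step_scale X _); rewrite -/c.
rewrite /step_scale big_map /step_fun rmorph_sum mulr_sumr.
by apply: eq_bigr => p _; rewrite /= rmorphM mulrA.
Qed.

End malliavin.

(** ** The integration by parts identity *)

(* Equality of the two expectations for a given f, including the fact that all
   the integrals involved exist. *)
Definition ibp_identity d (T : measurableType d) (R : realType)
    (P : probability T R) (X : R -> T -> R) (K : R * R -> R) (I : set R)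
    (f : smooth_functional I) : Prop :=
  let lhs w t := (X t w)%:C%C * malliavinD f t (X^~ w) in
  let rhs w t s := (K (t, s))%:C%C * Kstar K (malliavinD2 f t (X^~ w)) s in
  let Lhs w := cintegral (@leb01 R) (lhs w) in
  let Rhs w := cintegral (@leb01 R)
                 (fun t => cintegral (@leb01 R) (fun s => rhs w t s)) in
  [/\ {ae P, forall w, cintegrable (@leb01 R) (lhs w)},
      {ae P, forall w, cintegrable (@leb01 R \x @leb01 R)%E
                         (fun p => rhs w p.1 p.2)},
      cintegrable P Lhs,
      cintegrable P Rhs &
      cintegral P Lhs = cintegral P Rhs].

(** ** Full sets of times *)

(* K is a class in L^2([0,1]^2) and X one in L^2(dt (x) P), so neither K(t, .)
   nor X_t means anything at an individual time t: properties required for all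
   times are read as holding for all times in a set of full Lebesgue measure.
   This is needed: adding a constant to X_t at a single time t preserves the
   integration by parts identities for all f but not E[X_t] = 0. *)
Definition full_times (R : realType) (I : set R) : Prop :=
  I `<=` `[0, 1] /\ (@leb01 R).-negligible (~` I).

(* Main.v *)
Require Import Defs.
From HB Require Import structures.
From mathcomp Require Import all_boot all_order all_algebra.
From mathcomp Require Import complex.
From mathcomp Require Import all_classical all_reals all_analysis.
From mathcomp Require Import measurable_realfun ring lra.
Import Order.TTheory GRing.Theory Num.Theory.
Import numFieldNormedType.Exports.
Set Implicit Arguments.
Unset Strict Implicit.
Unset Printing Implicit Defensive.
Local Open Scope classical_set_scope.
Local Open Scope ring_scope.

(** A Gaussian process satisfies the identity because of the finite-dimensional
    Gaussian integration by parts formula: decompose the vector [Z] as [c Y] plus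
    a part independent of [Y], and apply Stein's identity to the normal variable
    [Y]; Fubini's theorem then integrates over the time [t].

    Conversely, the functionals [f(x) = - cos (z + th)], [z = \int_0^1 e dx], give
    the identity for linear functionals of the path.  Step functions approximate
    bounded functions [h] by a Monte Carlo argument, which leads to
      [E (sin (x_h + th) x_{Vh}) = <k_h, k_{Vh}> E cos (x_h + th)],
    where [x_h = \int h X], [k_h = \int h(t) K(t, .) dt] and [V] is the Volterra
    operator [(V h)(t) = \int_t^1 h].  So [E cos (x_h + th) exp (|k_h|^2 / 2)] is
    constant along the flow [h' = - V h]; since [h] tends weakly to [0] along this
    flow, the constant is [cos th], and [x_h] is normal with variance [|k_h|^2].
    By Lebesgue's differentiation theorem almost every [X_t] is a limit of such
    variables [x_h], with [K(t, .)] the limit of the corresponding [k_h]. *)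

(** The converse sees X, K and the kernel of V as three square integrable processes, the last two
    over the probability space [0,1]; x_h, k_h and V h are then one construction. V enters because
    the Malliavin derivative of \int e dx is e itself: when \int e dx approximates x_h, the
    functional of the measure h(t) dt, the step function e approximates the tail \int_t^1 h. Hence
    the identity relates x_h to x_{Vh}, and V has no eigenvector, so that no h yields Stein's
    equation for a single variable; this forces the flow. Its convergence rests on two energies: <h,
    V h> = (\int h)^2 / 2 is nonnegative, so the norm of h stays bounded, and \int t h(t)^2 dt
    decreases at the rate \int (V h)^2. The flow is replaced by Euler's scheme, whose local error is
    quadratic in the step. Weak convergence suffices because h |-> x_h and h |-> k_h are compact. As
    X and K have a meaning only almost everywhere, they are modified on null sets until all sections
    are square integrable, and sample times are drawn from a set of full measure. *)

Definition rint d (T : measurableType d) (R : realType)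
    (mu : {measure set T -> \bar R}) (f : T -> R) : Prop :=
  mu.-integrable setT (EFin \o f).

(** * Real-valued integrals and square integrable functions *)

Section rint_theory.
Context d (T : measurableType d) (R : realType).
Variable mu : {measure set T -> \bar R}.
Implicit Types f g h : T -> R.

Lemma rint_measurable f : rint mu f -> measurable_fun setT f.
Proof. by move=> /measurable_int /measurable_EFinP. Qed.

Lemma rintD f g : rint mu f -> rint mu g -> rint mu (fun x => f x + g x).
Proof. by move=> If Ig; exact: integrableD If Ig. Qed.

Lemma rintN f : rint mu f -> rint mu (fun x => - f x).
Proof. by move=> If; exact: integrableN If. Qed.

Lemma rintB f g : rint mu f -> rint mu g -> rint mu (fun x => f x - g x).
Proof. by move=> If Ig; apply: rintD => //; exact: rintN. Qed.

Lemma rintZl k f : rint mu f -> rint mu (fun x => k * f x).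
Proof. by move=> If; have := integrableZl measurableT k If. Qed.

Lemma rintZr k f : rint mu f -> rint mu (fun x => f x * k).
Proof. by move=> /(rintZl k); under eq_fun do rewrite mulrC. Qed.

Lemma rint0 : rint mu (fun=> 0).
Proof. exact: integrable0. Qed.

Lemma rint_sum I (s : seq I) (P : pred I) (F : I -> T -> R) :
  (forall i, rint mu (F i)) -> rint mu (fun x => \sum_(i <- s | P i) F i x).
Proof.
move=> IF; elim: s => [|i s ih].
  by under eq_fun do rewrite big_nil; exact: rint0.
under eq_fun do rewrite big_cons.
by case: (P i) => //; exact: rintD.
Qed.

Lemma rint_le f g : measurable_fun setT f -> (forall x, `|f x| <= g x) ->
  rint mu g -> rint mu f.
Proof.
move=> mf fg; apply: le_integrable => //; first exact/measurable_EFinP.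
by move=> x _ /=; rewrite lee_fin (le_trans (fg x))// ler_norm.
Qed.

Lemma rint_abs f : rint mu f -> rint mu (fun x => `|f x|).
Proof. exact: integrable_norm. Qed.

Lemma rintMl f h (M : R) : rint mu f -> measurable_fun setT h ->
  (forall x, `|h x| <= M) -> rint mu (fun x => h x * f x).
Proof.
move=> If mh hM; apply: (@rint_le _ (fun x => M * `|f x|)).
- by apply: measurable_funM => //; exact: rint_measurable.
- by move=> x; rewrite normrM ler_wpM2r.
- exact/rintZl/rint_abs.
Qed.

Lemma RintD f g : rint mu f -> rint mu g ->
  \int[mu]_x (f x + g x) = \int[mu]_x f x + \int[mu]_x g x.
Proof. exact: RintegralD. Qed.

Lemma RintB f g : rint mu f -> rint mu g ->
  \int[mu]_x (f x - g x) = \int[mu]_x f x - \int[mu]_x g x.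
Proof. exact: RintegralB. Qed.

Lemma RintZl k f : rint mu f -> \int[mu]_x (k * f x) = k * \int[mu]_x f x.
Proof. exact: RintegralZl. Qed.

Lemma RintZr k f : rint mu f -> \int[mu]_x (f x * k) = \int[mu]_x f x * k.
Proof. exact: RintegralZr. Qed.

Lemma Rint0 : \int[mu]_x (0 : R) = 0.
Proof. by rewrite /Rintegral integral0. Qed.

Lemma Rint_sum I (s : seq I) (P : pred I) (F : I -> T -> R) :
  (forall i, rint mu (F i)) ->
  \int[mu]_x (\sum_(i <- s | P i) F i x) = \sum_(i <- s | P i) \int[mu]_x F i x.
Proof.
move=> IF; elim: s => [|i s ih].
  by under eq_Rintegral do rewrite big_nil; rewrite Rint0 big_nil.
under eq_Rintegral do rewrite big_cons; rewrite big_cons.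
by case: (P i) => //; rewrite RintD ?ih//; exact: rint_sum.
Qed.

Lemma le_Rint f g : rint mu f -> rint mu g -> (forall x, f x <= g x) ->
  \int[mu]_x f x <= \int[mu]_x g x.
Proof. by move=> If Ig fg; apply: le_Rintegral. Qed.

Lemma Rint_ge0 f : (forall x, 0 <= f x) -> 0 <= \int[mu]_x f x.
Proof. by move=> f0; apply: Rintegral_ge0. Qed.

Lemma ler_norm_Rint f : rint mu f -> `|\int[mu]_x f x| <= \int[mu]_x `|f x|.
Proof. by move=> If; apply: le_normr_Rintegral. Qed.

Lemma EFin_Rint f : rint mu f ->
  ((\int[mu]_x f x)%:E = \int[mu]_x (f x)%:E)%E.
Proof. by move=> If; rewrite fineK//; exact: integrable_fin_num If. Qed.

Lemma ae_rint f g : measurable_fun setT g -> {ae mu, forall x, f x = g x} ->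
  rint mu f -> rint mu g.
Proof.
move=> mg fg If; have mf := rint_measurable If.
apply/integrableP; split; first exact/measurable_EFinP.
case/integrableP : If => _; apply: le_lt_trans.
rewrite le_eqVlt; apply/orP; left; apply/eqP.
apply: ae_eq_integral => //.
- by do 2 apply: measurableT_comp => //.
- by do 2 apply: measurableT_comp => //.
- by move: fg; apply: filterS => x /= ->.
Qed.

Lemma ae_Rint f g : measurable_fun setT f -> measurable_fun setT g ->
  {ae mu, forall x, f x = g x} -> \int[mu]_x f x = \int[mu]_x g x.
Proof.
move=> mf mg fg; congr fine; apply: ae_eq_integral => //.
- exact/measurable_EFinP.
- exact/measurable_EFinP.
- by move: fg; apply: filterS => x /= ->.
Qed.

Lemma Rint_cvg (F : nat -> T -> R) f g :
  (forall n, measurable_fun setT (F n)) -> rint mu g ->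
  (forall n x, `|F n x| <= g x) -> (forall x, F n x @[n --> \oo] --> f x) ->
  rint mu f /\ \int[mu]_x F n x @[n --> \oo] --> \int[mu]_x f x.
Proof.
move=> mF Ig Fg Ff.
have mf : measurable_fun setT f.
  by apply: (measurable_fun_cvg mF) => x _; exact: Ff.
have [] := @dominated_convergence _ T R mu setT measurableT
  (fun n => EFin \o F n) (EFin \o f) (EFin \o g).
- by move=> n; exact/measurable_EFinP.
- exact/measurable_EFinP.
- by apply: aeW => x _; apply: cvg_EFin; [exact: nearW|exact: Ff].
- exact: Ig.
- by apply: aeW => x n _; rewrite lee_fin.
move=> If _ cF; split => //.
apply: fine_cvg; rewrite /= fineK//; exact: integrable_fin_num If.
Qed.

(** Measurability of [f] is a separate requirement because that of its square does not imply it. *)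
Definition sqint f := measurable_fun setT f /\ rint mu (fun x => f x ^+ 2).

Lemma sqint_measurable f : sqint f -> measurable_fun setT f.
Proof. by case. Qed.

Lemma sqintM f g : sqint f -> sqint g -> rint mu (fun x => f x * g x).
Proof.
move=> [mf If] [mg Ig]; apply: (@rint_le _ (fun x => f x ^+ 2 + g x ^+ 2)).
- exact: measurable_funM.
- move=> x; rewrite ler_norml; apply/andP; split; nra.
- exact: rintD.
Qed.

Lemma sqintD f g : sqint f -> sqint g -> sqint (fun x => f x + g x).
Proof.
move=> Sf Sg; have [mf If] := Sf; have [mg Ig] := Sg.
split; first exact: measurable_funD.
have := rintD (rintD If Ig) (rintZl 2 (sqintM Sf Sg)).
by apply: eq_integrable => // x _ /=; congr EFin; ring.
Qed.

Lemma sqintZl k f : sqint f -> sqint (fun x => k * f x).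
Proof.
move=> [mf If]; split; first exact: measurable_funM.
by have := rintZl (k ^+ 2) If; apply: eq_integrable => // x _ /=; rewrite exprMn.
Qed.

Lemma sqintN f : sqint f -> sqint (fun x => - f x).
Proof. by move=> /(sqintZl (-1)); under eq_fun do rewrite mulN1r. Qed.

Lemma sqintB f g : sqint f -> sqint g -> sqint (fun x => f x - g x).
Proof. by move=> Sf Sg; apply: sqintD => //; exact: sqintN. Qed.

Lemma sqint0 : sqint (fun=> 0).
Proof. by split => //; rewrite expr0n; exact: rint0. Qed.

Lemma sqint_sum I (s : seq I) (P : pred I) (F : I -> T -> R) :
  (forall i, sqint (F i)) -> sqint (fun x => \sum_(i <- s | P i) F i x).
Proof.
move=> SF; elim: s => [|i s ih].
  by under eq_fun do rewrite big_nil; exact: sqint0.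
under eq_fun do rewrite big_cons.
by case: (P i) => //; exact: sqintD.
Qed.

Lemma sqint_abs f : sqint f -> sqint (fun x => `|f x|).
Proof.
move=> [mf If]; split; first exact: measurableT_comp.
by apply: eq_integrable If => // x _ /=; rewrite real_normK// num_real.
Qed.

Lemma sqintMl f h (M : R) : sqint f -> measurable_fun setT h ->
  (forall x, `|h x| <= M) -> sqint (fun x => h x * f x).
Proof.
move=> [mf If] mh hM; split; first exact: measurable_funM.
under eq_fun do rewrite exprMn.
apply: (@rintMl _ (fun x => h x ^+ 2) (M ^+ 2)) => //.
  exact: measurable_funX.
move=> x; rewrite normrX lerXn2r// ?nnegrE//.
exact: le_trans (hM x).
Qed.

Lemma sqint_le f g : measurable_fun setT f -> (forall x, `|f x| <= `|g x|) ->
  sqint g -> sqint f.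
Proof.
move=> mf fg [mg Ig]; split => //; apply: rint_le Ig.
  exact: measurable_funX.
move=> x; rewrite normrX -[leRHS]real_normK ?num_real//.
by rewrite lerXn2r ?nnegrE.
Qed.

Lemma Rint_sqrD f g : sqint f -> sqint g ->
  \int[mu]_x (f x + g x) ^+ 2 =
  \int[mu]_x (f x ^+ 2) + 2 * \int[mu]_x (f x * g x) + \int[mu]_x (g x ^+ 2).
Proof.
move=> Sf Sg; have [mf If] := Sf; have [mg Ig] := Sg; have Ifg := sqintM Sf Sg.
rewrite -RintZl// -RintD//; last exact: rintZl.
rewrite -RintD//; last by apply: rintD => //; exact: rintZl.
by apply: eq_Rintegral => x _; ring.
Qed.

(** The quadratic polynomial t |-> \int (f + t g)^2 is nonnegative; its value at the minimum t = - c
    / b gives the inequality when b is nonzero. *)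
Lemma Rint_CS f g : sqint f -> sqint g ->
  (\int[mu]_x (f x * g x)) ^+ 2 <=
  \int[mu]_x (f x ^+ 2) * \int[mu]_x (g x ^+ 2).
Proof.
move=> Sf Sg.
set a := \int[mu]_x f x ^+ 2; set b := \int[mu]_x g x ^+ 2.
set c := \int[mu]_x _.
have q t : 0 <= a + 2 * (t * c) + t ^+ 2 * b.
  have : 0 <= \int[mu]_x (f x + t * g x) ^+ 2.
    by apply: Rint_ge0 => x; exact: sqr_ge0.
  rewrite Rint_sqrD//; last exact: sqintZl.
  have <- : \int[mu]_x (f x * (t * g x)) = t * c.
    rewrite /c -RintZl; last exact: sqintM.
    by apply: eq_Rintegral => x _; rewrite mulrCA.
  suff -> : \int[mu]_x (t * g x) ^+ 2 = t ^+ 2 * b by [].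
  rewrite /b -RintZl; last exact: Sg.2.
  by apply: eq_Rintegral => x _; rewrite exprMn.
have a0 : 0 <= a by apply: Rint_ge0 => x; exact: sqr_ge0.
have b0 : 0 <= b by apply: Rint_ge0 => x; exact: sqr_ge0.
have [b00|b_neq0] := eqVneq b 0.
  have [->|c0] := eqVneq c 0; first by rewrite expr0n mulr_ge0.
  (* For b = 0 the polynomial is affine, and at this point it would take the value -1. *)
  have := q (- (a + 1) / (2 * c)); rewrite b00 mulr0 addr0.
  have -> : 2 * (- (a + 1) / (2 * c) * c) = - (a + 1) by field.
  by lra.
have bgt0 : 0 < b by rewrite lt_neqAle eq_sym b_neq0.
have := q (- c / b).
have -> : a + 2 * (- c / b * c) + (- c / b) ^+ 2 * b = a - c ^+ 2 / b by field.
by rewrite subr_ge0 ler_pdivrMr.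
Qed.

End rint_theory.

Section rint_prob.
Context d (T : measurableType d) (R : realType).
Variable P : probability T R.
Implicit Types f g h : T -> R.

Lemma rint_cst k : rint P (fun=> k).
Proof. exact: finite_measure_integrable_cst. Qed.

Lemma Rint_cst k : \int[P]_x (k : R) = k.
Proof. by rewrite Rintegral_cst// [X in fine X]probability_setT mulr1. Qed.

Lemma rint_bounded f M : measurable_fun setT f -> (forall x, `|f x| <= M) ->
  rint P f.
Proof. by move=> mf fM; apply: (rint_le mf fM); exact: rint_cst. Qed.

Lemma ler_norm_Rint_bounded f M : measurable_fun setT f ->
  (forall x, `|f x| <= M) -> `|\int[P]_x f x| <= M.
Proof.
move=> mf fM; have If := rint_bounded mf fM.
rewrite (le_trans (ler_norm_Rint If))// -[leRHS]Rint_cst.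
by apply: le_Rint => //; [exact: rint_abs|exact: rint_cst].
Qed.

Lemma sqint_cst k : sqint P (fun=> k).
Proof. by split => //; exact: rint_cst. Qed.

Lemma sqint_bounded f M : measurable_fun setT f -> (forall x, `|f x| <= M) ->
  sqint P f.
Proof.
move=> mf fM; split => //; apply: (@rint_bounded _ (M ^+ 2)).
  exact: measurable_funX.
by move=> x; rewrite normrX lerXn2r// nnegrE// (le_trans _ (fM x)).
Qed.

Lemma sqint_rint f : sqint P f -> rint P f.
Proof.
move=> Sf; have := sqintM (sqint_cst 1) Sf.
by under eq_fun do rewrite mul1r.
Qed.

Lemma Rint_Jensen f : sqint P f -> (\int[P]_x f x) ^+ 2 <= \int[P]_x (f x ^+ 2).
Proof.
move=> Sf; have := Rint_CS (sqint_cst 1) Sf.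
under eq_Rintegral do rewrite mul1r.
by rewrite Rint_cst expr1n mul1r.
Qed.

Lemma Rint_abs_sqr f : sqint P f -> \int[P]_x `|f x| <= Num.sqrt (\int[P]_x (f x ^+ 2)).
Proof.
move=> Sf; have := Rint_Jensen (sqint_abs Sf).
under [X in _ <= X]eq_Rintegral do rewrite real_normK ?num_real//.
move=> /ler_wsqrtr; rewrite sqrtr_sqr ger0_norm//.
exact: Rint_ge0.
Qed.

End rint_prob.
Arguments rint_bounded {d T R} P {f M}.
Arguments ler_norm_Rint_bounded {d T R} P {f M}.
Arguments sqint_bounded {d T R} P {f M}.
Arguments sqint_rint {d T R} P {f}.
Arguments Rint_Jensen {d T R} P {f}.
Arguments Rint_abs_sqr {d T R} P {f}.

(** * Fubini's theorem for real-valued integrals *)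

Section Rint_Fubini.
Context d1 d2 (T1 : measurableType d1) (T2 : measurableType d2) (R : realType).
Variables (m1 : {sigma_finite_measure set T1 -> \bar R}).
Variables (m2 : {sigma_finite_measure set T2 -> \bar R}).
Implicit Types f : T1 * T2 -> R.

(** The real integral is the finite part of a difference of two extended integrals, each measurable
    in the parameter by Tonelli's theorem; integrability of the sections plays no part in this. *)
Lemma measurable_Rint1 f : measurable_fun setT f ->
  measurable_fun setT (fun x => \int[m2]_y f (x, y)).
Proof.
move=> mf; apply: (@measurableT_comp _ _ _ _ _ _ (@fine R)) => //.
have mEf : measurable_fun setT (EFin \o f) by exact/measurable_EFinP.
rewrite (_ : (fun x => _) = (fun x => (\int[m2]_y ((EFin \o f)^\+ (x, y)) -
                            \int[m2]_y ((EFin \o f)^\- (x, y)))%E)); last first.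
  apply/funext => x; rewrite [LHS]integralE.
  under [in LHS]eq_integral do rewrite funeposE.
  under [X in (_ - X)%E = _]eq_integral do rewrite funenegE.
  by congr (_ - _)%E; apply: eq_integral => y _; rewrite ?funeposE ?funenegE.
apply: emeasurable_funB.
- apply: (@measurable_fun_fubini_tonelli_F _ _ _ _ _ _ (EFin \o f)^\+)%E => //.
  exact: measurable_funepos.
- apply: (@measurable_fun_fubini_tonelli_F _ _ _ _ _ _ (EFin \o f)^\-)%E => //.
  exact: measurable_funeneg.
Qed.

Lemma measurable_Rint2 f : measurable_fun setT f ->
  measurable_fun setT (fun y => \int[m1]_x f (x, y)).
Proof.
move=> mf; apply: (@measurableT_comp _ _ _ _ _ _ (@fine R)) => //.
have mEf : measurable_fun setT (EFin \o f) by exact/measurable_EFinP.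
rewrite (_ : (fun x => _) = (fun y => (\int[m1]_x ((EFin \o f)^\+ (x, y)) -
                            \int[m1]_x ((EFin \o f)^\- (x, y)))%E)); last first.
  apply/funext => x; rewrite [LHS]integralE.
  by congr (_ - _)%E; apply: eq_integral => y _; rewrite ?funeposE ?funenegE.
apply: emeasurable_funB.
- apply: (@measurable_fun_fubini_tonelli_G _ _ _ _ _ _ (EFin \o f)^\+)%E => //.
  exact: measurable_funepos.
- apply: (@measurable_fun_fubini_tonelli_G _ _ _ _ _ _ (EFin \o f)^\-)%E => //.
  exact: measurable_funeneg.
Qed.

(** Sections are integrable only for almost every x; elsewhere the inner real integral is a default
    value, so it is compared with the extended one almost everywhere. *)
Lemma rint_Fubini1 f : rint (m1 \x m2)%E f ->
  rint m1 (fun x => \int[m2]_y f (x, y)) /\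
  \int[m1]_x (\int[m2]_y f (x, y)) = \int[(m1 \x m2)%E]_z f z.
Proof.
move=> If; have mf := rint_measurable If.
have aeE : {ae m1, forall x,
    (fubini_F m2 (EFin \o f) x = (\int[m2]_y f (x, y))%:E)%E}.
  have := ae_integrable1 If; apply: filterS => x Ix.
  by rewrite /fubini_F (EFin_Rint Ix).
have IF := integrable_fubini_F If.
have mF : measurable_fun setT (fun x => \int[m2]_y f (x, y)).
  exact: measurable_Rint1.
have eqI : (\int[m1]_x (\int[m2]_y f (x, y))%:E = \int[m1]_x fubini_F m2 (EFin \o f) x)%E.
  apply: ae_eq_integral => //; first exact/measurable_EFinP.
    exact: measurable_int IF.
  by move: aeE; apply: filterS => x /= ->.
split; last by rewrite /Rintegral eqI integral12_prod_meas1.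
apply/integrableP; split; first exact/measurable_EFinP.
case/integrableP: IF => mIF; apply: le_lt_trans.
rewrite le_eqVlt; apply/orP; left; apply/eqP.
apply: ae_eq_integral => //.
- by apply: measurableT_comp => //; exact/measurable_EFinP.
- exact: measurableT_comp.
- by move: aeE; apply: filterS => x /= ->.
Qed.

Lemma rint_Fubini2 f : rint (m1 \x m2)%E f ->
  \int[m2]_y (\int[m1]_x f (x, y)) = \int[(m1 \x m2)%E]_z f z.
Proof.
move=> If; have mf := rint_measurable If.
rewrite /Rintegral -integral21_prod_meas1//; congr fine.
apply: ae_eq_integral => //.
- exact/measurable_EFinP/measurable_Rint2.
- exact: (measurable_fubini_G If).
- have := ae_integrable2 If; apply: filterS => x Ix _.
  by rewrite /fubini_G (EFin_Rint Ix).
Qed.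

Lemma Rint_Fubini f : rint (m1 \x m2)%E f ->
  \int[m1]_x (\int[m2]_y f (x, y)) = \int[m2]_y (\int[m1]_x f (x, y)).
Proof. by move=> If; rewrite (rint_Fubini1 If).2 rint_Fubini2. Qed.

End Rint_Fubini.

Section rint_swap.
Context d1 d2 (T1 : measurableType d1) (T2 : measurableType d2) (R : realType).
Variables (m1 : {sigma_finite_measure set T1 -> \bar R}).
Variables (m2 : {sigma_finite_measure set T2 -> \bar R}).

Lemma rint_swap (f : T1 * T2 -> R) :
  rint (m1 \x m2)%E f -> rint (m2 \x m1)%E (fun p => f (p.2, p.1)).
Proof.
move=> If; have mf := rint_measurable If.
apply/integrable12ltyP.
  by apply/measurable_EFinP; apply: measurableT_comp => //; exact: measurable_fun_pair.
by have /= := (@integrable21ltyP _ _ _ _ _ m1 m2 _ (measurable_int _ If)).1 If.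
Qed.

End rint_swap.

(** * Bernstein operators and uniqueness of laws *)

(* The expectation of [f (S_m)], [S_m] binomial with parameters [m] and [x]. *)
Fixpoint bern (R : nzRingType) (m : nat) (x : R) (f : nat -> R) : R :=
  if m is m'.+1 then
    x * bern m' x (fun k => f k.+1) + (1 - x) * bern m' x f
  else f 0%N.

Section bernstein.
Variable R : realType.
Implicit Types (x : R) (f g : nat -> R).

Lemma bernD m x f g : bern m x (fun k => f k + g k) = bern m x f + bern m x g.
Proof. by elim: m f g => //= m ih f g; rewrite !ih; ring. Qed.

Lemma bernZ m x c f : bern m x (fun k => c * f k) = c * bern m x f.
Proof. by elim: m f => //= m ih f; rewrite !ih; ring. Qed.

Lemma bern_cst m x c : bern m x (fun=> c) = c.
Proof. by elim: m => //= m ->; ring. Qed.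

Lemma le_bern m x f g : 0 <= x <= 1 ->
  (forall k, (k <= m)%N -> f k <= g k) -> bern m x f <= bern m x g.
Proof.
move=> /andP[x0 x1]; elim: m f g => [|m ih] f g fg /=; first exact: fg.
apply: lerD; apply: ler_wpM2l; rewrite ?subr_ge0//; apply: ih => k km.
- exact: fg.
- by apply: fg; rewrite (leq_trans km).
Qed.

Lemma bern_le m x f M : 0 <= x <= 1 ->
  (forall k, (k <= m)%N -> `|f k| <= M) -> `|bern m x f| <= M.
Proof.
move=> x01 fM; rewrite ler_norml -{1}(bern_cst m x (- M)) -{2}(bern_cst m x M).
by apply/andP; split; apply: le_bern => // k /fM; rewrite ler_norml => /andP[].
Qed.

(** Variance plus squared bias of a binomial variable. *)
Lemma bern_sqr m x c :
  bern m x (fun k => (k%:R - c) ^+ 2) = m%:R * x * (1 - x) + (m%:R * x - c) ^+ 2.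
Proof.
elim: m c => [|m ih] c /=; first by ring.
rewrite (_ : (fun k : nat => _) = (fun k => (k%:R - (c - 1)) ^+ 2 : R)).
  by rewrite !ih -natr1; ring.
by apply/funext => k; rewrite -natr1; congr (_ ^+ 2); ring.
Qed.

(** Bernstein's argument through Chebyshev's inequality: the deviation of [phi] is at most e / 2
    within distance d of x, and elsewhere at most 2 M, which is dominated by C (x - k / m)^2; the
    expectation of this square is at most 1 / m. *)
Lemma bern_cvg (phi : R -> R) M x : 0 <= x <= 1 ->
  (forall y, 0 <= y <= 1 -> `|phi y| <= M) -> {for x, continuous phi} ->
  bern m.+1 x (fun k => phi (k%:R / m.+1%:R)) @[m --> \oo] --> phi x.
Proof.
move=> x01 phiM cphi.
have M0 : 0 <= M by apply: le_trans (phiM _ x01).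
apply/cvgrPdist_le => /= e e0.
have e20 : 0 < e / 2 by rewrite divr_gt0.
move/cvgrPdist_le : cphi => /(_ _ e20) /nbhs_ballP[d /= d0 phid].
pose C := 2 * M / d ^+ 2.
have C0 : 0 <= C by apply: divr_ge0; [exact: mulr_ge0|exact: sqr_ge0].
near=> m.
pose F k := phi x + -1 * phi (k%:R / m.+1%:R).
have -> : phi x - bern m.+1 x (fun k => phi (k%:R / m.+1%:R)) = bern m.+1 x F.
  by rewrite bernD bernZ bern_cst mulN1r.
pose G := (fun k : nat => e / 2 + (C / m.+1%:R ^+ 2) * (k%:R - m.+1%:R * x) ^+ 2).
have m0 : (m.+1%:R : R) != 0 by rewrite pnatr_eq0.
have FG k : (k <= m.+1)%N -> `|F k| <= G k.
  move=> km; rewrite /F mulN1r.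
  have k01 : 0 <= (k%:R / m.+1%:R : R) <= 1.
    by rewrite divr_ge0//= ler_pdivrMr ?ltr0n// mul1r ler_nat.
  have Gk : G k = e / 2 + C * (x - k%:R / m.+1%:R) ^+ 2.
    by rewrite /G; congr (_ + _); move: m0; set n := m.+1%:R => n0; field.
  have [xk|xk] := ltP `|x - k%:R / m.+1%:R| d.
    rewrite Gk (le_trans (phid _ xk))// lerDl mulr_ge0 ?sqr_ge0//.
  rewrite Gk; apply: (@le_trans _ _ (2 * M)).
    apply: le_trans (ler_normB _ _) _.
    by rewrite [2]mulr2n mulrDl mul1r lerD// phiM.
  rewrite -[leLHS]add0r lerD ?(ltW e20)// /C -mulrAC ler_pdivlMr ?exprn_gt0//.
  rewrite ler_wpM2l ?mulr_ge0// -[leRHS]real_normK ?num_real//.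
  by rewrite lerXn2r// nnegrE ltW.
have bG : bern m.+1 x G = e / 2 + C * (x * (1 - x) / m.+1%:R).
  rewrite bernD bern_cst bernZ bern_sqr subrr; congr (_ + _).
  by move: m0; set n := m.+1%:R => n0; field.
have {}bG : bern m.+1 x G <= e.
  have -> : e = e / 2 + e / 2 by rewrite -splitr.
  rewrite bG lerD2l; apply: (@le_trans _ _ (C / m.+1%:R)).
    rewrite mulrA ler_wpM2r ?invr_ge0// ler_piMr//.
    by move: x01 => /andP[x0 x1]; rewrite mulr_ile1// ?subr_ge0// gerBl.
  rewrite ler_pdivrMr ?ltr0n// mulrC -ler_pdivrMr//.
  rewrite (le_trans (y := m%:R)) ?ler_nat//.
  by near: m; exact: nbhs_infty_ger.
rewrite (le_trans _ bG)// ler_norml; apply/andP; split.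
  rewrite -mulN1r -bernZ; apply: le_bern => // k /FG.
  by rewrite ler_norml mulN1r => /andP[].
by apply: le_bern => // k /FG; rewrite ler_norml => /andP[].
Unshelve. all: by end_near. Qed.

End bernstein.

Lemma row_cvg (R : realType) N (T : Type) (F : set_system T) (FF : Filter F)
    (f : T -> 'rV[R]_N) (l : 'rV[R]_N) :
  (forall j, f t 0 j @[t --> F] --> l 0 j) -> f t @[t --> F] --> l.
Proof.
move=> fl; apply/cvg_ballP => e e0.
have : \forall t \near F, forall j, ball (l 0 j) e (f t 0 j).
  apply: filter_forall => j.
  by have /cvg_ballP := fl j; exact.
by apply: filterS => t tj; split => // i j; rewrite (ord1 i).
Qed.

Section bernstein_closure.
Variables (R : realType) (N : nat) (D : Type) (u : 'I_N -> D -> R).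
Hypothesis u01 : forall i x, 0 <= u i x <= 1.
Variable H : (D -> R) -> Prop.
Hypothesis H_cst : forall c, H (fun=> c).
Hypothesis H_add : forall f g, H f -> H g -> H (fun x => f x + g x).
Hypothesis H_scale : forall c f, H f -> H (fun x => c * f x).
Hypothesis H_mul : forall i f, H f -> H (fun x => u i x * f x).
Hypothesis H_lim : forall (F : nat -> D -> R) f M, (forall n, H (F n)) ->
  (forall n x, `|F n x| <= M) -> (forall x, F n x @[n --> \oo] --> f x) -> H f.

Let H_bern i m (F : nat -> D -> R) : (forall k, H (F k)) ->
  H (fun x => bern m (u i x) (F ^~ x)).
Proof.
elim: m F => [|m ih] F HF /=; first exact: HF.
have -> : (fun x => u i x * bern m (u i x) (fun k => F k.+1 x) +
                   (1 - u i x) * bern m (u i x) (F ^~ x)) =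
  (fun x => u i x * bern m (u i x) (fun k => F k.+1 x) +
   (bern m (u i x) (F ^~ x) + (-1) * (u i x * bern m (u i x) (F ^~ x)))).
  by apply/funext => x; ring.
apply: H_add; first by apply: H_mul; apply: ih.
by apply: H_add; [exact: ih|apply: H_scale; apply: H_mul; exact: ih].
Qed.

Let upd i (v : R) (y : 'rV[R]_N) : 'rV[R]_N := y + (v - y 0 i) *: delta_mx 0 i.

Let updE i v y j : upd i v y 0 j = if j == i then v else y 0 j.
Proof.
rewrite !mxE eqxx /=; case: eqP => [->|_]; rewrite /= ?mulr1 ?mulr0 ?addr0//.
by rewrite addrC subrK.
Qed.

Let continuous_upd_l i v : continuous (upd i v).
Proof.
move=> y; apply: (@row_cvg _ _ _ (nbhs y) (nbhs_filter y)) => j; rewrite updE; under eq_fun do rewrite updE.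
by case: eqP => _; [exact: cvg_cst|exact: coord_continuous].
Qed.

Let continuous_upd_r i y : continuous (upd i ^~ y).
Proof.
move=> v; apply: (@row_cvg _ _ _ (nbhs v) (nbhs_filter v)) => j; rewrite updE; under eq_fun do rewrite updE.
by case: eqP => _; [exact: cvg_id|exact: cvg_cst].
Qed.

Let row_u x : 'rV[R]_N := \row_i u i x.

(** One coordinate at a time is replaced by grid values averaged with the Bernstein operator. Each
    average is a polynomial in [u i] whose coefficients are functions of the remaining coordinates,
    so it stays in [H] by induction, and the bounded limit over finer grids restores the function.
    In the induction, [s] lists the coordinates on which [F] may still depend. *)
Lemma bernstein_closure (G : 'rV[R]_N -> R) M : continuous G ->
  (forall y : 'rV[R]_N, (forall i, 0 <= y 0 i <= 1) -> `|G y| <= M) ->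
  H (fun x => G (\row_i u i x)).
Proof.
move=> cG GM.
suff suffs (s : seq 'I_N) F : continuous F ->
    (forall y : 'rV[R]_N, (forall i, 0 <= y 0 i <= 1) -> `|F y| <= M) ->
    (forall y z : 'rV[R]_N, (forall i, i \in s -> y 0 i = z 0 i) -> F y = F z) ->
    H (fun x => F (row_u x)).
  apply: (suffs (enum 'I_N)) => // y z yz; congr G.
  by apply/rowP => i; apply: yz; rewrite mem_enum.
elim: s F => [|i s ih] F cF FM Fs.
  by rewrite (_ : (fun x => _) = fun=> F 0)//; apply/funext => x; exact: Fs.
have c01 k m : (k <= m.+1)%N -> 0 <= (k%:R / m.+1%:R : R) <= 1.
  move=> km.
  by rewrite divr_ge0//= ler_pdivrMr ?ltr0n// mul1r ler_nat.
(* The cap keeps the grid point in [0,1] for every k, since [H_bern] asks for membership in [H] at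
   all k, including those that the Bernstein operator never reaches. *)
pose c m k : R := (minn k m.+1)%:R / m.+1%:R.
have row_u01 x j : 0 <= row_u x 0 j <= 1 by rewrite mxE.
apply: (H_lim (F := fun m x =>
    bern m.+1 (u i x) (fun k => F (upd i (c m k) (row_u x)))) (M := M)).
- move=> m; apply: (@H_bern i m.+1 (fun k x => F (upd i (c m k) (row_u x)))) => k.
  apply: (ih (F \o upd i (c m k))).
  + by move=> y; apply: continuous_comp; [exact: continuous_upd_l|exact: cF].
  + move=> y y01; apply: FM => j; rewrite updE; case: eqP => // _.
    by apply: c01; exact: geq_minr.
  + move=> y z yz; apply: Fs => j; rewrite !updE inE; case: eqP => //= _.
    exact: yz.
- move=> m x; apply: bern_le => // k km; apply: FM => j; rewrite updE.
  by case: eqP => // _; apply: c01; exact: geq_minr.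
- move=> x; rewrite (_ : F (row_u x) = F (upd i (u i x) (row_u x))); last first.
    by congr F; apply/rowP => j; rewrite updE !mxE; case: eqP => [->|].
  have := @bern_cvg R (fun v => F (upd i v (row_u x))) M (u i x) (u01 i x).
  have -> : (fun m => bern m.+1 (u i x) (fun k => F (upd i (c m k) (row_u x)))) =
    (fun m => bern m.+1 (u i x) (fun k => F (upd i (k%:R / m.+1%:R) (row_u x)))).
    apply/funext => m; apply/eqP; rewrite eq_le; apply/andP.
    by split; apply: le_bern => // k /minn_idPl km; rewrite /c km.
  apply.
  + by move=> y y01; apply: FM => j; rewrite updE; case: eqP.
  + by apply: continuous_comp; [exact: continuous_upd_r|exact: cF].
Qed.

End bernstein_closure.

Lemma cvg_norm_le (R : realType) (u : nat -> R) (l M : R) :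
  (forall n, `|u n| <= M) -> u n @[n --> \oo] --> l -> `|l| <= M.
Proof.
move=> uM ul; have nul : `|u n| @[n --> \oo] --> `|l| by exact: cvg_norm.
apply: (@closed_cvg _ _ \oo _ (fun n => `|u n|) (fun y => y <= M) _ _ _ nul).
  exact: closed_le.
exact: nearW.
Qed.

(** * Elementary bounds for sine and cosine *)

Section trig_bounds.
Variable R : realType.
Implicit Types (x y : R).

Lemma MVT_between (f df : R -> R) (a b : R) :
  (forall x, is_derive x 1 f (df x)) ->
  exists2 c, `|c - a| <= `|b - a| & f b - f a = df c * (b - a).
Proof.
move=> fdf; have cf x : {for x, continuous f}.
  by apply: differentiable_continuous; apply/derivable1_diffP; case: (fdf x).
have [ab|/ltW ba] := leP a b.
  have [|c + fc] := MVT_segment ab (fun x _ => fdf x).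
    by apply: continuous_subspaceT => x; exact: cf.
  rewrite in_itv/= => /andP[ac cb]; exists c => //.
  by rewrite !ger0_norm ?subr_ge0// lerD2r.
have [|c + fc] := MVT_segment ba (fun x _ => fdf x).
  by apply: continuous_subspaceT => x; exact: cf.
rewrite in_itv/= => /andP[bc ca]; exists c.
  by rewrite !ler0_norm ?subr_le0// lerN2 lerD2r.
by apply: oppr_inj; rewrite opprB fc -mulrN opprB.
Qed.

Lemma sin_le_abs x : `|sin x| <= `|x|.
Proof.
have [c _] := @MVT_between sin cos 0 x (fun y => is_derive_sin y).
rewrite sin0 !subr0 => ->; rewrite normrM ler_piMl//; exact: cos_max.
Qed.

Lemma cos_sub1_le x : `|cos x - 1| <= `|x|.
Proof.
have [c _] := @MVT_between cos (fun y => - sin y) 0 x (fun y => is_derive_cos y).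
rewrite cos0 !subr0 => ->; rewrite normrM ler_piMl// normrN; exact: sin_max.
Qed.

Lemma cos_sub1_sqr x : `|cos x - 1| <= x ^+ 2.
Proof.
have [c cx] := @MVT_between cos (fun y => - sin y) 0 x (fun y => is_derive_cos y).
rewrite cos0 !subr0 in cx * => ->; rewrite normrM normrN.
rewrite -[leRHS]ger0_norm ?sqr_ge0// expr2 normrM ler_wpM2r//.
exact: le_trans (sin_le_abs _) cx.
Qed.

Lemma sin_sub_sqr x : `|sin x - x| <= x ^+ 2.
Proof.
have h y : is_derive y 1 (fun z : R => sin z - z) (cos y - 1).
  by apply: is_deriveB; exact: is_derive_id.
have [c cx] := MVT_between 0 x h.
rewrite sin0 !subr0 in cx * => ->; rewrite normrM.
rewrite -[leRHS]ger0_norm ?sqr_ge0// expr2 normrM ler_wpM2r//.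
exact: le_trans (cos_sub1_le _) cx.
Qed.

Lemma cos_taylor x y : `|cos (x + y) - cos x + y * sin x| <= 2 * y ^+ 2.
Proof.
rewrite cosD.
have -> : cos x * cos y - sin x * sin y - cos x + y * sin x =
  cos x * (cos y - 1) - sin x * (sin y - y) by ring.
rewrite (le_trans (ler_normB _ _))// !normrM mulr_natl mulr2n lerD//.
  by rewrite -[leRHS]mul1r ler_pM// ?cos_max// cos_sub1_sqr.
by rewrite -[leRHS]mul1r ler_pM// ?sin_max// sin_sub_sqr.
Qed.

Lemma cos_lipschitz x y : `|cos x - cos y| <= `|x - y|.
Proof.
have [c _] := @MVT_between cos (fun y => - sin y) y x (fun y => is_derive_cos y).
move=> ->; rewrite normrM ler_piMl// normrN; exact: sin_max.
Qed.

(** A truncation of x: bounded by n + 1 and by |x|, and tending to x. Being a multiple of a sine, it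
    remains within reach of the functions built from cosines of linear forms. *)
Definition sinL (n : nat) x := n.+1%:R * sin (x / n.+1%:R).

Lemma sinL_le n x : `|sinL n x| <= `|x|.
Proof.
rewrite /sinL normrM ger0_norm// -ler_pdivlMl ?ltr0n//.
rewrite (le_trans (sin_le_abs _))// normrM mulrC.
by rewrite [X in X * _]ger0_norm// invr_ge0.
Qed.

Lemma sinL_cvg x : sinL n x @[n --> \oo] --> x.
Proof.
apply/cvgrPdist_le => /= e e0; near=> n.
have n0 : (n.+1%:R : R) != 0 by rewrite pnatr_eq0.
have -> : x - sinL n x = - (n.+1%:R * (sin (x / n.+1%:R) - x / n.+1%:R)).
  by rewrite /sinL; move: n0; set k := n.+1%:R => k0; field.
rewrite normrN normrM ger0_norm// -ler_pdivlMl ?ltr0n//.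
rewrite (le_trans (sin_sub_sqr _))//.
have -> : (x / n.+1%:R) ^+ 2 = n.+1%:R^-1 * (x ^+ 2 / n.+1%:R).
  by move: n0; set k := n.+1%:R => k0; field.
rewrite ler_wpM2l ?invr_ge0// ler_pdivrMr ?ltr0n// -ler_pdivrMl//.
rewrite (le_trans (y := n%:R)) ?ler_nat//.
by near: n; exact: nbhs_infty_ger.
Unshelve. all: by end_near. Qed.

End trig_bounds.

(** * Continuity of real functions and functions of a row vector *)

Section continuous_real.
Variables (R : realType) (T : topologicalType).
Implicit Types f g : T -> R.

Lemma contM f g : continuous f -> continuous g -> continuous (fun x => f x * g x).
Proof. by move=> cf cg x; apply: cvgM; [exact: cf|exact: cg]. Qed.

Lemma contD f g : continuous f -> continuous g -> continuous (fun x => f x + g x).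
Proof. by move=> cf cg x; apply: cvgD; [exact: cf|exact: cg]. Qed.

Lemma contB f g : continuous f -> continuous g -> continuous (fun x => f x - g x).
Proof. by move=> cf cg x; apply: cvgB; [exact: cf|exact: cg]. Qed.

Lemma cont_cst (c : R) : continuous (fun _ : T => c).
Proof. by move=> x; exact: cvg_cst. Qed.

Lemma cont_sum I (s : seq I) (F : I -> T -> R) :
  (forall i, continuous (F i)) -> continuous (fun x => \sum_(i <- s) F i x).
Proof.
move=> cF; elim: s => [|i s ih].
  by under eq_fun do rewrite big_nil; exact: cont_cst.
by under eq_fun do rewrite big_cons; exact: contD.
Qed.

Lemma cont_comp (U : topologicalType) (g : U -> R) (f : T -> U) :
  continuous f -> continuous g -> continuous (fun x => g (f x)).
Proof. by move=> cf cg x; apply: continuous_comp; [exact: cf|exact: cg]. Qed.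

End continuous_real.

Section rV_functions.
Variables (R : realType) (N : nat).

Lemma continuous_row (T : topologicalType) (f : T -> 'I_N -> R) :
  (forall j, continuous (f ^~ j)) -> continuous (fun t => \row_j f t j : 'rV[R]_N).
Proof.
move=> cf t; apply: (@row_cvg _ _ _ (nbhs t) (nbhs_filter t)) => j.
by rewrite mxE; under eq_fun do rewrite mxE; exact: cf.
Qed.

Lemma coord_le_norm (x : 'rV[R]_N) i : `|x 0 i| <= `|x|.
Proof.
rewrite [leRHS]/Num.Def.normr/= mx_normrE.
by apply/bigmax_geP; right => /=; exists (0, i).
Qed.

Lemma rV_norm_le (x : 'rV[R]_N) c : 0 <= c -> (forall i, `|x 0 i| <= c) -> `|x| <= c.
Proof.
move=> c0 xc; rewrite [leLHS]/Num.Def.normr/= mx_normrE bigmax_le//= => -[i j] _.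
by rewrite (ord1 i).
Qed.

Lemma continuous_rV_bounded (G : 'rV[R]_N -> R) (L : R) : continuous G ->
  exists M, forall y : 'rV[R]_N, (forall i, `|y 0 i| <= L) -> `|G y| <= M.
Proof.
move=> cG; pose A := [set v : 'rV[R]_N | forall i, `[- L, L]%classic (v ord0 i)].
have cA : compact A.
  by apply: (@rV_compact R N (fun=> `[- L, L]%classic)) => i; exact: segment_compact.
have : compact (G @` A).
  by apply: continuous_compact => //; apply: continuous_subspaceT.
move/compact_bounded => [M [_ +]] => /(_ (M + 1)); rewrite ltrDl ltr01 => /(_ isT) GM.
exists (M + 1) => y yL; apply: GM; exists y => // i.
by rewrite /= in_itv/= -ler_norml.
Qed.

End rV_functions.

(** * Expectations of cosines determine the law of a random vector *)

Section uniqueness.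
Variables (R : realType) (N : nat).
Implicit Types (G : 'rV[R]_N -> R).

Let u n (i : 'I_N) (x : 'rV[R]_N) : R := (1 + sin (x 0 i / n.+1%:R)) / 2.

Let u01 n i x : 0 <= u n i x <= 1.
Proof.
by have := sin_geN1 (x 0 i / n.+1%:R); have := sin_le1 (x 0 i / n.+1%:R);
  rewrite /u; lra.
Qed.

Let SL n (x : 'rV[R]_N) : 'rV[R]_N := \row_i sinL n (x 0 i).

Let GSL G n (y : 'rV[R]_N) := G (\row_i (n.+1%:R * (2 * y 0 i - 1))).

Let GSLE G n x : G (SL n x) = GSL G n (\row_i u n i x).
Proof. by congr G; apply/rowP => i; rewrite !mxE /sinL /u; congr (_ * _); field. Qed.

Let continuous_GSL G n : continuous G -> continuous (GSL G n).
Proof.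
move=> cG; apply: cont_comp => //; apply: continuous_row => j.
apply: contM; first exact: cont_cst.
apply: contB; last exact: cont_cst.
by apply: contM; [exact: cont_cst|exact: coord_continuous].
Qed.

Let bounded_GSL G n : continuous G -> exists M, forall y : 'rV[R]_N,
  (forall i, 0 <= y 0 i <= 1) -> `|GSL G n y| <= M.
Proof.
move=> cG; have [M GM] := continuous_rV_bounded n.+1%:R cG.
exists M => y y01; apply: GM => i; rewrite mxE normrM ger0_norm// ler_piMr//.
by rewrite ler_norml; have := y01 i; lra.
Qed.

Let cvg_SL G x : continuous G -> G (SL n x) @[n --> \oo] --> G x.
Proof.
move=> cG; apply: continuous_cvg; first exact: cG.
apply: row_cvg => j; rewrite /SL; under eq_fun do rewrite mxE; exact: sinL_cvg.
Qed.

(** Measurability is known for the coordinates only. The truncations of [G] are reached from them by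
    sums, products and limits, through [bernstein_closure] for the class of measurable functions;
    then the truncation is removed by a pointwise limit. *)
Lemma measurable_rV_comp d (T : measurableType d) (xi : T -> 'rV[R]_N) G :
  (forall i, measurable_fun setT (fun w => xi w 0 i)) -> continuous G ->
  measurable_fun setT (fun w => G (xi w)).
Proof.
move=> mxi cG; apply: (@measurable_fun_cvg _ _ _ _ (fun n w => G (SL n (xi w)))).
  move=> n; under eq_fun do rewrite GSLE.
  have [M GM] := bounded_GSL n cG.
  apply: (@bernstein_closure R N T (fun i w => u n i (xi w)) _
    (fun f => measurable_fun setT f) _ _ _ _ _ (GSL G n) M) => //.
  - by move=> f g mf mg; exact: measurable_funD.
  - by move=> c f mf; exact: measurable_funM.
  - move=> i f mf; apply: measurable_funM => //.
    apply: measurable_funM => //; apply: measurable_funD => //.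
    apply: (measurableT_comp (continuous_measurable_fun (@continuous_sin R))).
    exact: measurable_funM.
  - move=> F f _ mF _ Ff; apply: (measurable_fun_cvg mF) => x _; exact: Ff.
  - exact: continuous_GSL.
by move=> w _; exact: cvg_SL.
Qed.

Variables (d1 d2 : measure_display).
Variables (T1 : measurableType d1) (T2 : measurableType d2).
Variables (P1 : probability T1 R) (P2 : probability T2 R).
Variables (xi : T1 -> 'rV[R]_N) (eta : T2 -> 'rV[R]_N).
Hypothesis mxi : forall i, measurable_fun setT (fun w => xi w 0 i).
Hypothesis meta : forall i, measurable_fun setT (fun w => eta w 0 i).
Hypothesis cos_eq : forall (a : 'I_N -> R) (th : R),
  \int[P1]_w cos (\sum_i a i * xi w 0 i + th) =
  \int[P2]_w cos (\sum_i a i * eta w 0 i + th).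

Let dot (a : 'I_N -> R) (x : 'rV[R]_N) := \sum_i a i * x 0 i.

Let continuous_dot a : continuous (dot a).
Proof.
apply: cont_sum => i.
by apply: contM; [exact: cont_cst|exact: coord_continuous].
Qed.

Let continuous_cosdot a th : continuous (fun x => cos (dot a x + th)).
Proof.
apply: cont_comp; last exact: continuous_cos.
by apply: contD; [exact: continuous_dot|exact: cont_cst].
Qed.

(** Equality is required against every cosine and not only for [f] itself, so that the class is
    stable under multiplication by [u n i]. As the phase is free, cosines alone also stand for the
    sines. *)
Let H (f : 'rV[R]_N -> R) := [/\ measurable_fun setT (fun w => f (xi w)),
  measurable_fun setT (fun w => f (eta w)),
  (exists M, forall x, `|f x| <= M) &
  forall a th, \int[P1]_w (cos (dot a (xi w) + th) * f (xi w)) =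
               \int[P2]_w (cos (dot a (eta w) + th) * f (eta w))].

Let mcos1 a th : measurable_fun setT (fun w => cos (dot a (xi w) + th)).
Proof. exact: (measurable_rV_comp mxi (@continuous_cosdot a th)). Qed.

Let mcos2 a th : measurable_fun setT (fun w => cos (dot a (eta w) + th)).
Proof. exact: (measurable_rV_comp meta (@continuous_cosdot a th)). Qed.

Let cosM_bounded d (T : measurableType d) (P : probability T R) (f c : T -> R) M :
  measurable_fun setT f -> (forall w, `|f w| <= M) ->
  measurable_fun setT (fun w => cos (c w)) -> rint P (fun w => cos (c w) * f w).
Proof.
move=> mf fM mc; apply: (rintMl (M := 1)) => //; first exact: (rint_bounded P mf fM).
by move=> w; exact: cos_max.
Qed.

Let H_GSL G n : continuous G -> H (fun x => G (SL n x)).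
Proof.
move=> cG; have [M GM] := bounded_GSL n cG.
under eq_fun do rewrite GSLE.
apply: (@bernstein_closure R N _ (u n) (u01 n) H _ _ _ _ _ (GSL G n) M) => //.
- move=> c; split => //; first by exists `|c|.
  move=> a th; rewrite !RintZr ?cos_eq//.
    by apply: (rint_bounded P2 (M := 1)) => // w; exact: cos_max.
  by apply: (rint_bounded P1 (M := 1)) => // w; exact: cos_max.
- move=> f g [mf1 mf2 [Mf fM] ef] [mg1 mg2 [Mg gM] eg]; split.
  + exact: measurable_funD.
  + exact: measurable_funD.
  + by exists (Mf + Mg) => x; rewrite (le_trans (ler_normD _ _))// lerD.
  + move=> a th; under eq_Rintegral do rewrite mulrDr.
    under [RHS]eq_Rintegral do rewrite mulrDr.
    by rewrite !RintD ?ef ?eg//; apply: cosM_bounded => //;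
      solve [exact: mcos1|exact: mcos2].
- move=> c f [mf1 mf2 [Mf fM] ef]; split.
  + exact: measurable_funM.
  + exact: measurable_funM.
  + by exists (`|c| * Mf) => x; rewrite normrM ler_wpM2l.
  + move=> a th; under eq_Rintegral do rewrite mulrCA.
    under [RHS]eq_Rintegral do rewrite mulrCA.
    by rewrite !RintZl ?ef//; apply: cosM_bounded => //;
      solve [exact: mcos1|exact: mcos2].
- move=> i f [mf1 mf2 [Mf fM] ef].
  have mu d (T : measurableType d) (z : T -> 'rV[R]_N) :
      (forall i, measurable_fun setT (fun w => z w 0 i)) ->
      measurable_fun setT (fun w => u n i (z w)).
    move=> mz; apply: measurable_funM => //; apply: measurable_funD => //.
    apply: (measurableT_comp (continuous_measurable_fun (@continuous_sin R))).
    exact: measurable_funM.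
  split.
  + by apply: measurable_funM => //; exact: mu.
  + by apply: measurable_funM => //; exact: mu.
  + exists Mf => x; rewrite normrM ger0_norm; last by have /andP[] := u01 n i x.
    rewrite (le_trans _ (fM x))// ler_piMl//.
    by have /andP[] := u01 n i x.
  + move=> a th.
    have dotE c x : dot (fun j => a j + (j == i)%:R * c) x = dot a x + c * x 0 i.
      rewrite /dot; under eq_bigr do rewrite mulrDl.
      rewrite big_split/=; congr (_ + _); rewrite (bigD1 i)//= eqxx mul1r big1 ?addr0//.
      by move=> j /negbTE ->; rewrite !mul0r.
    pose ap j := a j + (j == i)%:R * n.+1%:R^-1.
    pose am j := a j + (j == i)%:R * - n.+1%:R^-1.
    have key x : cos (dot a x + th) * (u n i x * f x) =
      2^-1 * (cos (dot a x + th) * f x) +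
      (4^-1 * (cos (dot ap x + (th - pi / 2)) * f x) -
       4^-1 * (cos (dot am x + (th - pi / 2)) * f x)).
      (* With b = x_i / (n + 1), [u n i x] is (1 + sin b) / 2, and cos A sin b = (sin (A + b) - sin
         (A - b)) / 2; the frequencies [ap] and [am] add and subtract b, and the phase - pi / 2
         turns the sines into cosines. *)
      rewrite !addrA !cosBpihalf !dotE /u mulNr [_^-1 * x 0 i]mulrC.
      by set b := x 0 i / _; rewrite ![dot a x + _ + th]addrAC sinD sinB; field.
    have I1 c t : rint P1 (fun w => cos (dot c (xi w) + t) * f (xi w)).
      by apply: cosM_bounded => //; exact: mcos1.
    have I2 c t : rint P2 (fun w => cos (dot c (eta w) + t) * f (eta w)).
      by apply: cosM_bounded => //; exact: mcos2.
    under eq_Rintegral do rewrite key.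
    under [RHS]eq_Rintegral do rewrite key.
    rewrite !(RintB, RintD, RintZl) ?ef//;
      try solve [exact: rintZl|apply: rintB; exact: rintZl].
- move=> F f M' HF FM' Ff.
  have mf1 : measurable_fun setT (fun w => f (xi w)).
    apply: (@measurable_fun_cvg _ _ _ _ (fun n w => F n (xi w))).
      by move=> k; have [] := HF k.
    by move=> w _; exact: Ff.
  have mf2 : measurable_fun setT (fun w => f (eta w)).
    apply: (@measurable_fun_cvg _ _ _ _ (fun n w => F n (eta w))).
      by move=> k; have [] := HF k.
    by move=> w _; exact: Ff.
  have fM' x : `|f x| <= M' by apply: cvg_norm_le (Ff x) => k; exact: FM'.
  split => //; first by exists M'.
  move=> a th.
  have cosF d (T : measurableType d) (P : probability T R) (z : T -> 'rV[R]_N) :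
      measurable_fun setT (fun w => cos (dot a (z w) + th)) ->
      (forall k, measurable_fun setT (fun w => F k (z w))) ->
    \int[P]_w (cos (dot a (z w) + th) * F k (z w)) @[k --> \oo] -->
    \int[P]_w (cos (dot a (z w) + th) * f (z w)).
    move=> mz mFz; have [||||_] := @Rint_cvg _ T R P
      (fun k w => cos (dot a (z w) + th) * F k (z w))
      (fun w => cos (dot a (z w) + th) * f (z w)) (fun=> M'); last exact.
    - by move=> k; exact: measurable_funM.
    - exact: rint_cst.
    - move=> k w; rewrite normrM (le_trans _ (FM' k (z w)))// ler_piMl//.
      exact: cos_max.
    - by move=> w; apply: cvgM; [exact: cvg_cst|exact: Ff].
  have C1 := cosF _ _ P1 xi (mcos1 a th) (fun k => let: And4 m _ _ _ := HF k in m).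
  have C2 := cosF _ _ P2 eta (mcos2 a th) (fun k => let: And4 _ m _ _ := HF k in m).
  have CE : (fun n => \int[P1]_w (cos (dot a (xi w) + th) * F n (xi w))) =
      (fun n => \int[P2]_w (cos (dot a (eta w) + th) * F n (eta w))).
    by apply/funext => k; have [_ _ _ ->] := HF k.
  rewrite CE in C1.
  exact: (cvg_unique _ C1 C2).
- exact: continuous_GSL.
Qed.

(** After truncation by [SL n], [G] lies in the class [H], where frequency and phase zero give the
    equality of expectations. The polynomial bound survives the truncation because |SL n x| <= |x|,
    and the moments then allow dominated convergence. *)
Lemma eq_Rint_of_eq_cos G (C : R) (m : nat) : continuous G ->
  (forall x, `|G x| <= C * (1 + `|x|) ^+ m) ->
  rint P1 (fun w => (1 + `|xi w|) ^+ m) ->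
  rint P2 (fun w => (1 + `|eta w|) ^+ m) ->
  \int[P1]_w G (xi w) = \int[P2]_w G (eta w).
Proof.
move=> cG GC I1 I2.
have norm_SL n x : `|SL n x| <= `|x|.
  apply: rV_norm_le => // i; rewrite mxE (le_trans (sinL_le _ _))//.
  exact: coord_le_norm.
have C0 : 0 <= C by have := le_trans (normr_ge0 _) (GC 0); rewrite normr0 addr0 expr1n mulr1.
have GSLC n x : `|G (SL n x)| <= C * (1 + `|x|) ^+ m.
  rewrite (le_trans (GC _))// ler_wpM2l// lerXn2r ?nnegrE ?addr_ge0//.
  by rewrite lerD2l.
have [_ C1] := @Rint_cvg _ T1 R P1 (fun n w => G (SL n (xi w))) (fun w => G (xi w)) _
  (fun n => let: And4 m _ _ _ := @H_GSL G n cG in m) (rintZl C I1)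
  (fun n w => GSLC n (xi w)) (fun w => @cvg_SL G (xi w) cG).
have [_ C2] := @Rint_cvg _ T2 R P2 (fun n w => G (SL n (eta w))) (fun w => G (eta w)) _
  (fun n => let: And4 _ m _ _ := @H_GSL G n cG in m) (rintZl C I2)
  (fun n w => GSLC n (eta w)) (fun w => @cvg_SL G (eta w) cG).
suff CE : (fun n => \int[P1]_w G (SL n (xi w))) =
          (fun n => \int[P2]_w G (SL n (eta w))).
  by rewrite CE in C1; exact: (cvg_unique _ C1 C2).
apply/funext => n; have [_ _ _ /(_ (fun=> 0) 0)] := @H_GSL G n cG.
have d0 x : dot (fun=> 0) x = 0 by rewrite /dot big1// => i _; rewrite mul0r.
under eq_Rintegral do rewrite d0 addr0 cos0 mul1r.
by under [RHS]eq_Rintegral do rewrite d0 addr0 cos0 mul1r.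
Qed.

End uniqueness.

(** * Centered normal laws *)

(** A quadratic remainder survives integration, so this form together with [cos_taylor]
    differentiates under an expectation. *)
Lemma is_derive_quad (R : realType) (f : R -> R) (x d K : R) :
  (forall h, `|f (x + h) - f x - h * d| <= K * h ^+ 2) -> is_derive x 1 f d.
Proof.
move=> fK.
have K0 : 0 <= K.
  by have := le_trans (normr_ge0 _) (fK 1); rewrite expr1n mulr1.
have cv : h^-1 *: (f (h *: (1 : R^o) + x) - f x) @[h --> 0^'] --> d.
  apply/cvgrPdist_le => /= e e0.
  have K10 : 0 < K + 1 by rewrite ltr_wpDl.
  near=> h.
  have h0 : h != 0 by near: h; exact: nbhs_dnbhs_neq.
  have hE : d - h^-1 *: (f (h *: 1 + x) - f x) =
      - (h^-1 * (f (x + h) - f x - h * d)).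
    rewrite /GRing.scale/= mulr1 [h + x]addrC; field; exact: h0.
  rewrite hE normrN normrM normfV ler_pdivrMl ?normr_gt0//.
  rewrite (le_trans (fK h))// -[X in _ * X]real_normK ?num_real// expr2 mulrCA.
  rewrite ler_wpM2l// (le_trans (y := (K + 1) * `|h|)) ?ler_wpM2r ?lerDl//.
  rewrite -ler_pdivlMl// mulrC; near: h; apply: dnbhs0_le.
  by rewrite divr_gt0.
apply: DeriveDef; last exact/cvg_lim.
by apply/cvg_ex; exists d.
Unshelve. all: by end_near. Qed.

Section normal_law.
Variables (R : realType) (s : R).
Hypothesis s0 : s != 0.
Local Notation lam := (@lebesgue_measure R).
Local Notation gam := (@normal_prob R 0 s).
Local Notation pdf := (normal_pdf 0 s).

(** The Radon-Nikodym derivative and the normal density have the same integral over every measurable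
    set, hence agree almost everywhere. *)
Lemma normal_prob_ge0_integral (f : R -> \bar R) : measurable_fun setT f ->
  (forall x, (0 <= f x)%E) ->
  (\int[gam]_x f x = \int[lam]_x (f x * (pdf x)%:E))%E.
Proof.
move=> mf f0.
have dom : gam `<< lam := normal_prob_dominates 0 s.
rewrite -(Radon_Nikodym_SigmaFinite.change_of_variables dom f0 measurableT mf).
apply: ae_eq_integral => //.
- apply: emeasurable_funM => //; apply: measurable_int.
  exact: Radon_Nikodym_SigmaFinite.f_integrable dom.
- apply: emeasurable_funM => //; apply/measurable_EFinP.
  exact: measurable_normal_pdf.
- apply: ae_eqe_mul2l.
  apply: integral_ae_eq => //.
  + exact: Radon_Nikodym_SigmaFinite.f_integrable dom.
  + by apply/measurable_EFinP; exact: measurable_normal_pdf.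
  + by move=> E _ mE; rewrite -Radon_Nikodym_SigmaFinite.f_integral.
Qed.

Lemma rint_normal_prob (f : R -> R) : measurable_fun setT f ->
  rint lam (fun x => f x * pdf x) <-> rint gam f.
Proof.
move=> mf.
have E : (\int[gam]_x `|(f x)%:E| = \int[lam]_x `|(f x * pdf x)%:E|)%E.
  rewrite normal_prob_ge0_integral//; last first.
    by apply: measurableT_comp => //; exact/measurable_EFinP.
  by apply: eq_integral => x _; rewrite EFinM abseM (@gee0_abs _ (pdf x)%:E) ?lee_fin ?normal_pdf_ge0.
split => /integrableP[m I]; apply/integrableP; split => //=.
- exact/measurable_EFinP.
- by rewrite E.
- by apply/measurable_EFinP/measurable_funM => //; exact: measurable_normal_pdf.
- by rewrite -E.
Qed.

Lemma Rint_normal_prob (f : R -> R) : rint gam f ->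
  \int[gam]_x f x = \int[lam]_x (f x * pdf x).
Proof.
move=> If; have mf := rint_measurable If.
have mEf : measurable_fun setT (EFin \o f) by exact/measurable_EFinP.
have Ifp := (rint_normal_prob mf).2 If.
congr fine; rewrite [LHS]integralE [RHS]integralE.
rewrite !normal_prob_ge0_integral//; [|exact: measurable_funeneg|exact: measurable_funepos].
by congr (_ - _)%E; apply: eq_integral => x _;
  rewrite ?funeposE ?funenegE EFinM ?muleN ?maxe_pMl ?mul0e// ?lee_fin ?normal_pdf_ge0//
  -?EFinM -?EFinN -?EFin_max ?mulNr// maxr_pMl ?mul0r// normal_pdf_ge0.
Qed.

(** Completing the square: exp (c x) times the density with mean 0 is a multiple of the density with
    mean c s^2 and the same deviation. *)
Lemma rint_normal_expR c : rint gam (fun x => expR (c * x)).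
Proof.
have mE : measurable_fun setT (fun x : R => expR (c * x)).
  by apply: measurableT_comp => //; exact: measurable_funM.
apply/(rint_normal_prob mE).
have -> : (fun x => expR (c * x) * pdf x) =
    (fun x => expR (c ^+ 2 * s ^+ 2 / 2) * normal_pdf (c * s ^+ 2) s x).
  apply/funext => x; rewrite !normal_pdfE// mulrCA [RHS]mulrCA; congr (_ * _).
  rewrite /normal_fun -!expRD; congr expR.
  by rewrite -mulr_natr; field; rewrite s0.
by apply: rintZl; exact: integrable_normal_pdf.
Qed.

(** A single term of the exponential series at 1 + |x|, together with exp |x| <= exp x + exp (-
    x). *)
Lemma pow_le_expR m (x : R) :
  (1 + `|x|) ^+ m <= m.+1`!%:R * expR 1 * (expR (1 * x) + expR (-1 * x)).
Proof.
have h0 : 0 <= 1 + `|x| by rewrite addr_ge0.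
have f0 : (0 : R) < m.+1`!%:R by rewrite ltr0n fact_gt0.
apply: (@le_trans _ _ ((1 + `|x|) ^+ m.+1)).
  by rewrite exprS ler_peMl ?exprn_ge0// lerDl.
have := expR_ge1Dxn m h0 => /(le_trans (ler_wpDl ler01 (lexx _))).
rewrite ler_pdivrMr// => /le_trans; apply.
rewrite mulrC -mulrA ler_wpM2l ?(ltW f0)// expRD ler_wpM2l ?expR_ge0//.
rewrite mul1r mulN1r; have [x0|x0] := leP 0 x.
  by rewrite ger0_norm// lerDl expR_ge0.
by rewrite ltr0_norm// lerDr expR_ge0.
Qed.

Lemma rint_normal_pow m : rint gam (fun x => (1 + `|x|) ^+ m).
Proof.
have I := rintZl (m.+1`!%:R * expR 1) (rintD (rint_normal_expR 1) (rint_normal_expR (-1))).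
have mp : measurable_fun setT (fun x : R => (1 + `|x|) ^+ m).
  by apply: measurable_funX; exact: measurable_funD.
apply: (@rint_le _ _ R gam (fun x => (1 + `|x|) ^+ m) _ mp _ I).
by move=> x; rewrite ger0_norm ?exprn_ge0 ?addr_ge0// pow_le_expR.
Qed.

Lemma rint_normal_poly m A (f : R -> R) : measurable_fun setT f ->
  (forall x, `|f x| <= A * (1 + `|x|) ^+ m) -> rint gam f.
Proof.
move=> mf fA; apply: (@rint_le _ _ R gam f _ mf fA).
exact/rintZl/rint_normal_pow.
Qed.

Lemma is_derive_normal_pdf (x : R) : is_derive x (1 : R) (pdf : R -> R) (- (x / s ^+ 2) * pdf x).
Proof.
rewrite normal_pdfE// /normal_fun.
have h : is_derive x 1 (fun y : R => - (y - 0) ^+ 2 / (s ^+ 2 *+ 2)) (- (x / s ^+ 2)).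
  rewrite (_ : (fun y => _) = (fun y => (- (s ^+ 2 *+ 2)^-1) *: (y ^+ 2))); last first.
    by apply/funext => y; rewrite subr0 mulNr mulrC -mulNr.
  apply: is_derive_eq; rewrite /GRing.scale/= -mulr_natr.
  by field.
have := is_derive1_comp (is_derive_expR _) h.
move=> /(is_deriveZ (normal_peak s)) H; refine (is_derive_eq H _).
by rewrite /GRing.scale/=; ring.
Qed.

Lemma pdf_decay (F : R -> R) A m : (forall x, `|F x| <= A * (1 + `|x|) ^+ m) ->
  (F (n%:R) * pdf n%:R @[n --> \oo] --> (0 : R)) /\
  (F (- n%:R) * pdf (- n%:R) @[n --> \oo] --> (0 : R)).
Proof.
move=> FA.
have A0 : 0 <= A.
  by have := le_trans (normr_ge0 _) (FA 0); rewrite normr0 addr0 expr1n mulr1.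
pose B := A * (m.+1`!%:R * expR 1 * 2) * normal_peak s.
(* Once n >= 4 s^2, the exponent x^2 / (2 s^2) is at least 2 n, while the polynomial factor is O(exp
   n); exp (- n) remains. *)
have key (x : R) n : `|x| = n%:R -> 4 * s ^+ 2 <= n%:R ->
    `|F x * pdf x| <= B * expR (- n%:R).
  move=> xn sn; rewrite normrM (ger0_norm (normal_pdf_ge0 _ _ _)).
  rewrite /B.
  have x2 : x ^+ 2 = n%:R ^+ 2 by rewrite -xn real_normK ?num_real.
  have pE : pdf x <= normal_peak s * expR (- 2 * n%:R).
    rewrite normal_pdfE// ler_wpM2l ?normal_peak_ge0// /normal_fun subr0 ler_expR x2.
    have s2 : 0 < s ^+ 2 by rewrite exprn_even_gt0//= s0 orbT.
    rewrite ler_pdivrMr ?pmulrn_lgt0// mulr2n.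
    by have n0 := ler0n R n; nra.
  apply: (@le_trans _ _ (A * (m.+1`!%:R * expR 1 * (2 * expR n%:R)) *
      (normal_peak s * expR (- 2 * n%:R)))).
    rewrite ler_pM ?normal_pdf_ge0//; apply: (le_trans (FA x)).
    rewrite ler_wpM2l// (le_trans (pow_le_expR m x))//.
    rewrite ler_wpM2l ?mulr_ge0 ?expR_ge0//.
    rewrite [2]mulr2n mulrDl !mul1r lerD// ler_expR -xn ?mul1r ?mulN1r ?ler_norm//.
    by rewrite ler_normr lexx orbT.
  rewrite le_eqVlt; apply/orP; left; apply/eqP.
  have -> : expR (- n%:R) = expR n%:R * expR (- 2 * n%:R) :> R.
    by rewrite -expRD; congr expR; ring.
  by ring.
have cv0 : B * expR (- n%:R) @[n --> \oo] --> (0 : R).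
  by rewrite -[X in _ --> X](mulr0 B); apply: cvgM; [exact: cvg_cst|exact: cvgn_expR].
split; apply/cvgr0Pnorm_le => e e0; have := cvgr0_norm_le _ cv0 _ e0.
  move=> H; near=> n; rewrite (le_trans (key _ n _ _)) ?normr_nat//.
    by near: n; exact: nbhs_infty_ger.
  by rewrite (le_trans (ler_norm _))//; near: n; exact: H.
move=> H; near=> n; rewrite (le_trans (key _ n _ _)) ?normrN ?normr_nat//.
  by near: n; exact: nbhs_infty_ger.
by rewrite (le_trans (ler_norm _))//; near: n; exact: H.
Unshelve. all: by end_near. Qed.

(** The derivative of [F] times the density is (F' - x F / s^2) times the density. Its integral over
    [-n, n] is a boundary term, which vanishes in the limit by [pdf_decay]. *)
Lemma normal_Stein (F F' : R -> R) A m :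
  (forall x : R, is_derive x (1 : R) F (F' x)) -> continuous F' ->
  (forall x, `|F x| <= A * (1 + `|x|) ^+ m) ->
  (forall x, `|F' x| <= A * (1 + `|x|) ^+ m) ->
  \int[gam]_x (x * F x) = s ^+ 2 * \int[gam]_x F' x.
Proof.
move=> dF cF' FA F'A.
have cF : continuous F.
  move=> x; apply: differentiable_continuous; apply/derivable1_diffP.
  by case: (dF x).
have mF : measurable_fun setT F by exact: continuous_measurable_fun.
have mF' : measurable_fun setT F' by exact: continuous_measurable_fun.
have IF' : rint gam F' := rint_normal_poly mF' F'A.
have IxF : rint gam (fun x => x * F x).
  apply: (@rint_normal_poly m.+1 A); first exact: measurable_funM.
  move=> x; rewrite normrM exprS mulrCA ler_pM//.
  by rewrite lerDr.
have s20 : s ^+ 2 != 0 by rewrite expf_neq0.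
pose h x := (F' x - x * F x / s ^+ 2) * pdf x.
have cpdf : continuous pdf := @continuous_normal_pdf R 0 s s0.
have ch : continuous h.
  apply: contM => //; apply: contB => //; apply: contM; last exact: cont_cst.
  by apply: contM => // x; exact: cvg_id.
have IxFs : rint gam (fun x => x * F x / s ^+ 2) := rintZr _ IxF.
have Id : rint gam (fun x => F' x - x * F x / s ^+ 2) := rintB IF' IxFs.
have Ih : rint lam h := (rint_normal_prob (rint_measurable Id)).2 Id.
suff h0 : \int[lam]_x h x = 0.
  have := h0; rewrite -(Rint_normal_prob Id) (RintB IF' IxFs) (RintZr _ IxF).
  by move=> /subr0_eq ->; rewrite mulrC mulfVK.
have FTC n : \int[lam]_x (h \_ `[- n.+1%:R, n.+1%:R]) x =
    F n.+1%:R * pdf n.+1%:R - F (- n.+1%:R) * pdf (- n.+1%:R).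
  rewrite -Rintegral_mkcond /Rintegral.
  have dFp (x : R) : is_derive x (1 : R) (F \* (pdf : R -> R)) (h x).
    refine (is_derive_eq (is_deriveM (dF x) (is_derive_normal_pdf x)) _).
    by rewrite /GRing.scale/= /h; field.
  rewrite (@continuous_FTC2 _ h (F \* pdf))//.
  - by rewrite (@lt_trans _ _ 0)// ?oppr_lt0 ltr0n.
  - by apply: continuous_subspaceT.
  - have cFp : continuous (F \* pdf) by exact: contM.
    split.
    + by move=> x _; case: (dFp x).
    + by apply: cvg_at_right_filter; exact: cFp.
    + by apply: cvg_at_left_filter; exact: cFp.
  - by move=> x _; rewrite derive1E; case: (dFp x).
have [||||_ C1] := @Rint_cvg _ _ R lam
    (fun n x => (h \_ `[- n.+1%:R, n.+1%:R]) x) h (fun x => `|h x|).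
- move=> n; apply/(measurable_restrictT h (measurable_itv `[- n.+1%:R, n.+1%:R])).
  exact: measurable_funTS (rint_measurable Ih).
- exact: rint_abs.
- by move=> n x; rewrite patchE; case: ifP => _ //=; rewrite normr0.
- move=> x; apply: cvg_near_cst; near=> n; rewrite patchE mem_set//= in_itv/= -ler_norml.
  rewrite (le_trans (y := n%:R)) ?ler_nat//.
  by near: n; exact: nbhs_infty_ger.
have [p1 p2] := pdf_decay FA.
have : \int[lam]_x (h \_ `[- n.+1%:R, n.+1%:R]) x @[n --> \oo] --> (0 : R) - 0.
  under eq_fun do rewrite FTC.
  move: p1 p2; rewrite -(cvg_shiftS (fun n => F n%:R * pdf n%:R)).
  rewrite -(cvg_shiftS (fun n => F (- n%:R) * pdf (- n%:R))) => p1 p2.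
  exact: cvgB p1 p2.
by rewrite subr0 => C2; exact: (cvg_unique _ C1 C2).
Unshelve. all: by end_near. Qed.

Lemma Rint_normal_sqr : \int[gam]_x (x ^+ 2) = s ^+ 2.
Proof.
have := @normal_Stein id (fun=> 1) 1 1 (fun x => is_derive_id x 1) (@cont_cst _ _ 1).
rewrite (Rint_cst (gam : probability _ R)) mulr1; apply => x.
  by rewrite mul1r expr1 lerDr.
by rewrite mul1r expr1 normr1 lerDl.
Qed.

(** As a function of c the expectation solves phi' = - s^2 c phi, by Stein's identity for the sine;
    so phi(c) exp (c^2 s^2 / 2) is constant, equal to its value cos th at c = 0. *)
Lemma Rint_normal_cos c th :
  \int[gam]_x cos (c * x + th) = cos th * expR (- (c ^+ 2 * s ^+ 2 / 2)).
Proof.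
pose g := (gam : probability _ R).
have maff c' t : measurable_fun setT (fun x : R => c' * x + t).
  by apply: measurable_funD => //; exact: measurable_funM.
have mcos c' t : measurable_fun setT (fun x : R => cos (c' * x + t)).
  exact: (measurableT_comp (continuous_measurable_fun (@continuous_cos R))).
have msin c' t : measurable_fun setT (fun x : R => sin (c' * x + t)).
  exact: (measurableT_comp (continuous_measurable_fun (@continuous_sin R))).
have Icos c' t : rint gam (fun x => cos (c' * x + t)).
  by apply: (rint_bounded g (mcos c' t) (M := 1)) => x; exact: cos_max.
have Ix2 : rint gam (fun x => x ^+ 2).
  apply: (@rint_normal_poly 2 1); first exact: measurable_funX.
  by move=> x; rewrite mul1r normrX lerXn2r ?nnegrE ?addr_ge0// lerDr.
have Ixsin c' t : rint gam (fun x => x * sin (c' * x + t)).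
  apply: (@rint_normal_poly 1 1); first exact: measurable_funM.
  move=> x; rewrite mul1r expr1 normrM (le_trans (y := `|x|)) ?lerDr//.
  by rewrite ler_piMr// sin_max.
pose phi (c' : R) : R := \int[gam]_x cos (c' * x + th).
have dphi (c' : R) : is_derive c' (1 : R) phi (- (s ^+ 2 * c' * phi c')).
  apply: (@is_derive_quad _ _ _ _ (2 * \int[gam]_x (x ^+ 2))) => h.
  have St : \int[gam]_x (x * sin (c' * x + th)) = s ^+ 2 * c' * phi c'.
    rewrite /phi -mulrA -RintZl//.
    apply: (@normal_Stein (fun x => sin (c' * x + th)) _ (1 + `|c'|) 0).
    + move=> x; have h1 : is_derive (x : R) (1 : R) (fun y : R => c' * y + th) c'.
        by apply: is_derive_eq; rewrite /GRing.scale/= mulr1 addr0.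
      refine (is_derive_eq (@is_derive1_comp _ sin (fun y => c' * y + th) _ _ _
        (is_derive_sin _) h1) _).
      by rewrite mulrC.
    + apply: contM; first exact: cont_cst.
      apply: cont_comp; last exact: continuous_cos.
      apply: contD; last exact: cont_cst.
      by apply: contM; [exact: cont_cst|move=> x; exact: cvg_id].
    + by move=> x; rewrite expr0 mulr1 (le_trans (sin_max _))// lerDl.
    + move=> x; rewrite expr0 mulr1 normrM (le_trans (y := `|c'|)) ?lerDr//.
      by rewrite ler_piMr// cos_max.
  rewrite mulrN opprK -St -RintZl// /phi -RintB// -RintD//; last 2 first.
  - exact: rintB.
  - exact: rintZl.
  apply: (le_trans (ler_norm_Rint _)); first by apply: rintD; [exact: rintB|exact: rintZl].
  rewrite mulrAC -mulrA -RintZl// -RintZl//; last exact: rintZl.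
  apply: le_Rint; first by apply/rint_abs/rintD; [exact: rintB|exact: rintZl].
    by do 2 apply: rintZl.
  move=> x; have := cos_taylor (c' * x + th) (h * x).
  rewrite exprMn -(mulrA h).
  by rewrite (_ : c' * x + th + h * x = (c' + h) * x + th)//; ring.
pose psi (c' : R) : R := phi c' * expR (c' ^+ 2 * s ^+ 2 / 2).
have dpsi (c' : R) : is_derive c' (1 : R) psi 0.
  have h1 : is_derive (c' : R) (1 : R) (fun y : R => y ^+ 2 * s ^+ 2 / 2) (c' * s ^+ 2).
    rewrite (_ : (fun y => _) = (fun y => (s ^+ 2 / 2) *: y ^+ 2)); last first.
      by apply/funext => y; rewrite /GRing.scale/=; ring.
    by apply: is_derive_eq; rewrite /GRing.scale/=; field.
  refine (is_derive_eq
    (is_deriveM (dphi c') (is_derive1_comp (is_derive_expR _) h1)) _).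
  by rewrite /GRing.scale/=; ring.
have [c0 _] := MVT_between 0 c dpsi.
rewrite mul0r => /subr0_eq; rewrite {2}/psi expr0n !mul0r expR0 mulr1.
have -> : phi 0 = cos th.
  rewrite /phi; under eq_Rintegral do rewrite mul0r add0r.
  by rewrite (Rint_cst g).
by rewrite /psi => <-; rewrite -mulrA -expRD subrr expR0 mulr1.
Qed.

End normal_law.

(** * Gaussian integration by parts *)

Section normal_rv.
Context d (T : measurableType d) (R : realType).
Variable P : probability T R.
Implicit Types (U : T -> R) (s : R).

Lemma transfer_law (Q : probability (measurableTypeR R) R) U :
  measurable_fun setT U ->
  (forall A : set (measurableTypeR R), measurable A -> P (U @^-1` A) = Q A) ->
  forall f : measurableTypeR R -> R, rint Q f ->
  rint P (fun w => f (U w)) /\ \int[P]_w f (U w) = \int[Q]_x f x.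
Proof.
move=> mU PQ f If; have mf := rint_measurable If.
have mfU : measurable_fun setT (fun w => f (U w)) by exact: measurableT_comp mf mU.
pose mixX := @isMeasurableFun.Build _ _ T (measurableTypeR R) U mU.
pose X : {mfun T >-> measurableTypeR R} := HB.pack (U : T -> measurableTypeR R) mixX.
have QE g : (\int[Q]_x g x = \int[distribution P X]_x g x)%E.
  by apply: eq_measure_integral => A mA _; exact: (esym (PQ A mA)).
have IU : rint P (fun w => f (U w)).
  apply/integrableP; split; first exact/measurable_EFinP.
  case/integrableP : If => _; rewrite QE ge0_integral_distribution//.
  by apply: measurableT_comp => //; exact/measurable_EFinP.
split => //; congr fine; rewrite QE integral_distribution//.
exact/measurable_EFinP.
Qed.

Definition normal_law U s := forall A : set (measurableTypeR R), measurable A ->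
  P (U @^-1` A) = centered_normal s A.

Lemma normal_law0 U : measurable_fun setT U -> normal_law U 0 ->
  {ae P, forall w, U w = 0}.
Proof.
move=> mU U0; exists (U @^-1` (~` [set 0])); split.
- by rewrite -[X in measurable X]setTI; apply: mU => //; exact: measurableC.
- rewrite U0; last exact: measurableC.
  by rewrite /centered_normal eqxx diracE memNset//= => /(_ erefl).
- by move=> w /= Uw0.
Qed.

Lemma normal_law_facts U s : measurable_fun setT U -> normal_law U s ->
  [/\ forall m, rint P (fun w => (1 + `|U w|) ^+ m),
      \int[P]_w (U w ^+ 2) = s ^+ 2 &
      forall th, \int[P]_w cos (U w + th) = cos th * expR (- (s ^+ 2 / 2))].
Proof.
move=> mU Us.
have mp m : measurable_fun setT (fun w => (1 + `|U w|) ^+ m).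
  by apply: measurable_funX; apply: measurable_funD => //; exact: measurableT_comp.
have mc th : measurable_fun setT (fun w => cos (U w + th)).
  apply: (measurableT_comp (continuous_measurable_fun (@continuous_cos R))).
  exact: measurable_funD.
have [s0|s0] := eqVneq s 0.
  move: Us; rewrite s0 => /(normal_law0 mU) U0.
  have U0' w : {ae P, forall w, 0 = U w} by move: U0; apply: filterS => ? ->.
  split=> [m||th].
  - apply: (@ae_rint _ _ _ _ (fun=> 1)) => //; last exact: rint_cst.
    by move: U0; apply: filterS => w ->; rewrite normr0 addr0 expr1n.
  - rewrite (@ae_Rint _ _ _ _ _ (fun=> 0)) ?Rint0 ?expr0n//.
      exact: measurable_funX.
    by move: U0; apply: filterS => w ->; rewrite expr0n.
  - rewrite (@ae_Rint _ _ _ _ _ (fun=> cos th))//.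
      by rewrite Rint_cst expr0n/= mul0r oppr0 expR0 mulr1.
    by move: U0; apply: filterS => w ->; rewrite add0r.
have PQ (A : set (measurableTypeR R)) : measurable A ->
    P (U @^-1` A) = (normal_prob 0 s : probability _ R) A.
  by move=> mA; rewrite Us// /centered_normal (negbTE s0).
have tr := transfer_law mU PQ.
split=> [m||th].
- exact: (tr _ (rint_normal_pow s0 m)).1.
- rewrite -(Rint_normal_sqr s0); apply: (tr (fun x => x ^+ 2) _).2.
  apply: (@rint_normal_poly _ _ s0 2 1); first exact: measurable_funX.
  by move=> x; rewrite mul1r normrX lerXn2r ?nnegrE ?addr_ge0// lerDr.
- have := Rint_normal_cos s0 1 th; rewrite expr1n mul1r => <-.
  under [RHS]eq_Rintegral do rewrite mul1r.
  apply: (tr (fun x => cos (x + th)) _).2.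
  apply: (rint_bounded (normal_prob 0 s : probability _ R) (M := 1)).
    apply: (measurableT_comp (continuous_measurable_fun (@continuous_cos R))).
    exact: measurable_funD.
  by move=> x; exact: cos_max.
Qed.

Definition gaussian_rv U := exists s, normal_law U s.

Lemma gaussian_pow U m : measurable_fun setT U -> gaussian_rv U ->
  rint P (fun w => (1 + `|U w|) ^+ m).
Proof. by move=> mU [s /(normal_law_facts mU)[]]. Qed.

Lemma gaussian_sqint U : measurable_fun setT U -> gaussian_rv U -> sqint P U.
Proof.
move=> mU gU; split => //; apply: rint_le (gaussian_pow 2 mU gU).
  exact: measurable_funX.
by move=> w; rewrite normrX lerXn2r ?nnegrE ?addr_ge0// lerDr.
Qed.

Lemma gaussian_cos U th : measurable_fun setT U -> gaussian_rv U ->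
  \int[P]_w cos (U w + th) = cos th * expR (- (\int[P]_w (U w ^+ 2) / 2)).
Proof. by move=> mU [s /(normal_law_facts mU)[_ -> ->]]. Qed.

End normal_rv.

(** The norm is a maximum attained at a coordinate, unless it vanishes; the summand 1 covers that
    case, in particular N = 0. *)
Lemma pow_norm_le (R : realType) N (x : 'rV[R]_N) m :
  (1 + `|x|) ^+ m <= 1 + \sum_i (1 + `|x 0 i|) ^+ m.
Proof.
have sum0 : 0 <= \sum_i (1 + `|x 0 i|) ^+ m.
  by apply: sumr_ge0 => i _; rewrite exprn_ge0// addr_ge0.
have [x0|x0] := eqVneq (mx_norm x) 0.
  have -> : `|x| = 0 by [].
  by rewrite addr0 expr1n lerDl.
have [[i j]/= xE] := mx_norm_neq0 x0.
have -> : `|x| = `|x 0 j| by rewrite [LHS]/Num.Def.normr/= xE (ord1 i).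
rewrite ler_wpDl// (bigD1 j)//= lerDl.
by apply: sumr_ge0 => k _; rewrite exprn_ge0// addr_ge0.
Qed.

Lemma rint_pow_norm d (T : measurableType d) (R : realType) (P : probability T R)
    N (xi : T -> 'rV[R]_N) m :
  (forall i, measurable_fun setT (fun w => xi w 0 i)) ->
  (forall i, rint P (fun w => (1 + `|xi w 0 i|) ^+ m)) ->
  rint P (fun w => (1 + `|xi w|) ^+ m).
Proof.
move=> mxi Ixi.
have I := rintD (rint_cst P 1) (rint_sum (index_enum 'I_N) xpredT Ixi).
apply: (rint_le _ _ I).
  apply: (measurable_rV_comp (G := fun x : 'rV[R]_N => (1 + `|x|) ^+ m) mxi).
  move=> x; apply: (@continuous_comp _ _ _ (fun x : 'rV[R]_N => 1 + `|x|) (fun y => y ^+ m)).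
    by apply: (contD (@cont_cst _ _ 1)); exact: norm_continuous.
  exact: exprn_continuous.
move=> w; rewrite ger0_norm; last by rewrite exprn_ge0 ?addr_ge0.
exact: pow_norm_le.
Qed.

Lemma rint_prodM d1 d2 (T1 : measurableType d1) (T2 : measurableType d2)
    (R : realType) (P1 : probability T1 R) (P2 : probability T2 R) f g :
  rint P1 f -> rint P2 g -> rint (P1 \x P2)%E (fun p => f p.1 * g p.2).
Proof.
move=> If Ig; have mf := rint_measurable If; have mg := rint_measurable Ig.
apply/integrable12ltyP.
  apply/measurable_EFinP; apply: measurable_funM.
    exact: (measurableT_comp mf measurable_fst).
  exact: (measurableT_comp mg measurable_snd).
have -> : (fun x => \int[P2]_y `|(f x * g y)%:E|)%E =
    (fun x => `|(f x)%:E| * \int[P2]_y `|(g y)%:E|)%E.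
  apply/funext => x; under eq_integral do rewrite EFinM abseM.
  rewrite ge0_integralZl//.
  by apply: measurableT_comp => //; exact/measurable_EFinP.
case/integrableP : If => _ If; case/integrableP : Ig => _ Ig.
rewrite ge0_integralZr//; last 2 first.
- by apply: measurableT_comp => //; exact/measurable_EFinP.
- exact: integral_ge0.
by rewrite lte_mul_pinfty// ?integral_ge0// ge0_fin_numE// integral_ge0.
Qed.

Section line_derivative.
Variables (R : realType) (n : nat).

Lemma is_derive_line (h : 'rV[R]_n -> R) (a c : 'rV[R]_n) (y : R) :
  differentiable h (a + y *: c) ->
  is_derive (y : R) (1 : R) (fun t : R => h (a + t *: c))
    (\sum_l c 0 l * partial l h (a + y *: c)).
Proof.
move=> dh; set z := a + y *: c in dh *.
have fE : (fun t : R => t^-1 *: (h (a + (t *: (1 : R) + y) *: c) - h z)) =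
          (fun t : R => t^-1 *: (h (t *: c + z) - h z)).
  apply/funext => t; congr (_ *: (h _ - _)).
  have -> : t *: (1 : R) + y = t + y by rewrite /GRing.scale/= mulr1.
  by rewrite scalerDl addrCA.
have Dc : derivable h z c by exact: diff_derivable.
apply: DeriveDef.
  by move: Dc; rewrite /derivable -fE.
transitivity ('D_c h z); first by rewrite /derive fE.
rewrite deriveE//.
have -> : c = \sum_l c 0 l *: delta_mx 0 l by rewrite [LHS]row_sum_delta.
rewrite linear_sum/=; apply: eq_bigr => l _.
rewrite linearZ/= summxE (bigD1 l)//= big1 ?addr0.
  by rewrite !mxE !eqxx mulr1 /partial deriveE.
by move=> k kl; rewrite !mxE eqxx/= eq_sym (negbTE kl) mulr0.
Qed.

End line_derivative.

Definition C1poly (R : realType) n (h : 'rV[R]_n -> R) (A : R) (m : nat) : Prop :=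
  [/\ forall z, differentiable h z,
      forall l, continuous (partial l h),
      forall z, `|h z| <= A * (1 + `|z|) ^+ m &
      forall l z, `|partial l h z| <= A * (1 + `|z|) ^+ m].

Section gaussian_ibp.
Context d (T : measurableType d) (R : realType).
Variables (P : probability T R) (n : nat).
Variables (Y : T -> R) (Z : T -> 'rV[R]_n).
Hypothesis mY : measurable_fun setT Y.
Hypothesis mZ : forall i, measurable_fun setT (fun w => Z w 0 i).
Hypothesis gYZ : forall (b : R) (a : 'I_n -> R),
  gaussian_rv P (fun w => b * Y w + \sum_i a i * Z w 0 i).

Let U b a w := b * Y w + \sum_i a i * Z w 0 i.

Let mU b a : measurable_fun setT (U b a).
Proof.
apply: measurable_funD; first exact: measurable_funM.
by apply: measurable_sum => i; exact: measurable_funM.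
Qed.

Let gU b a : gaussian_rv P (U b a). Proof. exact: gYZ. Qed.

Let UZ i w : U 0 (fun j => (j == i)%:R) w = Z w 0 i.
Proof.
rewrite /U mul0r add0r (bigD1 i)//= eqxx mul1r big1 ?addr0//.
by move=> j /negbTE ->; rewrite mul0r.
Qed.

Let UY w : U 1 (fun=> 0) w = Y w.
Proof. by rewrite /U mul1r big1 ?addr0// => i _; rewrite mul0r. Qed.

Let gZ i : gaussian_rv P (fun w => Z w 0 i).
Proof. by have := gU 0 (fun j => (j == i)%:R); rewrite (funext (UZ i)). Qed.

Let gY : gaussian_rv P Y.
Proof. by have := gU 1 (fun=> 0); rewrite (funext UY). Qed.

Let SY : sqint P Y := gaussian_sqint mY gY.
Let SZ i : sqint P (fun w => Z w 0 i) := gaussian_sqint (mZ i) (gZ i).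

Variables (h : 'rV[R]_n -> R) (A : R) (m : nat).
Hypothesis hA : C1poly h A m.

Let ch : continuous h.
Proof. by move=> z; apply: differentiable_continuous; case: hA. Qed.

Let A0 : 0 <= A.
Proof.
case: hA => _ _ /(_ 0) + _ => /(le_trans (normr_ge0 _)).
by rewrite normr0 addr0 expr1n mulr1.
Qed.

Lemma sqint_poly_gaussian (g : 'rV[R]_n -> R) B k : continuous g ->
  (forall z, `|g z| <= B * (1 + `|z|) ^+ k) -> sqint P (fun w => g (Z w)).
Proof.
move=> cg gB; have mg := measurable_rV_comp mZ cg; split => //.
have I := rint_pow_norm mZ (fun i => gaussian_pow (2 * k) (mZ i) (gZ i)).
apply: (rint_le _ _ (rintZl (B ^+ 2) I)); first exact: measurable_funX.
move=> w; rewrite normrX mulnC exprM -exprMn lerXn2r ?nnegrE//.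
by rewrite (le_trans _ (gB (Z w))).
Qed.

Let s2 := \int[P]_w (Y w ^+ 2).

(** If E Y^2 = 0, the Cauchy-Schwarz inequality makes E (Y f) vanish for all square integrable f,
    hence both sides. The case is separate because the regression coefficients divide by E Y^2. *)
Lemma gaussian_ibp_degenerate : s2 = 0 ->
  \int[P]_w (Y w * h (Z w)) =
  \sum_l \int[P]_w (Y w * Z w 0 l) * \int[P]_w partial l h (Z w).
Proof.
move=> s20.
have Y0 f : sqint P f -> \int[P]_w (Y w * f w) = 0.
  move=> Sf; have := Rint_CS SY Sf; rewrite -/s2 s20 mul0r => le0.
  by apply/eqP; rewrite -sqrf_eq0 eq_le le0 sqr_ge0.
rewrite Y0; last by case: hA => _ _ hA' _; exact: (sqint_poly_gaussian ch hA').
by rewrite big1// => l _; rewrite Y0 ?mul0r.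
Qed.

Section nondegenerate.
Hypothesis s2n0 : s2 != 0.

Let s := Num.sqrt s2.

Let s2_ge0 : 0 <= s2. Proof. by apply: Rint_ge0 => w; exact: sqr_ge0. Qed.

Let s0 : s != 0.
Proof. by rewrite sqrtr_eq0 -ltNge lt_neqAle eq_sym s2n0. Qed.

Let sE : s ^+ 2 = s2. Proof. by rewrite sqr_sqrtr. Qed.

(** Regression coefficients of [Z] on [Y]: they make [W] uncorrelated with [Y]. *)
Let c l := \int[P]_w (Y w * Z w 0 l) / s2.
Let cv : 'rV[R]_n := \row_l c l.
Let gam : probability _ R := normal_prob 0 s.

Let W (w : T) : 'rV[R]_n := Z w - Y w *: cv.

Let WE l w : W w 0 l = U (- c l) (fun j => (j == l)%:R) w.
Proof.
rewrite /W /U !mxE (bigD1 l)//= eqxx mul1r big1 ?addr0; last first.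
  by move=> j /negbTE ->; rewrite mul0r.
by rewrite [RHS]addrC mulNr [Y w * _]mulrC.
Qed.

Let mW l : measurable_fun setT (fun w => W w 0 l).
Proof. by under eq_fun do rewrite WE; exact: mU. Qed.

Let gW l : gaussian_rv P (fun w => W w 0 l).
Proof. by under eq_fun do rewrite WE; exact: gU. Qed.

Let tl (x : 'rV[R]_n.+1) : 'rV[R]_n := \row_l x 0 (lift ord0 l).

Let hd_tl (y : R) (z : 'rV[R]_n) : 'rV[R]_n.+1 :=
  \row_i if unlift ord0 i is Some l then z 0 l else y.

Let hd_tl0 y z : hd_tl y z 0 ord0 = y.
Proof. by rewrite mxE unlift_none. Qed.

Let hd_tlS y z l : hd_tl y z 0 (lift ord0 l) = z 0 l.
Proof. by rewrite mxE liftK. Qed.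

Let tl_hd_tl y z : tl (hd_tl y z) = z.
Proof. by apply/rowP => l; rewrite mxE hd_tlS. Qed.

(** [xi] is the pair (Y, Z) on the original space; [eta] rebuilds it on a product space from a
    normal variable and an independent copy of [W]. Equality of their laws is the form in which the
    independence of [Y] and [W] is used. *)
Let xi w := hd_tl (Y w) (Z w).
Let eta (p : measurableTypeR R * T) := hd_tl p.1 (W p.2 + p.1 *: cv).

Let mxi i : measurable_fun setT (fun w => xi w 0 i).
Proof.
case: (unliftP ord0 i) => [l ->|->]; under eq_fun do rewrite ?hd_tlS ?hd_tl0.
  exact: mZ.
exact: mY.
Qed.

Let etaS l p : eta p 0 (lift ord0 l) = W p.2 0 l + p.1 * c l.
Proof. by rewrite hd_tlS !mxE. Qed.

Let mW2 l : measurable_fun setT (fun p : measurableTypeR R * T => W p.2 0 l).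
Proof. exact: (measurableT_comp (mW l) measurable_snd). Qed.

Let meta i : measurable_fun setT (fun w => eta w 0 i).
Proof.
case: (unliftP ord0 i) => [l ->|->].
  under eq_fun do rewrite etaS.
  by apply: measurable_funD => //; exact: measurable_funM.
under eq_fun do rewrite hd_tl0.
exact: measurable_fst.
Qed.

Let Ixi k : rint P (fun w => (1 + `|xi w|) ^+ k).
Proof.
apply: rint_pow_norm => // i.
case: (unliftP ord0 i) => [l ->|->]; under eq_fun do rewrite ?hd_tlS ?hd_tl0.
  exact: gaussian_pow.
exact: gaussian_pow.
Qed.

Let Ieta k : rint (gam \x P)%E (fun p => (1 + `|eta p|) ^+ k).
Proof.
apply: rint_pow_norm => // i.
have mi : measurable_fun setT (fun p => (1 + `|eta p 0 i|) ^+ k).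
  apply: measurable_funX; apply: measurable_funD => //.
  exact: (measurableT_comp _ (meta i)).
case: (unliftP ord0 i) mi => [l ->|->] mi.
  have I := rintZl ((1 + `|c l|) ^+ k)
    (rint_prodM (rint_normal_pow s0 k) (gaussian_pow k (mW l) (gW l))).
  apply: (rint_le mi _ I) => p.
  rewrite ger0_norm ?exprn_ge0 ?addr_ge0// -!exprMn lerXn2r ?nnegrE ?mulr_ge0 ?addr_ge0//.
  rewrite etaS; have := ler_normD (W p.2 0 l) (p.1 * c l); rewrite normrM.
  have := normr_ge0 (W p.2 0 l); have := normr_ge0 p.1; have := normr_ge0 (c l).
  set a := `|c l|; set b := `|p.1|; set e := `|W _ _ _|; set q := `|_ + _|.
  move=> a0 b0 e0 qle.
  have ab0 : 0 <= a * b by exact: mulr_ge0.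
  have ae0 : 0 <= a * e by exact: mulr_ge0.
  have be0 : 0 <= b * e by exact: mulr_ge0.
  have abe0 : 0 <= a * (b * e) by exact: mulr_ge0.
  by lra.
have I := rint_prodM (rint_normal_pow s0 k) (rint_cst P 1).
apply: (rint_le mi _ I) => p.
by rewrite hd_tl0 mulr1 ger0_norm ?exprn_ge0 ?addr_ge0.
Qed.

(** The second factor is the combination of the coordinates of [W] with coefficients [a]. *)
Let cov0 (a : 'I_n -> R) :
  \int[P]_w (Y w * U (- \sum_i a i * c i) a w) = 0.
Proof.
under eq_Rintegral do rewrite /U mulrDr mulr_sumr mulrCA -expr2.
have IYZ i : rint P (fun w => Y w * (a i * Z w 0 i)).
  by apply: sqintM SY _; exact: sqintZl.
rewrite RintD; [|exact/rintZl/SY.2|exact: rint_sum].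
rewrite RintZl; last exact: SY.2.
rewrite Rint_sum// -/s2 mulNr mulr_suml addrC; apply/eqP; rewrite subr_eq0; apply/eqP.
apply: eq_bigr => i _; under eq_Rintegral do rewrite mulrCA.
by rewrite RintZl; [rewrite /c; field|exact: sqintM].
Qed.

(** Both linear forms are b Y + V with V a combination of the coordinates of [W]. On the left the
    form is Gaussian, and its variance splits as b^2 E Y^2 + E V^2 since the cross term is [cov0];
    on the right the two Gaussian factors are integrated one after the other. *)
Let cos_eq (a : 'I_n.+1 -> R) th :
  \int[P]_w cos (\sum_i a i * xi w 0 i + th) =
  \int[(gam \x P)%E]_p cos (\sum_i a i * eta p 0 i + th).
Proof.
pose a' l := a (lift ord0 l); pose ac := \sum_l a' l * c l.
pose V := U (- ac) a'; pose b := a ord0 + ac.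
have mV : measurable_fun setT V by exact: mU.
have SV : sqint P V := gaussian_sqint mV (gU _ _).
have xiE w : \sum_i a i * xi w 0 i = b * Y w + V w.
  rewrite big_ord_recl hd_tl0 /b /V /U mulrDl mulNr addrA addrK.
  by congr (_ + _); apply: eq_bigr => l _; rewrite hd_tlS.
have etaE p : \sum_i a i * eta p 0 i = V p.2 + b * p.1.
  rewrite big_ord_recl hd_tl0 /b mulrDl [RHS]addrCA; congr (_ + _).
  under eq_bigr do rewrite etaS mulrDr.
  rewrite big_split/=; congr (_ + _).
    rewrite /V /U mulNr addrC /W; under eq_bigr do rewrite !mxE mulrBr.
    rewrite sumrB; congr (_ - _); rewrite /ac mulr_suml.
    by apply: eq_bigr => l _; rewrite mulrCA mulrC.
  by rewrite /ac mulr_suml; apply: eq_bigr => l _; rewrite mulrA mulrAC.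
under eq_Rintegral do rewrite xiE.
under [RHS]eq_Rintegral do rewrite etaE.
have bYV : (fun w => b * Y w + V w) = U (a ord0) a'.
  by apply/funext => w; rewrite /b /V /U mulrDl mulNr addrA addrK.
have mcos : measurable_fun setT
    (fun p : measurableTypeR R * T => cos (V p.2 + b * p.1 + th)).
  apply: (measurableT_comp (continuous_measurable_fun (@continuous_cos R))).
  apply: measurable_funD => //; apply: measurable_funD.
    exact: (measurableT_comp mV measurable_snd).
  by apply: measurable_funM => //; exact: measurable_fst.
have Icos : rint (gam \x P)%E (fun p => cos (V p.2 + b * p.1 + th)).
  by apply: (rint_bounded (gam \x P)%E mcos (M := 1)) => p; exact: cos_max.
rewrite -(rint_Fubini1 Icos).2/=.
under [RHS]eq_Rintegral => y _.
  under eq_Rintegral do rewrite -addrA.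
  rewrite (gaussian_cos _ mV (gU _ _)).
  over.
rewrite /= RintZr; last first.
  apply: (rint_bounded gam (M := 1)); last by move=> y; exact: cos_max.
  apply: (measurableT_comp (continuous_measurable_fun (@continuous_cos R))).
  by apply: measurable_funD => //; exact: measurable_funM.
rewrite (Rint_normal_cos s0) sE.
have -> : \int[P]_w cos (b * Y w + V w + th) = \int[P]_w cos (U (a ord0) a' w + th).
  by apply: eq_Rintegral => w _; rewrite -bYV.
rewrite (gaussian_cos _ (mU _ _) (gU _ _)) -bYV -[RHS]mulrA -expRD.
congr (_ * expR _).
rewrite Rint_sqrD//; last exact: sqintZl.
under [X in X + _ + _]eq_Rintegral do rewrite exprMn.
rewrite RintZl; last exact: SY.2.
under [X in _ + 2 * X + _]eq_Rintegral do rewrite -mulrA.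
rewrite RintZl; last exact: sqintM.
by rewrite cov0 -/s2; ring.
Qed.

Let continuous_tl : continuous tl.
Proof. by apply: continuous_row => l; exact: coord_continuous. Qed.

Let norm_tl x : `|tl x| <= `|x|.
Proof. by apply: rV_norm_le => // l; rewrite mxE; exact: coord_le_norm. Qed.

Let poly_tl k x : A * (1 + `|tl x|) ^+ k <= A * (1 + `|x|) ^+ k.
Proof. by rewrite ler_wpM2l// lerXn2r ?nnegrE ?addr_ge0// lerD2l. Qed.

Let same_law G B k : continuous G -> (forall x, `|G x| <= B * (1 + `|x|) ^+ k) ->
  \int[P]_w G (xi w) = \int[(gam \x P)%E]_p G (eta p).
Proof.
move=> cG GB; exact: (eq_Rint_of_eq_cos mxi meta cos_eq cG GB (Ixi k) (Ieta k)).
Qed.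

Let rint_eta G B k : continuous G -> (forall x, `|G x| <= B * (1 + `|x|) ^+ k) ->
  rint (gam \x P)%E (fun p => G (eta p)).
Proof.
move=> cG GB; apply: (rint_le (measurable_rV_comp meta cG) _ (rintZl B (Ieta k))).
by move=> p; exact: GB.
Qed.

(** On the product space, with w fixed, Stein's identity applies to y |-> h (W + y c), whose
    derivative is the sum of c_l times the partial derivatives of [h]; and s^2 c_l is E (Y Z_l). *)
Lemma gaussian_ibp_nondegenerate :
  \int[P]_w (Y w * h (Z w)) =
  \sum_l \int[P]_w (Y w * Z w 0 l) * \int[P]_w partial l h (Z w).
Proof.
have [dh cdh hA' dhA] := hA.
pose G1 (x : 'rV[R]_n.+1) := x 0 ord0 * h (tl x).
have cG1 : continuous G1.
  apply: contM; first exact: coord_continuous.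
  by apply: cont_comp => //; exact: continuous_tl.
have G1A x : `|G1 x| <= A * (1 + `|x|) ^+ m.+1.
  rewrite normrM exprS mulrCA ler_pM//.
    by rewrite (le_trans (coord_le_norm x ord0))// lerDr.
  exact: le_trans (hA' _) (poly_tl _ _).
pose G2 l (x : 'rV[R]_n.+1) := partial l h (tl x).
have cG2 l : continuous (G2 l) by apply: cont_comp => //; exact: continuous_tl.
have G2A l x : `|G2 l x| <= A * (1 + `|x|) ^+ m.
  exact: le_trans (dhA _ _) (poly_tl _ _).
have -> : \int[P]_w (Y w * h (Z w)) = \int[P]_w G1 (xi w).
  by apply: eq_Rintegral => w _; rewrite /G1 hd_tl0 tl_hd_tl.
rewrite (same_law cG1 G1A).
have -> : \sum_l \int[P]_w (Y w * Z w 0 l) * \int[P]_w partial l h (Z w) =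
    \sum_l s2 * c l * \int[(gam \x P)%E]_p G2 l (eta p).
  apply: eq_bigr => l _; rewrite -(same_law (cG2 l) (G2A l)); congr (_ * _).
    by rewrite /c mulrC mulfVK.
  by apply: eq_Rintegral => w _; rewrite /G2 tl_hd_tl.
have I2 l : rint (gam \x P)%E (fun p => c l * G2 l (eta p)).
  by apply: rintZl; exact: rint_eta (cG2 l) (G2A l).
have -> : \sum_l s2 * c l * \int[(gam \x P)%E]_p G2 l (eta p) =
    s2 * \int[(gam \x P)%E]_p (\sum_l c l * G2 l (eta p)).
  rewrite Rint_sum// mulr_sumr; apply: eq_bigr => l _; rewrite -mulrA RintZl//.
  exact: rint_eta (cG2 l) (G2A l).
rewrite -(rint_Fubini2 (rint_eta cG1 G1A)) -(rint_Fubini2 (rint_sum _ _ I2)).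
have IF : rint P (fun w => \int[gam]_y (\sum_l c l * G2 l (eta (y, w)))).
  have := rint_swap (rint_sum (index_enum 'I_n) xpredT I2).
  by move=> /rint_Fubini1[].
rewrite -RintZl//; apply: eq_Rintegral => w _.
pose F (y : R) := h (W w + y *: cv).
pose F' (y : R) := \sum_l c l * partial l h (W w + y *: cv).
have lin_cont : continuous (fun y : R => W w + y *: cv).
  move=> y; apply: cvgD; first exact: cvg_cst.
  by apply: cvgZr_tmp; exact: cvg_id.
pose D := (1 + `|W w|) * (1 + `|cv|).
have D1 : 1 <= D by rewrite /D -[leLHS]mulr1 ler_pM// lerDl.
have D0 : 0 <= D by rewrite (le_trans ler01).
have bnd (y : R) : (1 + `|W w + y *: cv|) ^+ m <= D ^+ m * (1 + `|y|) ^+ m.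
  rewrite -exprMn lerXn2r ?nnegrE ?mulr_ge0 ?addr_ge0//.
  have := ler_normD (W w) (y *: cv); rewrite normrZ /D.
  have := normr_ge0 (W w); have := normr_ge0 y; have := normr_ge0 cv.
  set a := `|cv|; set b := `|y|; set e := `|W _|; set q := `|_ + _|.
  move=> a0 b0 e0 qle.
  have ab0 : 0 <= a * b by exact: mulr_ge0.
  have ae0 : 0 <= a * e by exact: mulr_ge0.
  have be0 : 0 <= b * e by exact: mulr_ge0.
  have abe0 : 0 <= a * (b * e) by exact: mulr_ge0.
  by lra.
(* Stein's identity wants one bound for F and F': the summand 1 serves F, the sum serves F'. *)
pose C := 1 + \sum_l `|c l|.
have C1 : 1 <= C by rewrite lerDl sumr_ge0.
have -> : \int[gam]_y (\sum_l c l * G2 l (eta (y, w))) = \int[gam]_y F' y.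
  apply: eq_Rintegral => y _; apply: eq_bigr => l _.
  by rewrite /G2 tl_hd_tl.
rewrite -sE; transitivity (\int[gam]_y (y * F y)).
  by apply: eq_Rintegral => y _; rewrite /G1 hd_tl0 tl_hd_tl.
apply: (@normal_Stein _ s s0 F F' (C * A * D ^+ m) m).
- move=> y; refine (is_derive_eq (is_derive_line _) _) => //.
  by apply: eq_bigr => l _; rewrite mxE.
- apply: cont_sum => l; apply: contM; first exact: cont_cst.
  exact: cont_comp lin_cont (cdh l).
- move=> y; rewrite (le_trans (hA' _))// -!mulrA.
  apply: (@le_trans _ _ (1 * (A * (D ^+ m * (1 + `|y|) ^+ m)))).
    by rewrite mul1r ler_wpM2l.
  by rewrite ler_wpM2r// mulr_ge0// mulr_ge0 ?exprn_ge0// addr_ge0.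
- move=> y; rewrite /F' (le_trans (ler_norm_sum _ _ _))//.
  apply: (@le_trans _ _ (\sum_l `|c l| * (A * (D ^+ m * (1 + `|y|) ^+ m)))).
    apply: ler_sum => l _; rewrite normrM ler_wpM2l//.
    by rewrite (le_trans (dhA _ _))// ler_wpM2l.
  rewrite -mulr_suml -!mulrA ler_wpM2r ?lerDr//.
  by rewrite mulr_ge0// mulr_ge0 ?exprn_ge0// addr_ge0.
Qed.

End nondegenerate.

Lemma gaussian_ibp :
  \int[P]_w (Y w * h (Z w)) =
  \sum_l \int[P]_w (Y w * Z w 0 l) * \int[P]_w partial l h (Z w).
Proof.
have [s20|s20] := eqVneq s2 0.
  exact: gaussian_ibp_degenerate.
exact: gaussian_ibp_nondegenerate.
Qed.

End gaussian_ibp.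

(** * The integration by parts identity for Gaussian processes *)

Section smooth_functions.
Variables (R : realType) (n : nat).
Implicit Types (g : 'rV[R]_n -> R).

Lemma Cpinf_partial g k : Cpinf g -> Cpinf (partial k g).
Proof. by move=> Cg ks; have := Cg (rcons ks k); rewrite foldr_rcons. Qed.

Lemma Cpinf_C1poly g : Cpinf g -> exists A m, C1poly g A m.
Proof.
move=> Cg; have [dg [C0 [m0 b0]]] := Cg [::].
have /choice[Cm Cmb] l : exists Cm : R * nat, forall z,
    `|partial l g z| <= Cm.1 * (1 + `|z|) ^+ Cm.2.
  by have [_ [C [m bl]]] := Cg [:: l]; exists (C, m).
exists (`|C0| + \sum_l `|(Cm l).1|), (m0 + \sum_l (Cm l).2)%N.
have z1 (z : 'rV[R]_n) : 1 <= 1 + `|z| by rewrite lerDl.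
have z0 (z : 'rV[R]_n) k : 0 <= (1 + `|z|) ^+ k by rewrite exprn_ge0// addr_ge0.
have S0 : 0 <= \sum_l `|(Cm l).1| by exact: sumr_ge0.
have up (C B : R) (m k : nat) z : `|C| <= B -> (m <= k)%N ->
    C * (1 + `|z : 'rV[R]_n|) ^+ m <= B * (1 + `|z|) ^+ k.
  move=> CB mk; apply: (@le_trans _ _ (`|C| * (1 + `|z|) ^+ m)).
    by rewrite ler_wpM2r// ler_norm.
  by rewrite ler_pM// ler_weXn2l.
split => //.
- move=> l z; apply: differentiable_continuous.
  by have [dl _] := Cg [:: l]; exact: dl.
- by move=> z; rewrite (le_trans (b0 z))// up ?lerDl ?leq_addr.
- move=> l z; rewrite (le_trans (Cmb l z))// up//.
    rewrite (bigD1 l)//= addrCA lerDl addr_ge0//.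
    exact: sumr_ge0.
  by rewrite (bigD1 l)//= addnCA leq_addr.
Qed.

Lemma partial_line g k (a : 'rV[R]_n) (y : R) : differentiable g (a + y *: delta_mx 0 k) ->
  is_derive (y : R) (1 : R) (fun t : R => g (a + t *: delta_mx 0 k))
    (partial k g (a + y *: delta_mx 0 k)).
Proof.
move=> dg; refine (is_derive_eq (is_derive_line dg) _).
rewrite (bigD1 k)//= mxE !eqxx mul1r big1 ?addr0// => l lk.
by rewrite mxE eqxx/= (negbTE lk) mul0r.
Qed.

(** Two mean value theorems: in direction k for the first difference in direction l, then in
    direction l for [partial k g]. *)
Lemma second_difference g k l (z : 'rV[R]_n) (s : R) :
  (forall z, differentiable g z) -> (forall z, differentiable (partial k g) z) ->
  exists y, `|z - y| <= 2 * `|s| /\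
    g (z + s *: delta_mx 0 l + s *: delta_mx 0 k) - g (z + s *: delta_mx 0 l)
    - (g (z + s *: delta_mx 0 k) - g z) = s * s * partial l (partial k g) y.
Proof.
move=> dg dkg.
pose phi t := g (z + s *: delta_mx 0 l + t *: delta_mx 0 k)
              - g (z + t *: delta_mx 0 k).
have dphi (t : R) : is_derive (t : R) (1 : R) phi
    (partial k g (z + s *: delta_mx 0 l + t *: delta_mx 0 k) -
     partial k g (z + t *: delta_mx 0 k)).
  by apply: is_deriveB; exact: partial_line.
have [c c_s phic] := MVT_between 0 s dphi.
pose psi t := partial k g (z + c *: delta_mx 0 k + t *: delta_mx 0 l).
have dpsi (t : R) : is_derive (t : R) (1 : R) psi
    (partial l (partial k g) (z + c *: delta_mx 0 k + t *: delta_mx 0 l)).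
  exact: partial_line.
have [b b_s psib] := MVT_between 0 s dpsi.
have nd j (u : R) : `|u *: (delta_mx 0 j : 'rV[R]_n)| <= `|u|.
  apply: rV_norm_le => // i; rewrite !mxE eqxx/= normrM ler_piMr//.
  by case: eqP => _; rewrite ?normr1 ?normr0.
exists (z + c *: delta_mx 0 k + b *: delta_mx 0 l); split.
  rewrite -addrA opprD addNKr normrN (le_trans (ler_normD _ _))//.
  rewrite [2]mulr2n mulrDl mul1r lerD// (le_trans (nd _ _))//.
    by move: c_s; rewrite !subr0.
  by move: b_s; rewrite !subr0.
have -> : g (z + s *: delta_mx 0 l + s *: delta_mx 0 k) - g (z + s *: delta_mx 0 l)
    - (g (z + s *: delta_mx 0 k) - g z) = phi s - phi 0.
  by rewrite /phi !scale0r !addr0; ring.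
rewrite phic subr0 mulrC -mulrA; congr (_ * _).
have := psib; rewrite /psi scale0r addr0 subr0 mulrC => <-.
by rewrite addrAC.
Qed.

(** The second difference is symmetric in k and l; divided by the square of the step 1 / (m + 1) it
    tends to either mixed derivative. Integration by parts applied to [partial k g] produces the
    derivatives in the order opposite to that of the second Malliavin derivative. *)
Lemma partial_sym g k l z : Cpinf g ->
  partial k (partial l g) z = partial l (partial k g) z.
Proof.
move=> Cg.
have dg z' : differentiable g z' by have [] := Cg [::].
have d1 j z' : differentiable (partial j g) z' by have [] := Cg [:: j].
have c2 i j : continuous (partial i (partial j g)).
  by move=> z'; apply: differentiable_continuous; have [] := Cg [:: i; j].
have seq_cvg i j : exists2 y : nat -> 'rV[R]_n, (y m @[m --> \oo] --> z) &
    forall m, g (z + m.+1%:R^-1 *: delta_mx 0 j + m.+1%:R^-1 *: delta_mx 0 i)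
      - g (z + m.+1%:R^-1 *: delta_mx 0 j) - (g (z + m.+1%:R^-1 *: delta_mx 0 i) - g z) =
      m.+1%:R^-1 * m.+1%:R^-1 * partial j (partial i g) (y m).
  have [y yP] := choice (fun m => second_difference j z m.+1%:R^-1 dg (d1 i)).
  exists y => [|m]; last by have [] := yP m.
  apply/cvgrPdist_le => e e0; near=> m.
  have [ym _] := yP m; rewrite (le_trans ym)// ger0_norm//.
  rewrite ler_pdivrMr ?ltr0n// -ler_pdivrMl//.
  rewrite (le_trans (y := m%:R)) ?ler_nat//.
  by near: m; exact: nbhs_infty_ger.
have [y1 y1z y1E] := seq_cvg k l; have [y2 y2z y2E] := seq_cvg l k.
have cc i j (y : nat -> 'rV[R]_n) : y m @[m --> \oo] --> z ->
    partial i (partial j g) (y m) @[m --> \oo] --> partial i (partial j g) z.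
  by move=> yz; apply: continuous_cvg => //; exact: c2.
have c1 := cc l k y1 y1z; have c2' := cc k l y2 y2z.
suff E : (fun m => partial k (partial l g) (y2 m)) =
         (fun m => partial l (partial k g) (y1 m)).
  by rewrite E in c2'; exact: (cvg_unique _ c2' c1).
apply/funext => m; have := y1E m.
have m0 : m.+1%:R^-1 * m.+1%:R^-1 != 0 :> R by rewrite mulf_neq0.
have -> : g (z + m.+1%:R^-1 *: delta_mx 0 l + m.+1%:R^-1 *: delta_mx 0 k) -
    g (z + m.+1%:R^-1 *: delta_mx 0 l) - (g (z + m.+1%:R^-1 *: delta_mx 0 k) - g z) =
  g (z + m.+1%:R^-1 *: delta_mx 0 k + m.+1%:R^-1 *: delta_mx 0 l) -
    g (z + m.+1%:R^-1 *: delta_mx 0 k) - (g (z + m.+1%:R^-1 *: delta_mx 0 l) - g z).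
  by rewrite [z + _ + _]addrAC; ring.
by rewrite y2E => /(mulfI m0).
Unshelve. all: by end_near. Qed.

End smooth_functions.

(** * Step functions, and the adjoint operator on the second derivative *)

Section step_functions.
Variable R : realType.
Local Notation tR := (measurableTypeR R).

Lemma measurable_step_fun (e : step R R) : measurable_fun setT (step_fun e : tR -> R).
Proof.
rewrite /step_fun; elim: e => [|p e ih].
  by under eq_fun do rewrite big_nil; exact: measurable_cst.
under eq_fun do rewrite big_cons; apply: measurable_funD => //.
by apply: measurable_funM => //; exact: measurable_indic.
Qed.

Lemma step_fun_bounded (e : step R R) : exists M, forall t, `|step_fun e t| <= M.
Proof.
exists (\sum_(p <- e) `|p.1|) => t; rewrite (le_trans (ler_norm_sum _ _ _))//.
apply: ler_sum => p _; rewrite normrM ler_piMr// indicE.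
by case: (_ \in _); rewrite ?normr1 ?normr0.
Qed.

Definition Kstep (K : R * R -> R) (e : step R R) (s : R) : R :=
  \sum_(p <- e) p.1 * K (p.2, s).

Lemma Re_realM (x : R) (y : R[i]) : complex.Re (x%:C%C * y) = x * complex.Re y.
Proof. by case: y => a b /=; rewrite mul0r subr0. Qed.

Lemma Im_realM (x : R) (y : R[i]) : complex.Im (x%:C%C * y) = x * complex.Im y.
Proof. by case: y => a b /=; rewrite mul0r addr0. Qed.

Lemma Re_Mreal (x : R) (y : R[i]) : complex.Re (y * x%:C%C) = complex.Re y * x.
Proof. by rewrite mulrC Re_realM mulrC. Qed.

Lemma Im_Mreal (x : R) (y : R[i]) : complex.Im (y * x%:C%C) = complex.Im y * x.
Proof. by rewrite mulrC Im_realM mulrC. Qed.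

Lemma Re_sum J (s : seq J) (F : J -> R[i]) :
  complex.Re (\sum_(j <- s) F j) = \sum_(j <- s) complex.Re (F j).
Proof. by apply: (big_morph _ _ (erefl _)) => -[a b] [c d]. Qed.

Lemma Im_sum J (s : seq J) (F : J -> R[i]) :
  complex.Im (\sum_(j <- s) F j) = \sum_(j <- s) complex.Im (F j).
Proof. by apply: (big_morph _ _ (erefl _)) => -[a b] [c d]. Qed.

Lemma Kstar_malliavinD2 (K : R * R -> R) (I : set R) (f : smooth_functional I) t x s :
  Kstar K (malliavinD2 f t x) s =
  \sum_(k < sf_n f) \sum_(l < sf_n f)
    cpartial k (cpartial l (sf_g f)) (sf_z f x)
    * (step_fun (sf_e f k) t)%:C%C * (Kstep K (sf_e f l) s)%:C%C.
Proof.
have s0 : Kstar K [::] s = 0 by rewrite /Kstar big_nil.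
have sD : {morph (fun e => Kstar K e s) : e1 e2 / e1 ++ e2 >-> e1 + e2}.
  by move=> e1 e2; rewrite /Kstar big_cat.
rewrite /malliavinD2 (big_morph _ sD s0); apply: eq_bigr => k _.
rewrite (big_morph _ sD s0); apply: eq_bigr => l _; rewrite /Kstar.
set c := (X in step_scale X _); rewrite -/c.
rewrite /step_scale big_map /Kstep rmorph_sum mulr_sumr.
by apply: eq_bigr => p _; rewrite /= rmorphM mulrA.
Qed.

End step_functions.

Lemma sqint_sum_seq d (T : measurableType d) (R : realType)
    (m : {measure set T -> \bar R}) (J : eqType) (s : seq J) (F : J -> T -> R) :
  (forall j, j \in s -> sqint m (F j)) -> sqint m (fun x => \sum_(j <- s) F j x).
Proof.
elim: s => [|j s ih] SF.
  by under eq_fun do rewrite big_nil; exact: sqint0.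
under eq_fun do rewrite big_cons; apply: sqintD.
  by apply: SF; rewrite mem_head.
by apply: ih => k ks; apply: SF; rewrite inE ks orbT.
Qed.

(** * The identity for real functionals of a Gaussian process *)

Section gaussian_process.
Context d (T : measurableType d) (R : realType) (P : probability T R).
Variables (X : R -> T -> R) (K : R * R -> R) (I : set R).
Local Notation tR := (measurableTypeR R).
Local Notation mu := (@leb01 R).
Hypothesis mX : measurable_fun setT (fun p : tR * T => X p.1 p.2).
Hypothesis SX : sqint (mu \x P)%E (fun p => X p.1 p.2).
Hypothesis SK : sqint (mu \x mu)%E K.
Hypothesis fI : full_times I.
Hypothesis GX : fredholm_gaussian_on P X K I.

Let mXt t : measurable_fun setT (X t).
Proof. exact: (measurableT_comp mX (measurable_pair1 t)). Qed.

Lemma gaussian_list (s : seq (R * R)) : (forall p, p \in s -> I p.2) ->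
  gaussian_rv P (fun w => \sum_(p <- s) p.1 * X p.2 w).
Proof.
move=> sI; have [gX _] := GX.
have [|r rP] := gX (size s) (fun i => (tnth (in_tuple s) i).1)
  (fun i => (tnth (in_tuple s) i).2).
  by move=> i; apply: sI; exact: mem_tnth.
exists r => A mA; rewrite -rP//; congr (P (_ @^-1` A)).
by apply/funext => w; rewrite big_tnth.
Qed.

(** The covariance equation on the diagonal, read in the extended reals: \int K(t, u)^2 du is E
    X_t^2, which is finite for a Gaussian variable. This holds at every t in [I], and not merely
    almost everywhere as the hypothesis on [K] alone would give. *)
Lemma sqint_Kt t : I t -> sqint mu (fun s => K (t, s)).
Proof.
move=> It; have mKt : measurable_fun setT (fun s : tR => K (t, s)).
  exact: (measurableT_comp (sqint_measurable SK) (measurable_pair1 t)).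
split => //; apply/integrableP; split.
  by apply/measurable_EFinP; exact: measurable_funX.
have St : sqint P (X t).
  apply: gaussian_sqint => //.
  have := @gaussian_list [:: (1, t)].
  under eq_fun do rewrite big_seq1 mul1r; apply => p.
  by rewrite inE => /eqP ->.
have [_ /(_ t t It It) KE] := GX.
rewrite (eq_integral (fun s : tR => (K (t, s) * K (t, s))%:E)); last first.
  by move=> s _; rewrite /= ger0_norm ?sqr_ge0// expr2.
rewrite -KE; case/integrableP : St.2 => _; apply: le_lt_trans.
rewrite le_eqVlt; apply/orP; left; apply/eqP; apply: eq_integral => w _.
by rewrite /= ger0_norm ?sqr_ge0// expr2.
Qed.

Variables (n : nat) (e : 'I_n -> step R R).
Hypothesis eI : forall k, step_on I (e k).

Let z (w : T) : 'rV[R]_n := \row_k step_int (e k) (X^~ w).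

Let mz k : measurable_fun setT (fun w => z w 0 k).
Proof.
under eq_fun do rewrite mxE /step_int.
by apply: measurable_sum => p; exact: measurable_funM.
Qed.

Let gz t : I t -> forall (b : R) (a : 'I_n -> R),
  gaussian_rv P (fun w => b * X t w + \sum_i a i * z w 0 i).
Proof.
move=> It b a.
pose s := (b, t) :: flatten [seq [seq (a i * p.1, p.2) | p <- e i] | i <- index_enum 'I_n].
have -> : (fun w => b * X t w + \sum_i a i * z w 0 i) =
          (fun w => \sum_(p <- s) p.1 * X p.2 w).
  apply/funext => w; rewrite big_cons/=; congr (_ + _).
  rewrite big_flatten big_map; apply: eq_bigr => i _.
  rewrite big_map mxE /step_int mulr_sumr.
  by apply: eq_bigr => p _; rewrite mulrA.
apply: gaussian_list => p; rewrite inE => /predU1P[->//|/flattenP[q /mapP[i _ ->]]].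
by move=> /mapP[q' /eI[_ Iq] ->].
Qed.

(** [gz] speaks of a time in [I]; statements about [z] alone need one to instantiate it. *)
Let Iexists : exists t, I t.
Proof.
apply: contrapT => noI; have [_ [N [mN N0 IN]]] := fI.
have NT : N = setT.
  by apply/seteqP; split => // x _; apply: IN => Ix; apply: noI; exists x.
by move: N0; rewrite NT [LHS]leb01_setT => /eqP; rewrite onee_eq0.
Qed.

Let sqint_poly_z (h : 'rV[R]_n -> R) A m : C1poly h A m -> sqint P (fun w => h (z w)).
Proof.
move=> [dh _ hA _]; have [t It] := Iexists.
have ch : continuous h by move=> y; exact: differentiable_continuous.
exact: (sqint_poly_gaussian mz (gz It) ch hA).
Qed.

Let Ks l := Kstep K (e l) : tR -> R.

Let sqint_Ks l : sqint mu (Ks l).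
Proof.
apply: sqint_sum_seq => p /eI[_ Ip].
by apply: sqintZl; exact: sqint_Kt.
Qed.

Let ef k : tR -> R := step_fun (e k).

Let mef k : measurable_fun setT (ef k). Proof. exact: measurable_step_fun. Qed.

Let sqint_snd d' (T' : measurableType d') (P' : probability T' R) (f : T' -> R) :
  sqint P' f -> sqint (mu \x P')%E (fun p => f p.2).
Proof.
move=> [mf If]; split; first exact: (measurableT_comp mf measurable_snd).
have := rint_prodM (rint_cst mu 1) If.
by under eq_fun do rewrite mul1r.
Qed.

Let sqintMef k d' (T' : measurableType d') (P' : probability T' R) F :
  sqint (mu \x P')%E F -> sqint (mu \x P')%E (fun p => ef k p.1 * F p).
Proof.
move=> SF; have [M eM] := step_fun_bounded (e k).
apply: (sqintMl SF (M := M)) => [|p]; last exact: eM.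
exact: (measurableT_comp (mef k) measurable_fst).
Qed.

Let IKs k l : rint (mu \x mu)%E (fun p => ef k p.1 * K p * Ks l p.2).
Proof. by apply: sqintM; [exact: sqintMef|exact: sqint_snd]. Qed.

Let B k l := \int[(mu \x mu)%E]_p (ef k p.1 * K p * Ks l p.2).

Variable (g : 'rV[R]_n -> R).
Hypothesis Cg : Cpinf g.

Let lhs w t := X t w * \sum_k partial k g (z w) * ef k t.
Let rhs w t s := K (t, s) *
  \sum_k \sum_l partial k (partial l g) (z w) * ef k t * Ks l s.

Lemma ibp_lhs_ae : {ae P, forall w, rint mu (lhs w)}.
Proof.
have := ae_integrable2 SX.2; apply: filterS => w IXw.
have SXw : sqint mu (X^~ w).
  by split => //; exact: (measurableT_comp mX (measurable_pair2 w)).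
rewrite /lhs; under eq_fun do rewrite mulr_sumr.
apply: rint_sum => k; under eq_fun do rewrite mulrCA.
apply: rintZl; under eq_fun do rewrite mulrC.
have [M eM] := step_fun_bounded (e k).
exact: (rintMl (sqint_rint mu SXw) (mef k) eM).
Qed.

Let rhsE w p : rhs w p.1 p.2 =
  \sum_k \sum_l partial k (partial l g) (z w) * (ef k p.1 * K p * Ks l p.2).
Proof.
rewrite /rhs mulr_sumr; apply: eq_bigr => k _; rewrite mulr_sumr.
by apply: eq_bigr => l _; case: p => t s /=; ring.
Qed.

Lemma ibp_rhs_rint w : rint (mu \x mu)%E (fun p => rhs w p.1 p.2).
Proof.
under eq_fun do rewrite rhsE.
by do 2 apply: rint_sum => ?; exact: rintZl.
Qed.

Let Lhs w := \int[mu]_t lhs w t.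
Let Rhs w := \int[mu]_t \int[mu]_s rhs w t s.

Let RhsE w : Rhs w = \sum_k \sum_l partial k (partial l g) (z w) * B k l.
Proof.
rewrite /Rhs (rint_Fubini1 (ibp_rhs_rint w)).2.
under eq_Rintegral do rewrite rhsE.
rewrite Rint_sum; last by move=> k; apply: rint_sum => l; exact: rintZl.
apply: eq_bigr => k _; rewrite Rint_sum; last by move=> l; exact: rintZl.
by apply: eq_bigr => l _; rewrite RintZl.
Qed.

Let sqint_d2 k l : sqint P (fun w => partial k (partial l g) (z w)).
Proof.
have [A [m Cm]] := Cpinf_C1poly (Cpinf_partial k (Cpinf_partial l Cg)).
exact: sqint_poly_z Cm.
Qed.

Lemma ibp_Rhs : rint P Rhs.
Proof.
rewrite (funext RhsE); do 2 apply: rint_sum => ?; apply: rintZr.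
exact: sqint_rint.
Qed.

Let F k (p : tR * T) := ef k p.1 * X p.1 p.2 * partial k g (z p.2).

Let IF k : rint (mu \x P)%E (F k).
Proof.
apply: sqintM; first exact: (sqintMef k SX).
have [A [m Cm]] := Cpinf_C1poly (Cpinf_partial k Cg).
exact: (sqint_snd (sqint_poly_z Cm)).
Qed.

Let lhsE w t : lhs w t = \sum_k F k (t, w).
Proof. by rewrite /lhs mulr_sumr; apply: eq_bigr => k _; rewrite /F/=; ring. Qed.

Let IsF : rint (mu \x P)%E (fun p => \sum_k F k p).
Proof. by apply: rint_sum => k; exact: IF. Qed.

Lemma ibp_Lhs : rint P Lhs.
Proof.
rewrite /Lhs; under eq_fun do under eq_Rintegral do rewrite lhsE.
exact: (rint_Fubini1 (rint_swap IsF)).1.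
Qed.

(** For t in [I], [gaussian_ibp] with Y = X_t and h = [partial k g] leaves the covariances E (X_t
    z_l), which by linearity in [e l] are \int K(t, s) (K^* e_l)(s) ds. Both sides are therefore
    brought to an integral over t of functions that agree on [I]. *)
Lemma ibp_eq : \int[P]_w Lhs w = \int[P]_w Rhs w.
Proof.
have -> : \int[P]_w Lhs w = \int[mu]_t \int[P]_w lhs w t.
  rewrite /Lhs; under eq_Rintegral do under eq_Rintegral do rewrite lhsE.
  under [RHS]eq_Rintegral do under eq_Rintegral do rewrite lhsE.
  by rewrite -(Rint_Fubini IsF).
have -> : \int[P]_w Rhs w =
    \sum_k \sum_l \int[P]_w partial k (partial l g) (z w) * B k l.
  under eq_Rintegral do rewrite RhsE.
  rewrite Rint_sum; last first.
    by move=> k; apply: rint_sum => l; apply: rintZr; exact: sqint_rint.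
  apply: eq_bigr => k _; rewrite Rint_sum; last first.
    by move=> l; apply: rintZr; exact: sqint_rint.
  by apply: eq_bigr => l _; rewrite RintZr//; exact: sqint_rint.
pose H k l (t : tR) := \int[mu]_s (ef k t * K (t, s) * Ks l s).
have IH k l : rint mu (H k l) := (rint_Fubini1 (IKs k l)).1.
have -> : \sum_k \sum_l \int[P]_w partial k (partial l g) (z w) * B k l =
    \int[mu]_t \sum_k \sum_l \int[P]_w partial k (partial l g) (z w) * H k l t.
  rewrite Rint_sum; last by move=> k; apply: rint_sum => l; exact: rintZl.
  apply: eq_bigr => k _; rewrite Rint_sum; last by move=> l; exact: rintZl.
  apply: eq_bigr => l _; rewrite RintZl//; congr (_ * _).
  by rewrite /H (rint_Fubini1 (IKs k l)).2.
apply: ae_Rint.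
- apply: (@rint_measurable _ _ _ mu).
  under eq_fun do under eq_Rintegral do rewrite lhsE.
  exact: (rint_Fubini1 IsF).1.
- apply: (@rint_measurable _ _ _ mu).
  by do 2 apply: rint_sum => ?; exact: rintZl.
have [_ [N [mN N0 IN]]] := fI; exists N; split => // t /= nE.
apply: IN => It; apply: nE.
have SXt : sqint P (X t).
  apply: gaussian_sqint => //.
  have := gz It 1 (fun=> 0).
  rewrite (_ : (fun w => _) = X t)//; apply/funext => w.
  by rewrite mul1r big1 ?addr0// => i _; rewrite mul0r.
under eq_Rintegral do rewrite /lhs mulr_sumr.
rewrite Rint_sum; last first.
  move=> k; under eq_fun do rewrite mulrA; apply: rintZr.
  have [A [m Cm]] := Cpinf_C1poly (Cpinf_partial k Cg).
  by apply: sqintM => //; exact: sqint_poly_z Cm.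
apply: eq_bigr => k _; under eq_Rintegral do rewrite mulrA.
have [A [m Cm]] := Cpinf_C1poly (Cpinf_partial k Cg).
rewrite RintZr; last by apply: sqintM => //; exact: sqint_poly_z Cm.
rewrite (gaussian_ibp (mXt t) mz (gz It) Cm) mulr_suml.
apply: eq_bigr => l _; rewrite -mulrA mulrC -mulrA [RHS]mulrC.
under [in RHS]eq_Rintegral do rewrite (partial_sym _ _ _ Cg).
rewrite [RHS]mulrC; congr (_ * _).
have SKt := sqint_Kt It.
have [_ cov] := GX.
transitivity (ef k t * \int[mu]_s (K (t, s) * Ks l s)); last first.
  rewrite /H -RintZl; last exact: sqintM.
  by apply: eq_Rintegral => s _; rewrite mulrA.
congr (_ * _).
have SXp p : p \in e l -> sqint P (X p.2).
  move=> pe; apply: gaussian_sqint => //.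
  have := @gaussian_list [:: (1, p.2)].
  under eq_fun do rewrite big_seq1 mul1r; apply => q.
  by rewrite inE => /eqP -> /=; have [] := eI pe.
have {}cov p : p \in e l ->
    \int[P]_w (X t w * X p.2 w) = \int[mu]_s (K (t, s) * K (p.2, s)).
  by move=> /eI[_ Ip]; congr fine; exact: cov.
under eq_Rintegral do rewrite mxE /step_int.
under [RHS]eq_Rintegral do rewrite /Ks /Kstep.
(* The induction runs over sublists of [e l], which keeps all jump times in the range of [cov]. *)
have : {subset e l <= e l} by [].
elim: {1 3 4}(e l) => [|p s ih] se.
  under eq_Rintegral do rewrite big_nil mulr0.
  by under [RHS]eq_Rintegral do rewrite big_nil mulr0; rewrite !Rint0.
have pe : p \in e l by apply: se; rewrite mem_head.
have {}se q : q \in s -> q \in e l by move=> qs; apply: se; rewrite inE qs orbT.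
have sX : sqint P (fun w => \sum_(q <- s) q.1 * X q.2 w).
  by apply: sqint_sum_seq => q /se qe; apply: sqintZl; exact: SXp.
have sK : sqint mu (fun u => \sum_(q <- s) q.1 * K (q.2, u)).
  by apply: sqint_sum_seq => q /se/eI[_ Iq]; apply: sqintZl; exact: sqint_Kt.
under eq_Rintegral do rewrite big_cons mulrDr mulrCA.
under [RHS]eq_Rintegral do rewrite big_cons mulrDr mulrCA.
have SKp : sqint mu (fun u => K (p.2, u)) by apply: sqint_Kt; have [] := eI pe.
have SXp' := SXp _ pe.
rewrite !RintD; try solve [exact: sqintM|exact/rintZl/sqintM].
by rewrite !RintZl ?cov ?ih//; exact: sqintM.
Qed.

End gaussian_process.

(** * Complex functionals: real and imaginary parts of the identity *)

Section complex_identity.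
Context d (T : measurableType d) (R : realType) (P : probability T R).
Variables (X : R -> T -> R) (K : R * R -> R) (I : set R).
Variable f : smooth_functional I.
Local Notation tR := (measurableTypeR R).
Local Notation mu := (@leb01 R).

Definition real_lhs (g : 'rV[R]_(sf_n f) -> R) w t :=
  X t w * \sum_k partial k g (sf_z f (X^~ w)) * step_fun (sf_e f k) t.

Definition real_rhs (g : 'rV[R]_(sf_n f) -> R) w t s :=
  K (t, s) * \sum_k \sum_l partial k (partial l g) (sf_z f (X^~ w))
    * step_fun (sf_e f k) t * Kstep K (sf_e f l) s.

Let gRe y := complex.Re (sf_g f y).
Let gIm y := complex.Im (sf_g f y).

Lemma Re_lhs w t : complex.Re ((X t w)%:C%C * malliavinD f t (X^~ w)) =
  real_lhs gRe w t.
Proof.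
rewrite Re_realM /malliavinD Re_sum; congr (_ * _).
by apply: eq_bigr => k _; rewrite Re_Mreal.
Qed.

Lemma Im_lhs w t : complex.Im ((X t w)%:C%C * malliavinD f t (X^~ w)) =
  real_lhs gIm w t.
Proof.
rewrite Im_realM /malliavinD Im_sum; congr (_ * _).
by apply: eq_bigr => k _; rewrite Im_Mreal.
Qed.

Lemma Re_rhs w t s :
  complex.Re ((K (t, s))%:C%C * Kstar K (malliavinD2 f t (X^~ w)) s) =
  real_rhs gRe w t s.
Proof.
rewrite Re_realM Kstar_malliavinD2 Re_sum; congr (_ * _).
by apply: eq_bigr => k _; rewrite Re_sum; apply: eq_bigr => l _; rewrite !Re_Mreal.
Qed.

Lemma Im_rhs w t s :
  complex.Im ((K (t, s))%:C%C * Kstar K (malliavinD2 f t (X^~ w)) s) =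
  real_rhs gIm w t s.
Proof.
rewrite Im_realM Kstar_malliavinD2 Im_sum; congr (_ * _).
by apply: eq_bigr => k _; rewrite Im_sum; apply: eq_bigr => l _; rewrite !Im_Mreal.
Qed.

Hypothesis mX : measurable_fun setT (fun p : tR * T => X p.1 p.2).
Hypothesis SX : sqint (mu \x P)%E (fun p => X p.1 p.2).
Hypothesis SK : sqint (mu \x mu)%E K.
Hypothesis fI : full_times I.
Hypothesis GX : fredholm_gaussian_on P X K I.

Lemma gaussian_ibp_identity : ibp_identity P X K f.
Proof.
have [CRe CIm] := sf_g_smooth f; have eI := @sf_e_on _ _ f.
have Lhs_Re w : complex.Re (cintegral mu (fun t => (X t w)%:C%C * malliavinD f t (X^~ w)))
    = \int[mu]_t real_lhs gRe w t.
  by rewrite /=; under eq_Rintegral do rewrite Re_lhs.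
have Lhs_Im w : complex.Im (cintegral mu (fun t => (X t w)%:C%C * malliavinD f t (X^~ w)))
    = \int[mu]_t real_lhs gIm w t.
  by rewrite /=; under eq_Rintegral do rewrite Im_lhs.
have Rhs_Re w : complex.Re (cintegral mu (fun t => cintegral mu (fun s =>
      (K (t, s))%:C%C * Kstar K (malliavinD2 f t (X^~ w)) s))) =
    \int[mu]_t \int[mu]_s real_rhs gRe w t s.
  by rewrite /=; under eq_Rintegral do under eq_Rintegral do rewrite Re_rhs.
have Rhs_Im w : complex.Im (cintegral mu (fun t => cintegral mu (fun s =>
      (K (t, s))%:C%C * Kstar K (malliavinD2 f t (X^~ w)) s))) =
    \int[mu]_t \int[mu]_s real_rhs gIm w t s.
  by rewrite /=; under eq_Rintegral do under eq_Rintegral do rewrite Im_rhs.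
rewrite /ibp_identity; split.
- have := ibp_lhs_ae mX SX (sf_e f) gRe.
  have := ibp_lhs_ae mX SX (sf_e f) gIm.
  apply: filterS2 => w iIm iRe; split.
    by under eq_fun do rewrite Re_lhs; exact: iRe.
  by under eq_fun do rewrite Im_lhs; exact: iIm.
- apply: aeW => w; split.
    under eq_fun do rewrite Re_rhs.
    exact: (ibp_rhs_rint mX SK GX eI gRe w).
  under eq_fun do rewrite Im_rhs.
  exact: (ibp_rhs_rint mX SK GX eI gIm w).
- split.
    under eq_fun do rewrite Lhs_Re.
    exact: (ibp_Lhs mX SX fI GX eI CRe).
  under eq_fun do rewrite Lhs_Im.
  exact: (ibp_Lhs mX SX fI GX eI CIm).
- split.
    under eq_fun do rewrite Rhs_Re.
    exact: (ibp_Rhs mX SK fI GX eI CRe).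
  under eq_fun do rewrite Rhs_Im.
  exact: (ibp_Rhs mX SK fI GX eI CIm).
- have CE (a b a' b' : R) : a = a' -> b = b' -> Complex a b = Complex a' b' by move=> -> ->.
  apply: CE.
    under eq_Rintegral do rewrite Lhs_Re.
    under [RHS]eq_Rintegral do rewrite Rhs_Re.
    exact: (ibp_eq mX SX SK fI GX eI CRe).
  under eq_Rintegral do rewrite Lhs_Im.
  under [RHS]eq_Rintegral do rewrite Rhs_Im.
  exact: (ibp_eq mX SX SK fI GX eI CIm).
Qed.

End complex_identity.

(** * Square integrable processes *)

Section L2_norm.
Context d (T : measurableType d) (R : realType) (P : probability T R).
Implicit Types f g : T -> R.

Definition nrm f := Num.sqrt (\int[P]_x (f x ^+ 2)).

Lemma nrm_ge0 f : 0 <= nrm f. Proof. exact: sqrtr_ge0. Qed.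

Lemma nrm_sqr f : nrm f ^+ 2 = \int[P]_x (f x ^+ 2).
Proof. by rewrite sqr_sqrtr// Rint_ge0// => x; exact: sqr_ge0. Qed.

Lemma nrm_CS f g : sqint P f -> sqint P g ->
  `|\int[P]_x (f x * g x)| <= nrm f * nrm g.
Proof.
move=> Sf Sg; rewrite -sqrtr_sqr /nrm -sqrtrM; last by apply: Rint_ge0 => x; exact: sqr_ge0.
by apply: ler_wsqrtr; exact: Rint_CS.
Qed.

Lemma nrm_CS_abs f g : sqint P f -> sqint P g ->
  \int[P]_x (`|f x| * `|g x|) <= nrm f * nrm g.
Proof.
move=> Sf Sg; have := nrm_CS (sqint_abs Sf) (sqint_abs Sg).
have E (k : T -> R) : nrm (fun x => `|k x|) = nrm k.
  by congr Num.sqrt; apply: eq_Rintegral => x _; rewrite real_normK ?num_real.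
by rewrite !E; apply: le_trans; exact: ler_norm.
Qed.

Lemma nrm_le f M : 0 <= M -> \int[P]_x (f x ^+ 2) <= M ^+ 2 -> nrm f <= M.
Proof. by move=> M0 /ler_wsqrtr; rewrite sqrtr_sqr ger0_norm. Qed.

Lemma nrmD f g : sqint P f -> sqint P g ->
  nrm (fun x => f x + g x) <= nrm f + nrm g.
Proof.
move=> Sf Sg; apply: nrm_le; first by rewrite addr_ge0 ?nrm_ge0.
rewrite Rint_sqrD// -!nrm_sqr sqrrD.
by have := le_trans (ler_norm _) (nrm_CS Sf Sg); lra.
Qed.

End L2_norm.

(** If f exceeded c on all of [J], then |f - c| would equal f - c almost everywhere and have
    integral 0, so that f = c almost everywhere, which is absurd on a probability space. This turns
    a bound for the average over a random time into an actual time of [J]. *)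
Lemma full_has_le (R : realType) (J : set R) (f : measurableTypeR R -> R) c :
  full_times J -> rint (@leb01 R) f -> \int[@leb01 R]_t f t <= c ->
  exists2 t, J t & f t <= c.
Proof.
move=> [_ [N [mN N0 JN]]] If fc; apply: contrapT => nJ.
have Jf t : J t -> c < f t.
  by move=> Jt; rewrite ltNge; apply/negP => tc; apply: nJ; exists t.
have Ifc : rint (@leb01 R) (fun t => f t - c) by exact: rintB If (rint_cst _ c).
have aeE : {ae @leb01 R, forall t, `|f t - c| = f t - c}.
  exists N; split => // t /= nE; apply: JN => Jt; apply: nE.
  by rewrite gtr0_norm// subr_gt0; exact: Jf.
have int0 : \int[@leb01 R]_t `|f t - c| = 0.
  rewrite (ae_Rint _ _ aeE); [|exact: rint_measurable (rint_abs Ifc)|exact: rint_measurable Ifc].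
  apply/eqP; rewrite eq_le; apply/andP; split.
    by rewrite RintB//; [rewrite Rint_cst subr_le0|exact: rint_cst].
  rewrite -(ae_Rint _ _ aeE); [|exact: rint_measurable (rint_abs Ifc)|exact: rint_measurable Ifc].
  by apply: Rint_ge0.
have ae0 : {ae @leb01 R, forall t, f t - c = 0}.
  have [+ _] := ae_eq_integral_abs (@leb01 R) measurableT (measurable_int _ Ifc).
  have := EFin_Rint (rint_abs Ifc); rewrite int0 => <- /(_ erefl).
  by apply: filterS => t /(_ I) [].
have [N' [mN' N'0 JN']] := ae0.
have : (@leb01 R) (N `|` N') = 0%E.
  by rewrite null_set_setU.
have -> : N `|` N' = setT.
  apply/seteqP; split => // t _.
  have [Jt|nJt] := pselect (J t); last by left; exact: JN.
  right; apply: JN' => /= ft0; have := Jf _ Jt.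
  by rewrite -subr_gt0 ft0 ltxx.
by rewrite [LHS]leb01_setT => /eqP; rewrite onee_eq0.
Qed.

Section L2_processes.
Context d (T : measurableType d) (R : realType) (P : probability T R).
Local Notation tR := (measurableTypeR R).
Local Notation mu := (@leb01 R).
Implicit Types (Z : tR * T -> R) (h : tR -> R).

(** All sections are square integrable, so that no exceptional times or paths are carried along;
    [L2proc_version] supplies such versions. The probability space is arbitrary: with [0,1] itself
    in the role of T, the notion covers the kernel K and the kernel of the Volterra operator. *)
Definition L2proc Z := [/\ measurable_fun setT Z,
  forall w, sqint mu (fun t => Z (t, w)),
  forall t, sqint P (fun w => Z (t, w)) &
  sqint (mu \x P)%E Z].

Definition bmf h := measurable_fun setT h /\ exists M, forall t, `|h t| <= M.

Lemma bmf_sqint h : bmf h -> sqint mu h.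
Proof. by move=> [mh [M hM]]; exact: sqint_bounded mh hM. Qed.

Lemma bmfD h g : bmf h -> bmf g -> bmf (fun t => h t + g t).
Proof.
move=> [mh [M hM]] [mg [M' gM']]; split; first exact: measurable_funD.
by exists (M + M') => t; rewrite (le_trans (ler_normD _ _))// lerD.
Qed.

Lemma bmfM h g : bmf h -> bmf g -> bmf (fun t => h t * g t).
Proof.
move=> [mh [M hM]] [mg [M' gM']]; split; first exact: measurable_funM.
by exists (M * M') => t; rewrite normrM ler_pM.
Qed.

Lemma bmf_cst (c : R) : bmf (fun=> c).
Proof. by split => //; exists `|c|. Qed.

(** For the process X this is x_h, for the kernel K it is k_h, and for [Zvol] it is V h. *)
Definition pint Z h w := \int[mu]_t (h t * Z (t, w)).

Definition esq Z := \int[(mu \x P)%E]_p (Z p ^+ 2).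

Definition pathsq Z w := \int[mu]_t (Z (t, w) ^+ 2).

Section one_process.
Variable Z : tR * T -> R.
Hypothesis LZ : L2proc Z.

Let mZ : measurable_fun setT Z. Proof. by case: LZ. Qed.
Let Zw w : sqint mu (fun t => Z (t, w)). Proof. by case: LZ. Qed.
Let Zt t : sqint P (fun w => Z (t, w)). Proof. by case: LZ. Qed.
Let SZ : sqint (mu \x P)%E Z. Proof. by case: LZ. Qed.

Lemma esq_ge0 : 0 <= esq Z. Proof. by apply: Rint_ge0 => p; exact: sqr_ge0. Qed.

Lemma rint_pathsq : rint P (pathsq Z) /\ \int[P]_w pathsq Z w = esq Z.
Proof.
have := rint_swap SZ.2 => Is; split; first exact: (rint_Fubini1 Is).1.
by rewrite /pathsq (rint_Fubini2 SZ.2).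
Qed.

Lemma measurable_pint h : measurable_fun setT h -> measurable_fun setT (pint Z h).
Proof.
move=> mh; apply: (measurable_Rint2 mu (f := fun p : tR * T => h p.1 * Z p)).
by apply: measurable_funM => //; exact: (measurableT_comp mh measurable_fst).
Qed.

Lemma pint_sqr_le h w : sqint mu h ->
  pint Z h w ^+ 2 <= \int[mu]_t (h t ^+ 2) * pathsq Z w.
Proof. by move=> Sh; exact: Rint_CS. Qed.

Lemma sqint_pint h : sqint mu h -> sqint P (pint Z h).
Proof.
move=> Sh; have mp := measurable_pint (sqint_measurable Sh); split => //.
apply: (rint_le _ _ (rintZl (\int[mu]_t (h t ^+ 2)) rint_pathsq.1)).
  exact: measurable_funX.
by move=> w; rewrite ger0_norm ?sqr_ge0// pint_sqr_le.
Qed.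

Lemma Rint_pint_sqr h : sqint mu h ->
  \int[P]_w (pint Z h w ^+ 2) <= \int[mu]_t (h t ^+ 2) * esq Z.
Proof.
move=> Sh; rewrite -rint_pathsq.2 -RintZl; last exact: rint_pathsq.1.
apply: le_Rint; first exact: (sqint_pint Sh).2.
  by apply: rintZl; exact: rint_pathsq.1.
by move=> w; exact: pint_sqr_le.
Qed.

Lemma pintD h g w : sqint mu h -> sqint mu g ->
  pint Z (fun t => h t + g t) w = pint Z h w + pint Z g w.
Proof.
move=> Sh Sg; rewrite /pint -RintD; [|exact: sqintM|exact: sqintM].
by apply: eq_Rintegral => t _; rewrite mulrDl.
Qed.

Lemma pintZ c h w : sqint mu h -> pint Z (fun t => c * h t) w = c * pint Z h w.
Proof.
move=> Sh; rewrite /pint -RintZl; last exact: sqintM.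
by apply: eq_Rintegral => t _; rewrite mulrA.
Qed.

Lemma pintB h g w : sqint mu h -> sqint mu g ->
  pint Z (fun t => h t - g t) w = pint Z h w - pint Z g w.
Proof.
move=> Sh Sg; rewrite -[X in _ = _ + X]mulN1r -pintZ// -pintD//; last exact: sqintZl.
by apply: eq_Rintegral => t _; rewrite mulN1r.
Qed.

(* Averaging over an independent uniform time [u] adds the variance. *)
Lemma monte_carlo_step h (M : R) (S : T -> R) : measurable_fun setT h ->
  (forall t, `|h t| <= M) -> sqint P S ->
  let phi u := \int[P]_w ((S w + (h u * Z (u, w) - pint Z h w)) ^+ 2) in
  rint mu phi /\ \int[mu]_u phi u <= \int[P]_w (S w ^+ 2) + M ^+ 2 * esq Z.
Proof.
move=> mh hM SS phi.
have Sh : sqint mu h := sqint_bounded mu mh hM.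
have M0 : 0 <= M := le_trans (normr_ge0 _) (hM 0).
have SY : sqint (mu \x P)%E (fun p => h p.1 * Z p).
  apply: (sqintMl SZ (M := M)) => [|p]; last exact: hM.
  exact: (measurableT_comp mh measurable_fst).
have snd f : sqint P f -> sqint (mu \x P)%E (fun p => f p.2).
  move=> [mf If]; split; first exact: (measurableT_comp mf measurable_snd).
  by have := rint_prodM (rint_cst mu 1) If; under eq_fun do rewrite mul1r.
pose G (p : tR * T) := (S p.2 + (h p.1 * Z p - pint Z h p.2)) ^+ 2.
have IG : rint (mu \x P)%E G.
  have : sqint (mu \x P)%E (fun p => S p.2 + (h p.1 * Z p - pint Z h p.2)).
    apply: sqintD; first exact: snd.
    by apply: sqintB => //; apply: snd; exact: sqint_pint.
  by case.
split; first exact: (rint_Fubini1 IG).1.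
have -> : \int[mu]_u phi u = \int[P]_w \int[mu]_u G (u, w) by exact: Rint_Fubini IG.
have IY : rint P (fun w => \int[mu]_u ((h u * Z (u, w)) ^+ 2)).
  exact: (rint_Fubini1 (rint_swap SY.2)).1.
apply: (@le_trans _ _ (\int[P]_w (S w ^+ 2 + \int[mu]_u ((h u * Z (u, w)) ^+ 2)))).
  apply: le_Rint; first exact: (rint_Fubini1 (rint_swap IG)).1.
    by apply: rintD => //; exact: SS.2.
  move=> w; rewrite /G/=.
  have SYw : sqint mu (fun u => h u * Z (u, w)) by exact: (sqintMl (Zw w) mh hM).
  set p := pint Z h w.
  have SYp : sqint mu (fun u => h u * Z (u, w) - p).
    by apply: sqintB => //; exact: sqint_cst.
  rewrite Rint_sqrD//; last exact: sqint_cst.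
  rewrite Rint_cst RintZl; last exact: (sqint_rint mu SYp).
  have -> : \int[mu]_u (h u * Z (u, w) - p) = 0.
    rewrite RintB; [|exact: (sqint_rint mu SYw)|exact: rint_cst].
    by rewrite Rint_cst subrr.
  rewrite !mulr0 addr0 lerD2l.
  have -> : \int[mu]_u ((h u * Z (u, w) - p) ^+ 2) =
      \int[mu]_u ((h u * Z (u, w)) ^+ 2) - p ^+ 2.
    rewrite (Rint_sqrD SYw (sqint_cst mu (- p))) Rint_cst RintZr; last first.
      exact: (sqint_rint mu SYw).
    by rewrite -/(pint Z h w) -/p; ring.
  by rewrite gerBl sqr_ge0.
rewrite RintD//; last exact: SS.2.
rewrite lerD2l (rint_Fubini2 SY.2) /esq -RintZl; last exact: SZ.2.
apply: le_Rint; [exact: SY.2|by apply: rintZl; exact: SZ.2|].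
move=> p; rewrite exprMn ler_wpM2r ?sqr_ge0// -[leLHS]real_normK ?num_real//.
by rewrite lerXn2r ?nnegrE.
Qed.

End one_process.

(** The same list [e] plays three roles: for the process X this is \int e dX, for the kernel K it is
    the adjoint operator applied to e, and for [Zvol] it is the step function e itself. *)
Definition psum Z (e : seq (R * R)) w := \sum_(p <- e) p.1 * Z (p.2, w).

Lemma sqint_psum Z e : L2proc Z -> sqint P (psum Z e).
Proof. by move=> [_ _ Zt _]; apply: sqint_sum => p; exact: sqintZl. Qed.

End L2_processes.

(** The empirical measure of the sample [us] with density [h]: its [psum] is the Monte Carlo
    estimate of [pint]. *)
Definition weights (R : realType) (h : R -> R) (us : seq R) : seq (R * R) :=
  [seq (h u / (size us)%:R, u) | u <- us].

(** * Monte Carlo approximation by step functions *)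

Section monte_carlo.
Variable R : realType.
Local Notation tR := (measurableTypeR R).
Local Notation mu := (@leb01 R).
Context d1 (T1 : measurableType d1) (P1 : probability T1 R).
Context d2 (T2 : measurableType d2) (P2 : probability T2 R).
Context d3 (T3 : measurableType d3) (P3 : probability T3 R).
Variables (Z1 : tR * T1 -> R) (Z2 : tR * T2 -> R) (Z3 : tR * T3 -> R).
Hypothesis L1 : L2proc P1 Z1.
Hypothesis L2 : L2proc P2 Z2.
Hypothesis L3 : L2proc P3 Z3.
Variables (J : set R) (h : tR -> R) (M : R).
Hypothesis fJ : full_times J.
Hypothesis mh : measurable_fun setT h.
Hypothesis hM : forall t, `|h t| <= M.

Let Sh : sqint mu h := sqint_bounded mu mh hM.

Let C := M ^+ 2 * (esq P1 Z1 + esq P2 Z2 + esq P3 Z3).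

Let dev d (T : measurableType d) (Z : tR * T -> R) (us : seq R) w :=
  \sum_(u <- us) (h u * Z (u, w) - pint Z h w).

Let sqint_dev d (T : measurableType d) (P : probability T R) (Z : tR * T -> R) us :
  L2proc P Z -> sqint P (dev Z us).
Proof.
move=> LZ; have [_ _ Zt _] := LZ; apply: sqint_sum => u.
by apply: sqintB; [exact: sqintZl|exact: sqint_pint].
Qed.

(** Derandomised sampling: averaged over the next time, the squared error grows by at most C, so
    some time in [J] does no worse. The errors of the three processes are added because one sample
    has to serve them all. *)
Let greedy n : exists us : seq R, [/\ size us = n, {in us, forall u, J u} &
  \int[P1]_w (dev Z1 us w ^+ 2) + \int[P2]_w (dev Z2 us w ^+ 2) +
  \int[P3]_w (dev Z3 us w ^+ 2) <= n%:R * C].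
Proof.
elim: n => [|n [us [sus Jus le_us]]].
  exists [::]; split => //; rewrite mul0r /dev.
  under [in X in X + _ + _]eq_Rintegral do rewrite big_nil expr0n.
  under [in X in _ + X + _]eq_Rintegral do rewrite big_nil expr0n.
  under [in X in _ + X]eq_Rintegral do rewrite big_nil expr0n.
  by rewrite !Rint0 !addr0.
have [I1 le1] := monte_carlo_step L1 mh hM (sqint_dev us L1).
have [I2 le2] := monte_carlo_step L2 mh hM (sqint_dev us L2).
have [I3 le3] := monte_carlo_step L3 mh hM (sqint_dev us L3).
have [|u Ju le_u] := full_has_le (c := n.+1%:R * C) fJ (rintD (rintD I1 I2) I3).
  rewrite !RintD//; last exact: rintD.
  rewrite -natr1 mulrDl mul1r /C; move: le_us; rewrite /C => le_us.
  by lra.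
exists (u :: us); split => /=; first by rewrite sus.
  by move=> v; rewrite inE => /predU1P[->//|/Jus].
have devE d (T : measurableType d) (P : probability T R) (Z : tR * T -> R) :
    \int[P]_w (dev Z (u :: us) w ^+ 2) =
    \int[P]_w ((dev Z us w + (h u * Z (u, w) - pint Z h w)) ^+ 2).
  by apply: eq_Rintegral => w _; rewrite /dev big_cons addrC.
by rewrite !devE.
Qed.

Lemma monte_carlo n : exists us : seq R, {in us, forall u, J u} /\
  [/\ \int[P1]_w ((psum Z1 (weights h us) w - pint Z1 h w) ^+ 2) <= C / n.+1%:R,
      \int[P2]_w ((psum Z2 (weights h us) w - pint Z2 h w) ^+ 2) <= C / n.+1%:R &
      \int[P3]_w ((psum Z3 (weights h us) w - pint Z3 h w) ^+ 2) <= C / n.+1%:R].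
Proof.
have [us [sus Jus le_us]] := greedy n.+1; exists us; split => //.
have n0 : (n.+1%:R : R) != 0 by rewrite pnatr_eq0.
have E d (T : measurableType d) (P : probability T R) (Z : tR * T -> R) : L2proc P Z ->
    \int[P]_w ((psum Z (weights h us) w - pint Z h w) ^+ 2) =
    n.+1%:R ^- 2 * \int[P]_w (dev Z us w ^+ 2).
  move=> LZ; rewrite -RintZl; last exact: (sqint_dev us LZ).2.
  apply: eq_Rintegral => w _; rewrite -exprVn -exprMn; congr (_ ^+ 2).
  rewrite /psum /weights /dev big_map sus/= sumrB mulrBr mulr_sumr.
  congr (_ - _); first by apply: eq_bigr => u _; rewrite mulrA [_^-1 * _]mulrC.
  rewrite big_const_seq count_predT sus iter_addr_0 -[pint Z h w *+ _]mulr_natl mulrA.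
  by rewrite mulVf// mul1r.
rewrite !E//.
have p0 d (T : measurableType d) (P : probability T R) (Z : tR * T -> R) :
    0 <= \int[P]_w (dev Z us w ^+ 2) by apply: Rint_ge0 => w; exact: sqr_ge0.
have := p0 _ _ P1 Z1; have := p0 _ _ P2 Z2; have := p0 _ _ P3 Z3.
have -> : C / n.+1%:R = n.+1%:R ^- 2 * (n.+1%:R * C) by rewrite expr2; field.
have n20 : 0 <= n.+1%:R ^- 2 :> R by rewrite invr_ge0 sqr_ge0.
by move=> a b c; split; apply: ler_wpM2l => //; lra.
Qed.

End monte_carlo.

(** * Limits of inner products *)

Section inner_products.
Context d (T : measurableType d) (R : realType) (P : probability T R).

Lemma nrm_lipschitz (f g : T -> R) (F : R -> R) :
  (forall x y, `|F x - F y| <= `|x - y|) -> continuous F ->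
  sqint P f -> sqint P g -> nrm P (fun w => F (f w) - F (g w)) <= nrm P (fun w => f w - g w).
Proof.
move=> FL cF Sf Sg; apply: ler_wsqrtr.
have mF k : measurable_fun setT k -> measurable_fun setT (fun w : T => F (k w)).
  by move=> mk; apply: (measurableT_comp (continuous_measurable_fun cF)).
have SF : sqint P (fun w => F (f w) - F (g w)).
  apply: sqint_le (sqintB Sf Sg) => //.
  apply: measurable_funB; apply: mF; first exact: (sqint_measurable Sf).
  exact: (sqint_measurable Sg).
apply: le_Rint; [exact: SF.2|exact: (sqintB Sf Sg).2|].
move=> w; rewrite -[leLHS]real_normK ?num_real// -[leRHS]real_normK ?num_real//.
by rewrite lerXn2r ?nnegrE.
Qed.

Lemma inner_cvg (f g : nat -> T -> R) (f0 g0 : T -> R) :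
  (forall n, sqint P (f n)) -> (forall n, sqint P (g n)) -> sqint P f0 -> sqint P g0 ->
  nrm P (fun w => f n w - f0 w) @[n --> \oo] --> (0 : R) ->
  nrm P (fun w => g n w - g0 w) @[n --> \oo] --> (0 : R) ->
  \int[P]_w (f n w * g n w) @[n --> \oo] --> \int[P]_w (f0 w * g0 w).
Proof.
move=> Sf Sg Sf0 Sg0 cf cg.
pose df n w := f n w - f0 w; pose dg n w := g n w - g0 w.
have Sdf n : sqint P (df n) by exact: sqintB.
have Sdg n : sqint P (dg n) by exact: sqintB.
have E n : \int[P]_w (f n w * g n w) = \int[P]_w (f0 w * g0 w) +
    (\int[P]_w (df n w * dg n w) + (\int[P]_w (df n w * g0 w) + \int[P]_w (f0 w * dg n w))).
  rewrite -RintD; [|exact: sqintM|exact: sqintM].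
  rewrite -RintD; [|exact: sqintM|by apply: rintD; exact: sqintM].
  rewrite -RintD; [|exact: sqintM|by apply: rintD; [exact: sqintM|apply: rintD; exact: sqintM]].
  by apply: eq_Rintegral => w _; rewrite /df /dg; ring.
rewrite (funext E) -[X in _ --> X]addr0; apply: cvgD; first exact: cvg_cst.
have cv0 (u : nat -> R) v : (forall n, `|u n| <= v n) -> v n @[n --> \oo] --> (0 : R) ->
    u n @[n --> \oo] --> (0 : R).
  move=> uv v0; apply/cvgr0Pnorm_le => e e0; have H := cvgr0_norm_le _ v0 _ e0.
  near=> n; rewrite (le_trans (uv n))// (le_trans (ler_norm _))//.
  by near: n; exact: H.
rewrite -[X in _ --> X]addr0; apply: cvgD.
  apply: (cv0 _ (fun n => nrm P (df n) * nrm P (dg n))) => [n|]; first exact: nrm_CS.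
  by rewrite -[X in _ --> X](mulr0 (0 : R)); exact: cvgM.
rewrite -[X in _ --> X]addr0; apply: cvgD.
  apply: (cv0 _ (fun n => nrm P (df n) * nrm P g0)) => [n|]; first exact: nrm_CS.
  by rewrite -[X in _ --> X](mul0r (nrm P g0)); apply: cvgM => //; exact: cvg_cst.
apply: (cv0 _ (fun n => nrm P f0 * nrm P (dg n))) => [n|]; first exact: nrm_CS.
by rewrite -[X in _ --> X](mulr0 (nrm P f0)); apply: cvgM => //; exact: cvg_cst.
Unshelve. all: by end_near. Qed.

Lemma cvg0_sqrt_harmonic (c : R) (v : nat -> R) :
  (forall n, 0 <= v n) -> (forall n, v n ^+ 2 <= c / n.+1%:R) -> v n @[n --> \oo] --> (0 : R).
Proof.
move=> v0 vc; apply/cvgr0Pnorm_le => e e0; near=> n.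
rewrite ger0_norm// -(@ler_pXn2r _ 2)// ?nnegrE ?(ltW e0)//.
rewrite (le_trans (vc n))// ler_pdivrMr ?ltr0n// mulrC -ler_pdivrMr ?exprn_gt0//.
rewrite (le_trans (y := n%:R)) ?ler_nat//.
by near: n; exact: nbhs_infty_ger.
Unshelve. all: by end_near. Qed.

End inner_products.

Lemma sin_lipschitz (R : realType) (x y : R) : `|sin x - sin y| <= `|x - y|.
Proof.
have [c _ ->] := @MVT_between R sin cos y x (fun y => is_derive_sin y).
rewrite normrM ler_piMl//; exact: cos_max.
Qed.

(** * The Volterra operator and the identity for bounded functions *)

Section volterra.
Variable R : realType.
Local Notation tR := (measurableTypeR R).
Local Notation mu := (@leb01 R).

(* The process whose integral against [h] is the Volterra operator
   [t |-> \int_t^1 h]. *)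
Definition Zvol (p : tR * tR) : R := \1_(`[0, p.1[) p.2.

Lemma L2proc_Zvol : L2proc mu Zvol.
Proof.
have mZ : measurable_fun setT Zvol.
  have -> : Zvol = fun p => if (0 <= p.2) && (p.2 < p.1) then 1 else 0.
    apply/funext => p; rewrite /Zvol indicE; case: ifPn => h.
      by rewrite mem_set//= in_itv.
    by rewrite memNset//= in_itv/=; apply/negP.
  apply: measurable_fun_ifT => //; apply: measurable_and.
    by apply: measurable_fun_ler => //; exact: measurable_snd.
  by apply: measurable_fun_ltr; [exact: measurable_snd|exact: measurable_fst].
have Z1 p : `|Zvol p| <= 1.
  by rewrite /Zvol indicE; case: (_ \in _); rewrite ?normr1 ?normr0.
split => //.
- move=> w; apply: (sqint_bounded mu _ (fun t => Z1 (t, w))).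
  exact: (measurableT_comp mZ (measurable_pair2 w)).
- move=> t; apply: (sqint_bounded mu _ (fun w => Z1 (t, w))).
  exact: (measurableT_comp mZ (measurable_pair1 t)).
- exact: (sqint_bounded (mu \x mu)%E mZ Z1).
Qed.

Definition vol (h : tR -> R) : tR -> R := pint Zvol h.

Lemma bmf_vol h : bmf h -> bmf (vol h).
Proof.
move=> [mh [M hM]]; split; first exact: measurable_pint L2proc_Zvol _ mh.
exists M => t; apply: (ler_norm_Rint_bounded mu).
  apply: measurable_funM => //; have [mZ _ _ _] := L2proc_Zvol.
  exact: (measurableT_comp mZ (measurable_pair2 t)).
move=> u; rewrite normrM (le_trans _ (hM u))// ler_piMr//.
by rewrite /Zvol indicE; case: (_ \in _); rewrite ?normr1 ?normr0.
Qed.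

Context d (T : measurableType d) (P : probability T R).
Variables (X : tR * T -> R) (K : tR * tR -> R) (J : set R).
Hypothesis LX : L2proc P X.
Hypothesis LK : L2proc mu K.
Hypothesis fJ : full_times J.
(* The integration by parts identity for [f = - cos (. + th)] applied to a step
   function. *)
Hypothesis ibp_steps : forall (th : R) (e : seq (R * R)),
  (forall p, p \in e -> J p.2) ->
  \int[P]_w (sin (psum X e w + th) * pint X (psum Zvol e) w) =
  \int[P]_w cos (psum X e w + th) * \int[mu]_s (psum K e s * pint K (psum Zvol e) s).

(** A single Monte Carlo sample gives step functions e_n for which [psum] converges in L^2 to [pint]
    for X, K and [Zvol] at once; in the last case this means that e_n, as a function, tends to V h.
    Every term of [ibp_steps] is an inner product of such sequences. *)
Lemma ibp_functions (h : tR -> R) th : bmf h ->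
  \int[P]_w (sin (pint X h w + th) * pint X (vol h) w) =
  \int[P]_w cos (pint X h w + th) * \int[mu]_s (pint K h s * pint K (vol h) s).
Proof.
move=> bh; have [mh [M hM]] := bh; have LV := L2proc_Zvol.
pose C := M ^+ 2 * (esq P X + esq mu K + esq mu Zvol).
have /choice[us usP] n := monte_carlo LX LK LV fJ mh hM n.
pose e n := weights h (us n).
have eJ n p : p \in e n -> J p.2.
  by move=> /mapP[u uus ->]; have [Jus _] := usP n; exact: Jus.
have Sh := bmf_sqint bh; have Svh := bmf_sqint (bmf_vol bh).
have nsq d' (T' : measurableType d') (P' : probability T' R) (f : nat -> T' -> R) :
    (forall n, \int[P']_w (f n w ^+ 2) <= C / n.+1%:R) ->
    nrm P' (f n) @[n --> \oo] --> (0 : R).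
  move=> fC; apply: (@cvg0_sqrt_harmonic _ C) => n; first exact: nrm_ge0.
  by rewrite nrm_sqr.
have cX : nrm P (fun w => psum X (e n) w - pint X h w) @[n --> \oo] --> (0 : R).
  by apply: (nsq _ _ P (fun n w => psum X (e n) w - pint X h w)) => n; have [_ []] := usP n.
have cK : nrm mu (fun w => psum K (e n) w - pint K h w) @[n --> \oo] --> (0 : R).
  by apply: (nsq _ _ mu (fun n s => psum K (e n) s - pint K h s)) => n; have [_ []] := usP n.
have cV : nrm mu (fun w => psum Zvol (e n) w - vol h w) @[n --> \oo] --> (0 : R).
  by apply: nsq => n; have [_ []] := usP n.
have SV n : sqint mu (psum Zvol (e n)) by exact: sqint_psum LV.
have cp d' (T' : measurableType d') (P' : probability T' R) Z : L2proc P' Z ->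
    nrm P' (fun w => pint Z (psum Zvol (e n)) w - pint Z (vol h) w) @[n --> \oo] --> (0 : R).
  move=> LZ; apply: (@cvg0_sqrt_harmonic _ (C * esq P' Z)) => n; first exact: nrm_ge0.
  rewrite nrm_sqr; under eq_Rintegral do rewrite -(pintB LZ)//.
  rewrite (le_trans (Rint_pint_sqr LZ _))//; first exact: sqintB.
  rewrite mulrAC ler_wpM2r//; first exact: esq_ge0.
  by have [_ []] := usP n.
have LcX F : (forall x y, `|F x - F y| <= `|x - y|) -> continuous F ->
    nrm P (fun w => F (psum X (e n) w + th) - F (pint X h w + th)) @[n --> \oo] --> (0 : R).
  move=> FL cF; apply/cvgr0Pnorm_le => eps eps0; have H := cvgr0_norm_le _ cX _ eps0.
  near=> n; apply: (@le_trans _ _ `|nrm P (fun w => psum X (e n) w - pint X h w)|); last first.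
    by near: n; exact: H.
  rewrite !ger0_norm ?nrm_ge0//.
  have := nrm_lipschitz FL cF (sqintD (sqint_psum (e n) LX) (sqint_cst P th))
    (sqintD (sqint_pint LX Sh) (sqint_cst P th)).
  move/le_trans; apply; rewrite le_eqVlt; apply/orP; left; apply/eqP.
  by congr (nrm P _); apply/funext => w; ring.
have trig_sq F f : continuous F -> (forall x, `|F x| <= 1) -> sqint P f ->
    sqint P (fun w => F (f w + th)).
  move=> cF F1 Sf; apply: (sqint_bounded P _ (fun w => F1 (f w + th))).
  apply: (measurableT_comp (continuous_measurable_fun cF)).
  by apply: measurable_funD => //; exact: sqint_measurable Sf.
have c1 := inner_cvg
  (fun n => trig_sq _ _ (@continuous_sin R) (@sin_max R) (sqint_psum (e n) LX))
  (fun n => sqint_pint LX (SV n))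
  (trig_sq _ _ (@continuous_sin R) (@sin_max R) (sqint_pint LX Sh))
  (sqint_pint LX Svh) (LcX _ (@sin_lipschitz R) (@continuous_sin R)) (cp _ _ _ _ LX).
(* The plain expectation of the cosine is treated as an inner product with the constant sequence
   1. *)
have c0 : nrm P (fun=> (1 - 1 : R)) @[_ --> \oo] --> (0 : R).
  rewrite /nrm; under eq_Rintegral do rewrite subrr expr0n.
  by rewrite Rint0 sqrtr0; exact: cvg_cst.
have c2 := inner_cvg
  (fun n => trig_sq _ _ (@continuous_cos R) (@cos_max R) (sqint_psum (e n) LX))
  (fun n => sqint_cst P 1)
  (trig_sq _ _ (@continuous_cos R) (@cos_max R) (sqint_pint LX Sh))
  (sqint_cst P 1) (LcX _ (@cos_lipschitz R) (@continuous_cos R)) c0.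
have E f : \int[P]_w (cos (f w + th) * 1) = \int[P]_w cos (f w + th).
  by apply: eq_Rintegral => w _; rewrite mulr1.
rewrite E (funext (fun n => E (psum X (e n)))) in c2.
have c3 := inner_cvg (fun n => sqint_psum (e n) LK) (fun n => sqint_pint LK (SV n))
  (sqint_pint LK Sh) (sqint_pint LK Svh) cK (cp _ _ _ _ LK).
have := cvgM c2 c3.
have -> : (fun n => \int[P]_w cos (psum X (e n) w + th)) \*
    (fun n => \int[mu]_w (psum K (e n) w * pint K (psum Zvol (e n)) w)) =
    (fun n => \int[P]_w (sin (psum X (e n) w + th) * pint X (psum Zvol (e n)) w)).
  by apply/funext => n /=; rewrite ibp_steps//; exact: eJ.
by move=> c4; exact: (cvg_unique _ c1 (c4 _)).
Unshelve. all: by end_near. Qed.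

End volterra.

(** * Local averages *)

Section local_averages.
Variable R : realType.
Local Notation tR := (measurableTypeR R).
Local Notation mu := (@leb01 R).
Local Notation lam := (@lebesgue_measure R).

Lemma integral_leb01 (f : tR -> \bar R) : measurable_fun setT f ->
  (forall x, 0 <= f x)%E ->
  (\int[mu]_x f x = \int[lam]_(x in `[0%R, 1%R]) f x)%E.
Proof.
move=> mf f0; have := integral_uniform (@ltr01 R) mf f0.
rewrite subr0 invr1 mul1e => <-; apply: eq_measure_integral => A mA _ /=.
rewrite /uniform_prob integral_uniform_pdf.
rewrite (eq_integral (cst 1%E)); last first.
  move=> x /set_mem[_ /=]; rewrite in_itv/= => x01.
  by rewrite /uniform_pdf x01 subr0 invr1.
by rewrite integral_cst ?mul1e//; exact: measurableI.
Qed.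

(** The ball indicator normalised by the full length 2 / (n + 1) of the ball: near the end points of
    [0,1] part of the mass is lost, so the total mass is at most 1. In exchange the kernel is
    symmetric. *)
Definition ker (n : nat) (p : tR * tR) : R :=
  n.+1%:R / 2 * \1_(ball p.1 (n.+1%:R^-1 : R)) p.2.

Lemma ker_sym n t s : ker n (t, s) = ker n (s, t).
Proof.
rewrite /ker !indicE/=; congr (_ * (_ : bool)%:R).
by apply/idP/idP => /set_mem ts; apply/mem_set; exact: ball_sym.
Qed.

Lemma ker_ge0 n p : 0 <= ker n p.
Proof. by rewrite mulr_ge0// divr_ge0. Qed.

Lemma ker_le n p : `|ker n p| <= n.+1%:R / 2.
Proof.
by rewrite ger0_norm ?ker_ge0// ler_piMr ?divr_ge0// indicE lern1 leq_b1.
Qed.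

Lemma measurable_ker n : measurable_fun setT (ker n).
Proof.
apply: measurable_funM => //.
have -> : (fun p : tR * tR => \1_(ball p.1 (n.+1%:R^-1 : R)) p.2 : R) =
    fun p => if `|p.1 - p.2| < n.+1%:R^-1 then 1 else 0.
  apply/funext => p; rewrite indicE; case: ifPn => h.
    by rewrite mem_set.
  by rewrite memNset//; apply/negP.
apply: measurable_fun_ifT => //; apply: measurable_fun_ltr => //.
by apply: measurableT_comp => //; apply: measurable_funB.
Qed.

Lemma bmf_ker n t : bmf (fun s => ker n (t, s)).
Proof.
split; last by exists (n.+1%:R / 2) => s; exact: ker_le.
exact: (measurableT_comp (measurable_ker n) (measurable_pair1 t)).
Qed.

Lemma Rint_indic (A : set tR) : measurable A -> \int[mu]_s (\1_A s : R) = fine (mu A).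
Proof. by move=> mA; rewrite /Rintegral integral_indic// setIT. Qed.

Lemma Rint_ker n t : \int[mu]_s ker n (t, s) = n.+1%:R / 2 * fine (mu (ball (t : R) n.+1%:R^-1)).
Proof.
rewrite RintZl ?Rint_indic//; first exact: measurable_ball.
apply: (rint_bounded mu (M := 1)); first by apply: measurable_indic; exact: measurable_ball.
by move=> s; rewrite indicE; case: (_ \in _); rewrite ?normr1 ?normr0.
Qed.

Lemma leb_ball n (t : R) : lam (ball t (n.+1%:R^-1 : R)) = (n.+1%:R^-1 *+ 2)%:E.
Proof. by rewrite lebesgue_measure_ball// invr_ge0. Qed.

Lemma Rint_ker_le1 n t : \int[mu]_s ker n (t, s) <= 1.
Proof.
rewrite Rint_ker -ler_pdivlMl ?divr_gt0// invfM invrK mulr1 mulr_natr.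
rewrite -lee_fin fineK ?fin_num_measure//; last exact: measurable_ball.
rewrite -(leb_ball n t) /leb01 /mrestr.
by apply: le_measure; rewrite ?inE//; [apply: measurableI => //|]; exact: measurable_ball.
Qed.

Lemma Rint_ker_eq1 n (t : R) : ball t (n.+1%:R^-1 : R) `<=` `[0%R, 1%R]%classic -> \int[mu]_s ker n (t, s) = 1.
Proof.
move=> b01; rewrite Rint_ker /leb01 /mrestr setIidl// leb_ball /=.
by rewrite -mulr_natl; field.
Qed.

Definition avg n (x : tR -> R) t := \int[mu]_s (ker n (t, s) * x s).

Lemma rint_ker n t x : rint mu x -> rint mu (fun s => ker n (t, s) * x s).
Proof. by move=> Ix; apply: rintMl Ix (bmf_ker n t).1 (fun s => ker_le n (t, s)). Qed.

Lemma ae_leb01 (Q : tR -> Prop) : {ae lam, forall t, Q t} -> {ae mu, forall t, Q t}.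
Proof.
move=> [N [mN N0 QN]]; exists N; split => //.
by apply/eqP; rewrite eq_le measure_ge0 andbT -N0 measureIl.
Qed.

Lemma ae_leb01_oo : {ae mu, forall t : tR, (0 : R) < t < 1}.
Proof.
exists (~` `]0%R, 1%R[%classic); split; first exact: measurableC.
  apply/eqP; rewrite eq_le measure_ge0 andbT.
  have -> : mu (~` `]0%R, 1%R[%classic) = lam (~` `]0%R, 1%R[%classic `&` `[0%R, 1%R]%classic) by [].
  apply: (@le_trans _ _ (lam ([set (0 : R)] `|` [set (1 : R)]))).
    apply: le_measure; rewrite ?inE.
    - by apply: measurableI => //; exact: measurableC.
    - exact: measurableU.
    move=> t /= []; rewrite !in_itv/= => + /andP[t0 t1].
    rewrite !lt_neqAle t0 t1 !andbT => /negP; rewrite negb_and !negbK => /orP[]/eqP->.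
      by left.
    by right.
  have lam1 (c : R) : lam [set c] = 0%E by exact: lebesgue_measure_set1.
  by rewrite (@null_set_setU _ _ _ lam)//; exact: lam1.
by move=> t /= nt; rewrite in_itv.
Qed.

(** Lebesgue's differentiation theorem for x extended by 0. For t in ]0, 1[ the ball is eventually
    inside [0,1], where the kernel has mass 1. *)
Lemma avg_cvg (x : tR -> R) : rint mu x ->
  {ae mu, forall t, avg n x t @[n --> \oo] --> x t}.
Proof.
move=> Ix; have mx := rint_measurable Ix.
pose y : R -> R := x \_ `[0, 1].
have Ly : locally_integrable setT y.
  apply: integrable_locally => //.
  apply/integrableP; split.
    by apply/measurable_funTS/measurable_EFinP.
  rewrite -integral_leb01//.
    by have /integrableP[] := Ix.
  by apply: measurableT_comp => //; exact/measurable_EFinP.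
move: ae_leb01_oo (ae_leb01 (lebesgue_differentiation Ly)).
apply: filterS2 => t /andP[t0 t1] yt.
have yn : davg y t (n.+1%:R^-1) @[n --> \oo] --> 0%E.
  have := (@cvge_at_rightP _ (davg y t) 0 0).1 yt; apply; split => [n|]; first by rewrite invr_gt0.
  exact: cvg_harmonic.

have b01 : \forall n \near \oo, ball t (n.+1%:R^-1 : R) `<=` `[0, 1]%classic.
  have m0 : 0 < Num.min t (1 - t) by rewrite lt_min t0 subr_gt0.
  have H := cvgr_lt _ (@cvg_harmonic R) _ m0.
  near=> n; have : harmonic n < Num.min t (1 - t) by near: n; exact: H.
  move=> + s; rewrite /harmonic/= lt_min => /andP[nt nt'].
  rewrite /ball/= ltr_distlC in_itv/= => /andP[ts st].
  rewrite (ltW (lt_trans _ ts)) ?subr_gt0//= ltW// (lt_trans st)//.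
  by rewrite -ltrBrDl.
have yn' := fine_cvg yn.
apply/cvgrPdist_le => e e0; have H := cvgr0_norm_le _ (yn' _) _ e0.
near=> n.
have bn : ball t (n.+1%:R^-1 : R) `<=` `[0, 1]%classic by near: n; exact: b01.
have hn : `|fine (davg y t (n.+1%:R^-1))| <= e by near: n; exact: H.
apply: le_trans hn; rewrite distrC.
have It : rint mu (fun s => ker n (t, s) * (x s - x t)).
  by apply: rint_ker; apply: rintB => //; exact: rint_cst.
have -> : avg n x t - x t = \int[mu]_s (ker n (t, s) * (x s - x t)).
  rewrite -[in LHS](mul1r (x t)) -(Rint_ker_eq1 bn) -RintZr; last first.
    exact: (sqint_rint mu (bmf_sqint (bmf_ker n t))).
  rewrite -RintB; [|exact: rint_ker|]; last first.
    by apply: rintZr; exact: (sqint_rint mu (bmf_sqint (bmf_ker n t))).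
  by apply: eq_Rintegral => s _; rewrite mulrBr.
rewrite (le_trans (ler_norm_Rint It))// [leRHS]ger0_norm; last first.
  by rewrite fine_ge0// mule_ge0 ?inve_ge0// integral_ge0.
rewrite le_eqVlt; apply/orP; left; apply/eqP; congr fine.
rewrite integral_leb01//; last first.
  apply/measurable_EFinP; apply: measurableT_comp => //.
  exact: rint_measurable It.
rewrite /davg /iavg leb_ball inver mulrn_eq0/= invr_eq0 pnatr_eq0/=.
have mb : measurable (ball t (n.+1%:R^-1 : R)) by exact: measurable_ball.
have -> : (ball t (n.+1%:R^-1 : R)) = `[0, 1]%classic `&` ball t (n.+1%:R^-1 : R).
  by rewrite setIidr.
rewrite integral_mkcondr -ge0_integralZl//=; last 2 first.
- apply/measurable_funTS; apply/(measurable_restrictT _ _).1 => //.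
  apply/measurable_EFinP/measurable_funTS; apply: measurableT_comp => //.
  apply: measurable_funB => //; have [my _ _] := Ly; exact: my.
- by move=> s _; rewrite patchE; case: ifPn.
apply: eq_integral => s s01; rewrite patchE.
have ys u : `[0, 1]%classic u -> y u = x u by move=> u01; rewrite /y patchE mem_set.
rewrite /ker/= indicE; case: ifPn => sb; last by rewrite mulr0 mul0r normr0 mule0.
rewrite mulr1 normrM /= (ys s (set_mem s01)) (ys t); last by rewrite /= in_itv/= !ltW.
rewrite -EFinM ger0_norm ?divr_ge0//; congr (_ * _)%:E.
by rewrite -mulr_natl; field.
Unshelve. all: by end_near. Qed.

(** Jensen's inequality for a kernel of mass at most 1: \int ker (x - c)^2 is expanded with c the
    average, and the missing mass contributes c^2 (1 - mass) with the favourable sign. *)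
Lemma avg_sqr n (x : tR -> R) t : sqint mu x -> avg n x t ^+ 2 <= avg n (fun s => x s ^+ 2) t.
Proof.
move=> Sx; set c := avg n x t.
have I1 := rint_ker n t (sqint_rint mu Sx); have I2 := rint_ker n t Sx.2.
have I0 : rint mu (fun s => ker n (t, s)) by exact: (sqint_rint mu (bmf_sqint (bmf_ker n t))).
have : 0 <= \int[mu]_s (ker n (t, s) * (x s - c) ^+ 2).
  by apply: Rint_ge0 => s; rewrite mulr_ge0 ?sqr_ge0 ?ker_ge0.
have -> : \int[mu]_s (ker n (t, s) * (x s - c) ^+ 2) =
    \int[mu]_s (ker n (t, s) * x s ^+ 2 - 2 * c * (ker n (t, s) * x s) + c ^+ 2 * ker n (t, s)).
  by apply: eq_Rintegral => s _; ring.
rewrite RintD; [|by apply: rintB => //; exact: rintZl|exact: rintZl].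
rewrite RintB//; last exact: rintZl.
rewrite (RintZl _ I1) (RintZl _ I0) -/(avg n x t) -/(avg n (fun s => x s ^+ 2) t) -/c.
have := Rint_ker_le1 n t; rewrite -subr_ge0 => /(mulr_ge0 (sqr_ge0 c)) k1 h.
by rewrite -subr_ge0; apply: le_trans (addr_ge0 h k1) _; rewrite le_eqVlt; apply/orP; left; apply/eqP; ring.
Qed.

Lemma rint_ker_prod n (x : tR -> R) : rint mu x ->
  rint (mu \x mu)%E (fun p => ker n p * x p.2).
Proof.
move=> Ix; apply: (rintMl _ (measurable_ker n) (fun p => ker_le n p)).
by have := rint_prodM (rint_cst mu 1) Ix; under eq_fun do rewrite mul1r.
Qed.

Lemma rint_avg n (x : tR -> R) : rint mu x -> rint mu (avg n x).
Proof. by move=> Ix; exact: (rint_Fubini1 (rint_ker_prod n Ix)).1. Qed.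

(** Averaging is self-adjoint, by the symmetry of the kernel. *)
Lemma Rint_avgM n (x h : tR -> R) : bmf h -> rint mu x ->
  \int[mu]_t (h t * avg n x t) = \int[mu]_t (avg n h t * x t).
Proof.
move=> [mh [M hM]] Ix.
have Ih : rint (mu \x mu)%E (fun p => h p.1 * (ker n p * x p.2)).
  apply: (rintMl (rint_ker_prod n Ix) _ (fun p => hM p.1)).
  exact: (measurableT_comp mh measurable_fst).
transitivity (\int[mu]_t \int[mu]_s (h t * (ker n (t, s) * x s))).
  by apply: eq_Rintegral => t _; rewrite RintZl//; exact: rint_ker.
rewrite (Rint_Fubini Ih); apply: eq_Rintegral => s _ /=.
rewrite /avg -RintZr; last by apply: rint_ker; exact: rint_bounded mh hM.
by apply: eq_Rintegral => t _; rewrite [in RHS]ker_sym; ring.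
Qed.

Lemma Rint_avg_le n (x : tR -> R) : rint mu x -> (forall t, 0 <= x t) ->
  \int[mu]_t avg n x t <= \int[mu]_t x t.
Proof.
move=> Ix x0; have := Rint_avgM n (bmf_cst 1) Ix.
under eq_Rintegral do rewrite mul1r.
move=> ->; have b1 : bmf (avg n (fun=> 1 : R)).
  split; first exact: rint_measurable (rint_avg n (rint_cst mu 1)).
  exists (n.+1%:R / 2) => t; apply: (ler_norm_Rint_bounded mu).
    by apply: measurable_funM => //; exact: (bmf_ker n t).1.
  by move=> s; rewrite mulr1 ker_le.
apply: le_Rint => //; first by have [mb [M bM]] := b1; exact: rintMl Ix mb bM.
move=> t; rewrite ler_piMl//; apply: le_trans (Rint_ker_le1 n t).
by rewrite /avg; under eq_Rintegral do rewrite mulr1.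
Qed.

Lemma sqint_avg n (x : tR -> R) : sqint mu x -> sqint mu (avg n x).
Proof.
move=> Sx; have mA := rint_measurable (rint_avg n (sqint_rint mu Sx)).
split => //; apply: rint_le (rint_avg n Sx.2); first exact: measurable_funX.
by move=> t; rewrite ger0_norm ?sqr_ge0// avg_sqr.
Qed.

Lemma Rint_avg_diff_le n (x : tR -> R) : sqint mu x ->
  \int[mu]_t ((x t - avg n x t) ^+ 2) <= 4 * \int[mu]_t (x t ^+ 2).
Proof.
move=> Sx; have I1 := Sx.2; have I2 := rint_avg n Sx.2.
apply: (@le_trans _ _ (\int[mu]_t (2 * x t ^+ 2 + 2 * avg n (fun s => x s ^+ 2) t))).
  apply: le_Rint; first exact: (sqintB Sx (sqint_avg n Sx)).2.
    by apply: rintD; exact: rintZl.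
  by move=> t; have := avg_sqr n t Sx; have := sqr_ge0 (x t + avg n x t); nra.
rewrite RintD; [|exact: rintZl|exact: rintZl]; rewrite !RintZl//.
have := Rint_avg_le n Sx.2 (fun t => sqr_ge0 (x t)); lra.
Qed.

(* [2 x^2 + 2 avg (x^2) - (x - avg x)^2] is nonnegative and tends to [4 x^2] almost
   everywhere, so that dominated convergence applies to the positive part of its
   difference with [4 x^2]. *)
Lemma avg_sqint_cvg (x : tR -> R) : sqint mu x ->
  \int[mu]_t ((x t - avg n x t) ^+ 2) @[n --> \oo] --> (0 : R).
Proof.
move=> Sx; have Ix := sqint_rint mu Sx.
pose q t := x t ^+ 2; have Iq : rint mu q by exact: Sx.2.
pose G n t := 2 * q t - 2 * avg n q t + (x t - avg n x t) ^+ 2.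
have IG n : rint mu (G n).
  apply: rintD; last exact: (sqintB Sx (sqint_avg n Sx)).2.
  by apply: rintB; apply: rintZl => //; exact: rint_avg.
have [N [mN N0 cvN]] : {ae mu, forall t, G n t @[n --> \oo] --> (0 : R)}.
  move: (avg_cvg Ix) (avg_cvg Iq); apply: filterS2 => t xt qt.
  rewrite [X in _ --> X](_ : _ = 2 * q t - 2 * q t + (x t - x t) * (x t - x t)); last by ring.
  have dt : x t - avg n x t @[n --> \oo] --> x t - x t by apply: cvgB => //; exact: cvg_cst.
  apply: cvgD; last exact: cvgM.
  by apply: cvgB; [exact: cvg_cst|apply: cvgM => //; exact: cvg_cst].
(* Cutting off the null set makes the convergence hold at every t, the form required by
   [Rint_cvg]. *)
pose H n t := \1_(~` N) t * Num.max 0 (G n t).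
have mH n : measurable_fun setT (H n).
  apply: measurable_funM; first by apply: measurable_indic; exact: measurableC.
  by apply: measurable_maxr => //; exact: rint_measurable (IG n).
have H0 n t : 0 <= H n t by rewrite mulr_ge0// le_max lexx.
have H4 n t : `|H n t| <= 4 * q t.
  rewrite ger0_norm// (@le_trans _ _ (Num.max 0 (G n t)))//.
    by rewrite ler_piMl ?le_max ?lexx// indicE lern1 leq_b1.
  rewrite ge_max mulr_ge0 ?sqr_ge0//=.
  by have := avg_sqr n t Sx; have := sqr_ge0 (x t + avg n x t); rewrite /G /q; nra.
have Hc t : H n t @[n --> \oo] --> (0 : R).
  have [tN|tN] := pselect (N t).
    rewrite (_ : H^~ t = fun=> 0); first exact: cvg_cst.
    by apply/funext => n; rewrite /H indicE memNset ?mul0r//= => -[].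
  have Gt : G n t @[n --> \oo] --> (0 : R) by apply: contrapT => nG; apply: tN; exact: cvN.
  apply/cvgr0Pnorm_le => e e0; have K := cvgr0_norm_le _ Gt _ e0; near=> n.
  rewrite ger0_norm// (@le_trans _ _ `|G n t|)//; last by near: n; exact: K.
  rewrite (@le_trans _ _ (Num.max 0 (G n t)))//.
    by rewrite ler_piMl ?le_max ?lexx// indicE lern1 leq_b1.
  by rewrite ge_max normr_ge0 ler_norm.
have [_] := Rint_cvg mH (rintZl 4 Iq) H4 Hc; rewrite Rint0 => cH.
apply/cvgr0Pnorm_le => e e0; have K := cvgr0_norm_le _ cH _ e0; near=> n.
rewrite ger0_norm; last by apply: Rint_ge0 => t; exact: sqr_ge0.
apply: (@le_trans _ _ `|\int[mu]_t H n t|); last by near: n; exact: K.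
apply: le_trans (ler_norm _).
(* The terms 2 q - 2 avg q of G have nonnegative integral, since averaging does not increase the
   integral of a nonnegative function. *)
apply: (@le_trans _ _ (\int[mu]_t G n t)).
  rewrite RintD; [|by apply: rintB; apply: rintZl => //; exact: rint_avg|exact: (sqintB Sx (sqint_avg n Sx)).2].
  rewrite lerDr RintB; [|exact: rintZl|by apply: rintZl; exact: rint_avg].
  rewrite !RintZl//; last exact: rint_avg.
  by rewrite -mulrBr mulr_ge0// subr_ge0 Rint_avg_le// => t; exact: sqr_ge0.
have IM : rint mu (fun t => Num.max 0 (G n t)).
  apply: rint_le (rintZl 4 Iq) => [|t].
    by apply: measurable_maxr => //; exact: rint_measurable (IG n).
  rewrite ger0_norm ?le_max ?lexx// ge_max mulr_ge0 ?sqr_ge0//=.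
  by have := avg_sqr n t Sx; have := sqr_ge0 (x t + avg n x t); rewrite /G /q; nra.
apply: (@le_trans _ _ (\int[mu]_t Num.max 0 (G n t))).
  by apply: le_Rint => // t; rewrite le_max lexx orbT.
rewrite le_eqVlt; apply/orP; left; apply/eqP; apply: ae_Rint => //.
  exact: rint_measurable IM.
exists N; split => // t /= nH; apply: contrapT => tN; apply: nH.
by rewrite /H indicE mem_set// mul1r.
Unshelve. all: by end_near. Qed.

End local_averages.

(** * Local averages of a process *)

Section process_averages.
Context d (T : measurableType d) (R : realType) (P : probability T R).
Local Notation tR := (measurableTypeR R).
Local Notation mu := (@leb01 R).
Variable Z : tR * T -> R.
Hypothesis LZ : L2proc P Z.

Let mZ : measurable_fun setT Z. Proof. by case: LZ. Qed.
Let Zw w : sqint mu (fun t => Z (t, w)). Proof. by case: LZ. Qed.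
Let Zt t : sqint P (fun w => Z (t, w)). Proof. by case: LZ. Qed.
Let SZ : sqint (mu \x P)%E Z. Proof. by case: LZ. Qed.

Let D n (p : tR * T) := Z p - pint Z (fun s => ker n (p.1, s)) p.2.

Definition avg_err n t := \int[P]_w ((Z (t, w) - pint Z (fun s => ker n (t, s)) w) ^+ 2).

Let sqint_D n : sqint (mu \x P)%E (D n).
Proof.
have mA : measurable_fun setT (fun p : tR * T => pint Z (fun s => ker n (p.1, s)) p.2).
  apply: (measurable_Rint1 mu (f := fun q : (tR * T) * tR => ker n (q.1.1, q.2) * Z (q.2, q.1.2))).
  apply: measurable_funM.
    apply: (measurableT_comp (measurable_ker n)).
    apply/measurable_fun_pairP; split => /=; last exact: measurable_snd.
    exact: (measurableT_comp measurable_fst measurable_fst).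
  apply: (measurableT_comp mZ); apply/measurable_fun_pairP; split => /=.
    exact: measurable_snd.
  exact: (measurableT_comp measurable_snd measurable_fst).
have mD : measurable_fun setT (D n) by exact: measurable_funB.
split => //; pose c : R := (n.+1%:R / 2) ^+ 2.
have I2 : rint (mu \x P)%E (fun p : tR * T => pathsq Z p.2).
  by have := rint_prodM (rint_cst mu 1) (rint_pathsq LZ).1; under eq_fun do rewrite mul1r.
apply: (rint_le _ _ (rintD (rintZl 2 SZ.2) (rintZl (2 * c) I2))).
  exact: measurable_funX.
move=> p; rewrite ger0_norm ?sqr_ge0// /D; set y := pint _ _ _.
have yc : y ^+ 2 <= c * pathsq Z p.2.
  apply: le_trans (pint_sqr_le LZ _ (bmf_sqint (bmf_ker n p.1))) _.
  apply: ler_wpM2r; first by apply: Rint_ge0 => t; exact: sqr_ge0.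
  have b := bmf_ker n p.1; have Sb := bmf_sqint b.
  rewrite -(Rint_cst mu c); apply: le_Rint; [exact: Sb.2|exact: rint_cst|].
  move=> s; rewrite -[leLHS]real_normK ?num_real// lerXn2r ?nnegrE ?divr_ge0//.
  exact: ker_le.
by have := sqr_ge0 (Z p + y); move: yc; rewrite -mulrA; nra.
Qed.

Lemma rint_avg_err n : rint mu (avg_err n).
Proof. exact: (rint_Fubini1 (sqint_D n).2).1. Qed.

Lemma avg_err_ge0 n t : 0 <= avg_err n t.
Proof. by apply: Rint_ge0 => w; exact: sqr_ge0. Qed.

Let Rint_avg_err n : \int[mu]_t avg_err n t =
  \int[P]_w \int[mu]_t ((Z (t, w) - avg n (fun s => Z (s, w)) t) ^+ 2).
Proof. by have := Rint_Fubini (sqint_D n).2. Qed.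

(** Path by path this is [avg_sqint_cvg]; the domination by four times [pathsq], from
    [Rint_avg_diff_le], carries it to the expectation. *)
Lemma avg_err_cvg : \int[mu]_t avg_err n t @[n --> \oo] --> (0 : R).
Proof.
rewrite (funext Rint_avg_err) -(Rint0 P).
apply: (Rint_cvg (g := fun w => 4 * pathsq Z w) _ _ _ _).2.
- move=> n; exact: rint_measurable (rint_Fubini1 (rint_swap (sqint_D n).2)).1.
- exact: rintZl (rint_pathsq LZ).1.
- move=> n w; rewrite ger0_norm; first exact: Rint_avg_diff_le.
  by apply: Rint_ge0 => t; exact: sqr_ge0.
- by move=> w; exact: avg_sqint_cvg.
Qed.

(** Quantitative compactness. The pairing of h with a path splits into its pairing with path minus
    average, small uniformly over bounded sets of h, and its pairing with the average, which by
    self-adjointness only sees the average of h. *)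
Lemma pint_sqr_avg n (h : tR -> R) (b : R) : bmf h -> (forall t, `|avg n h t| <= b) ->
  \int[P]_w (pint Z h w ^+ 2) <=
  2 * (\int[mu]_t (h t ^+ 2) * \int[mu]_t avg_err n t + b ^+ 2 * esq P Z).
Proof.
move=> bh hb; have Sh := bmf_sqint bh.
pose e w := \int[mu]_t ((Z (t, w) - avg n (fun s => Z (s, w)) t) ^+ 2).
have Ie : rint P e by exact: (rint_Fubini1 (rint_swap (sqint_D n).2)).1.
pose N := \int[mu]_t (h t ^+ 2).
have Ip := (rint_pathsq LZ).1.
apply: (@le_trans _ _ (\int[P]_w (2 * (N * e w + b ^+ 2 * pathsq Z w)))).
  apply: le_Rint; first exact: (sqint_pint LZ Sh).2.
    by apply: rintZl; apply: rintD; exact: rintZl.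
  move=> w; have SA := sqint_avg n (Zw w).
  have mb : measurable_fun setT (avg n h) by exact: rint_measurable (rint_avg n (sqint_rint mu Sh)).
  have -> : pint Z h w = \int[mu]_t (h t * (Z (t, w) - avg n (fun s => Z (s, w)) t)) +
      \int[mu]_t (avg n h t * Z (t, w)).
    rewrite -(Rint_avgM n bh (sqint_rint mu (Zw w))) -RintD; last 2 first.
    - by apply: sqintM => //; exact: sqintB.
    - exact: sqintM.
    by apply: eq_Rintegral => t _; ring.
  set x := \int[mu]_t (h t * _); set y := \int[mu]_t (avg n h t * _).
  have xe : x ^+ 2 <= N * e w := Rint_CS Sh (sqintB (Zw w) SA).
  have yb : y ^+ 2 <= \int[mu]_t (avg n h t ^+ 2) * pathsq Z w.
    exact: Rint_CS (sqint_bounded mu mb hb) (Zw w).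
  apply: (@le_trans _ _ (2 * (x ^+ 2 + y ^+ 2))).
    by rewrite -subr_ge0 (_ : _ - _ = (x - y) ^+ 2) ?sqr_ge0//; ring.
  rewrite ler_pM2l// lerD// (le_trans yb)//.
  apply: ler_wpM2r; first by apply: Rint_ge0 => t; exact: sqr_ge0.
  rewrite -(Rint_cst mu (b ^+ 2)); apply: le_Rint.
  - exact: (sqint_bounded mu mb hb).2.
  - exact: rint_cst.
  move=> s; rewrite -[leLHS]real_normK ?num_real// lerXn2r ?nnegrE//.
  exact: le_trans (hb s).
rewrite RintZl; last by apply: rintD; exact: rintZl.
rewrite RintD; [|exact: rintZl|exact: rintZl].
by rewrite !RintZl// (rint_pathsq LZ).2 Rint_avg_err.
Qed.

End process_averages.

(** * Energy identities for the Volterra operator *)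

Section volterra_energy.
Variable R : realType.
Local Notation tR := (measurableTypeR R).
Local Notation mu := (@leb01 R).
Local Notation Zv := (@Zvol R).
Implicit Types g h : tR -> R.

Lemma ZvolE (t c : R) : Zv (t, c) = if (0 <= c) && (c < t) then 1 else 0.
Proof.
rewrite /Zvol indicE; case: ifPn => h.
  by rewrite mem_set//= in_itv.
by rewrite memNset//= in_itv/=; apply/negP.
Qed.

Lemma ae_neq (b : R) : {ae mu, forall s, s != b :> R}.
Proof.
apply: ae_leb01; exists [set b]; split; [exact: measurable_set1|exact: lebesgue_measure_set1|].
by move=> s /= /negP; rewrite negbK => /eqP.
Qed.

Lemma bmf_Zvol (c : R) : bmf (fun t => Zv (t, c)).
Proof.
have [mZ _ _ _] := L2proc_Zvol R; split.
  exact: (measurableT_comp mZ (measurable_pair2 c)).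
by exists 1 => t; rewrite ZvolE; case: ifP; rewrite ?normr1 ?normr0.
Qed.

(** V plus its adjoint is the projection onto the constants: [Zv (t, s)] and [Zv (s, t)] add up to 1
    for almost all s and t in [0,1]. *)
Lemma Rint_vol g : bmf g -> (\int[mu]_t g t) ^+ 2 = 2 * \int[mu]_t (g t * vol g t).
Proof.
move=> bg; have [mg [M gM]] := bg; have Ig := sqint_rint mu (bmf_sqint bg).
have [mZ _ _ _] := L2proc_Zvol R.
have Z1 p : `|Zv p| <= 1 by case: p => t c; rewrite ZvolE; case: ifP; rewrite ?normr1 ?normr0.
pose F (p : tR * tR) := g p.1 * (g p.2 * Zv p).
have IF : rint (mu \x mu)%E F.
  apply: (rintMl (M := M) _ (measurableT_comp mg measurable_fst) (fun p => gM p.1)).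
  apply: (rint_bounded (mu \x mu)%E (M := M * 1)).
    by apply: measurable_funM => //; exact: (measurableT_comp mg measurable_snd).
  by move=> p; rewrite normrM ler_pM.
have E : \int[mu]_t (g t * vol g t) = \int[mu]_t \int[mu]_s (g t * (g s * Zv (t, s))).
  have := Rint_Fubini IF; rewrite /F/= => ->.
  apply: eq_Rintegral => t _; rewrite /vol /pint -RintZl.
    by apply: eq_Rintegral => s _; ring.
  by apply: sqintM; [exact: bmf_sqint|exact: bmf_sqint (bmf_Zvol t)].
have mvol := (bmf_vol bg).1.
have IgZ t : rint mu (fun s => g s * Zv (t, s)).
  apply: (rint_bounded mu (M := M * 1)).
    apply: measurable_funM => //; exact: (measurableT_comp mZ (measurable_pair1 t)).
  by move=> p; rewrite normrM ler_pM.
have I1 := (rint_Fubini1 IF).1.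
have IgZ' t : rint mu (fun s => g s * Zv (s, t)).
  by apply: sqintM; [exact: bmf_sqint|exact: bmf_sqint (bmf_Zvol t)].
have I2 : rint mu (fun t => g t * vol g t) by apply: sqintM; apply: bmf_sqint => //; exact: bmf_vol.
rewrite mulr_natl mulr2n [X in _ = X + _]E -RintD//.
rewrite expr2 -RintZr//; apply: ae_Rint.
- exact: measurable_funM.
- by apply: measurable_funD; [exact: rint_measurable I1|exact: rint_measurable I2].
apply: filterS (ae_leb01_oo R) => t /andP[t0 t1].
rewrite RintZl// -mulrDr; congr (_ * _); rewrite /vol /pint -RintD//.
apply: ae_Rint => //.
  by apply: measurable_funD; [exact: rint_measurable (IgZ t)|exact: rint_measurable (IgZ' t)].
move: (ae_leb01_oo R) (ae_neq t); apply: filterS2 => s /andP[s0 s1] st.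
rewrite !ZvolE (ltW s0) (ltW t0)/=; case: ltgtP st => // _ _; ring.
Qed.

(** [Rint_vol] for h cut off to ]c, 1], whose total integral is V h (c). *)
Lemma vol_sqr h c : bmf h -> vol h c ^+ 2 = 2 * \int[mu]_t (Zv (t, c) * (h t * vol h t)).
Proof.
move=> bh; have bg := bmfM bh (bmf_Zvol c).
rewrite {1}/vol /pint Rint_vol//; congr (_ * _); apply: eq_Rintegral => t _.
rewrite ZvolE; case: ifPn => [/andP[c0 ct]|_]; last by rewrite mulr0 !mul0r.
rewrite mulr1 mul1r; congr (_ * _); apply: eq_Rintegral => s _.
rewrite !ZvolE c0 (ltW (le_lt_trans c0 ct))/=; case: (ltP t s) => ts; last by rewrite !mulr0.
by rewrite (lt_trans ct ts) !mulr1.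
Qed.

(** Interpolation: V h is small in supremum norm as soon as it is small in L^2 and h is bounded in
    L^2. *)
Lemma vol_sqr_le h c : bmf h -> vol h c ^+ 2 <= 2 * (nrm mu h * nrm mu (vol h)).
Proof.
move=> bh; rewrite vol_sqr// ler_pM2l//.
have Sh := bmf_sqint bh; have Sv := bmf_sqint (bmf_vol bh).
apply: le_trans (nrm_CS_abs Sh Sv); apply: le_Rint.
- have [mc [M cM]] := bmf_Zvol c; exact: (rintMl (sqintM Sh Sv) mc cM).
- exact: sqintM (sqint_abs Sh) (sqint_abs Sv).
move=> t; apply: le_trans (ler_norm _) _; rewrite !normrM ler_piMl// ?mulr_ge0//.
by rewrite ZvolE; case: ifP; rewrite ?normr1 ?normr0.
Qed.

(** An average of h is a difference quotient of its primitive. The arguments are cut at 0 because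
    [vol h] vanishes on the negative axis instead of continuing as a constant. *)
Lemma avg_vol n h t : bmf h -> avg n h t = n.+1%:R / 2 *
  (vol h (Num.max 0 (t - n.+1%:R^-1)) - vol h (Num.max 0 (t + n.+1%:R^-1))).
Proof.
move=> bh; have Sh := bmf_sqint bh; set a := Num.max _ _; set b := Num.max _ _.
have IZ c : rint mu (fun s => h s * Zv (s, c)).
  by apply: sqintM => //; exact: bmf_sqint (bmf_Zvol c).
rewrite /vol /pint -RintB// -RintZl; last exact: rintB.
apply: ae_Rint.
- by apply: measurable_funM; [exact: (bmf_ker n t).1|exact: bh.1].
- by apply: measurable_funM => //; exact: rint_measurable (rintB (IZ a) (IZ b)).
move: (ae_leb01_oo R) (ae_neq (t + n.+1%:R^-1)); apply: filterS2 => s /andP[s0 s1] sb.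
rewrite !ZvolE /ker -mulrBr -[LHS]mulrA; congr (_ * _); rewrite [LHS]mulrC; congr (_ * _).
rewrite /a /b !le_max lexx/= !gt_max s0/= indicE.
case: ifPn => as_; case: ifPn => bs.
- rewrite subrr memNset//= /ball/= ltr_distlC => /andP[_]; rewrite ltNge (ltW bs)//.
- by rewrite subr0 mem_set//= /ball/= ltr_distlC as_ /= lt_neqAle sb leNgt.
- have r0 : 0 < n.+1%:R^-1 :> R by rewrite invr_gt0.
  by move: as_; rewrite (lt_trans _ bs)// ltrBlDr -addrA ltrDl addr_gt0.
- by rewrite subrr memNset//= /ball/= ltr_distlC (negPf as_).
Qed.

End volterra_energy.

(** * The flow of the Volterra operator *)

Section weak_convergence.
Context d (T : measurableType d) (R : realType) (P : probability T R).
Local Notation tR := (measurableTypeR R).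
Local Notation mu := (@leb01 R).
Variable Z : tR * T -> R.
Hypothesis LZ : L2proc P Z.

(* A bounded sequence in L^2 whose image under the Volterra operator tends to [0]
   converges weakly to [0], and [h |-> pint Z h] is a compact operator. *)
Lemma pint_weak_cvg (h : nat -> tR -> R) (C : R) :
  (forall m, bmf (h m)) -> (forall m, \int[mu]_t (h m t ^+ 2) <= C) ->
  nrm mu (vol (h m)) @[m --> \oo] --> (0 : R) ->
  \int[P]_w (pint Z (h m) w ^+ 2) @[m --> \oo] --> (0 : R).
Proof.
move=> bh hC v0.
have C0 : 0 <= C by apply: le_trans (hC 0%N); apply: Rint_ge0 => t; exact: sqr_ge0.
apply/cvgr0Pnorm_le => e e0.
(* The radius index r is fixed first, so that C rho <= e / 4; then m is taken large enough for k v
   <= e / 4. The factor 2 of [pint_sqr_avg] brings the sum to e. *)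
have e1 : 0 < e / (4 * (C + 1)) by rewrite divr_gt0// mulr_gt0// ltr_wpDl.
have [r _ Hr] := cvgr0_norm_le _ (avg_err_cvg LZ) _ e1.
have {Hr} := Hr r (leqnn r); set rho := \int[mu]_t avg_err _ _ _ _ => rho_le.
have rho0 : 0 <= rho by apply: Rint_ge0 => t; exact: avg_err_ge0.
rewrite ger0_norm// ler_pdivlMr in rho_le; last by rewrite mulr_gt0// ltr_wpDl.
pose k := r.+1%:R ^+ 2 * (2 * Num.sqrt C) * esq P Z.
have k0 : 0 <= k by rewrite !mulr_ge0 ?sqr_ge0 ?sqrtr_ge0 ?esq_ge0.
have e2 : 0 < e / (4 * (k + 1)) by rewrite divr_gt0// mulr_gt0// ltr_wpDl.
have H := cvgr0_norm_le _ v0 _ e2; near=> m.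
have : `|nrm mu (vol (h m))| <= e / (4 * (k + 1)) by near: m; exact: H.
rewrite ger0_norm ?nrm_ge0// ler_pdivlMr; last by rewrite mulr_gt0// ltr_wpDl.
have v_ge0 := nrm_ge0 mu (vol (h m)); set v := nrm mu _ in v_ge0 * => v_le.
rewrite ger0_norm; last by apply: Rint_ge0 => w; exact: sqr_ge0.
(* A bound for the averages of [h m]: by [avg_vol] they are (r + 1) / 2 times a difference of two
   values of V h, each bounded through [vol_sqr_le]. *)
pose b := r.+1%:R * Num.sqrt (2 * (Num.sqrt C * v)).
have b2 : b ^+ 2 = r.+1%:R ^+ 2 * (2 * Num.sqrt C) * v.
  by rewrite exprMn sqr_sqrtr ?mulr_ge0 ?sqrtr_ge0//; ring.
have volb c : `|vol (h m) c| <= Num.sqrt (2 * (Num.sqrt C * v)).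
  rewrite -sqrtr_sqr ler_wsqrtr//; apply: le_trans (vol_sqr_le c (bh m)) _.
  by rewrite ler_pM2l// ler_wpM2r// /nrm ler_wsqrtr.
have avgb t : `|avg r (h m) t| <= b.
  rewrite avg_vol// normrM ger0_norm ?divr_ge0// /b -mulrA ler_wpM2l//.
  rewrite ler_pdivrMl// (le_trans (ler_normB _ _))//.
  by rewrite [leRHS]mulr_natl mulr2n lerD.
rewrite (le_trans (pint_sqr_avg LZ (bh m) avgb))// -/rho b2.
have : \int[mu]_t (h m t ^+ 2) * rho <= C * rho by rewrite ler_wpM2r.
by move: v_le rho_le; rewrite -/k [_ * v * _]mulrAC -/k; nra.
Unshelve. all: by end_near. Qed.

End weak_convergence.

(** * Euler's scheme for the flow and its decay *)

Section euler_scheme.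
Variable R : realType.
Local Notation tR := (measurableTypeR R).
Local Notation mu := (@leb01 R).
Local Notation Zv := (@Zvol R).
Implicit Types g h w : tR -> R.

Definition euler (eps : R) h : tR -> R := fun t => h t - eps * vol h t.

Lemma bmf_euler eps h : bmf h -> bmf (euler eps h).
Proof.
move=> bh; apply: bmfD => //; have := bmfM (bmf_cst (- eps)) (bmf_vol bh).
by under eq_fun do rewrite mulNr.
Qed.

(* Equal to [t] on [0,1]. *)
Definition vweight (t : tR) : R := \int[mu]_c Zv (t, c).

Lemma vweight_itv t : 0 <= vweight t <= 1.
Proof.
have [mZ _ _ _] := L2proc_Zvol R.
have Z1 c : 0 <= Zv (t, c) <= 1 by rewrite ZvolE; case: ifP; rewrite ?lexx ?ler01.
have mt : measurable_fun setT (fun c => Zv (t, c)).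
  exact: (measurableT_comp mZ (measurable_pair1 t)).
have IZ : rint mu (fun c => Zv (t, c)).
  apply: (rint_bounded mu (M := 1)) => // c; have /andP[c0 c1] := Z1 c.
  by rewrite ger0_norm.
apply/andP; split; first by apply: Rint_ge0 => c; have /andP[] := Z1 c.
rewrite -[leRHS](Rint_cst mu); apply: le_Rint => //; first exact: rint_cst.
by move=> c; have /andP[] := Z1 c.
Qed.

Lemma bmf_vweight : bmf vweight.
Proof.
have [mZ _ _ _] := L2proc_Zvol R.
split; first exact: (measurable_Rint1 mu mZ).
by exists 1 => t; have /andP[t0 t1] := vweight_itv t; rewrite ger0_norm.
Qed.

(** [vol_sqr] integrated over c. It identifies \int (V h)^2 with the rate at which the weighted
    energy \int t h^2 decreases along h' = - V h. *)
Lemma Rint_vol_sqr h : bmf h ->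
  \int[mu]_c (vol h c ^+ 2) = 2 * \int[mu]_t (vweight t * (h t * vol h t)).
Proof.
move=> bh; have [mZ _ _ _] := L2proc_Zvol R.
have Z1 p : `|Zv p| <= 1 by case: p => t c; rewrite ZvolE; case: ifP; rewrite ?normr1 ?normr0.
pose f t := h t * vol h t; have bf : bmf f by apply: bmfM => //; exact: bmf_vol.
have If := sqint_rint mu (bmf_sqint bf).
have IF : rint (mu \x mu)%E (fun p => Zv p * f p.1).
  apply: (rintMl (M := 1) _ mZ Z1).
  by have := rint_prodM If (rint_cst mu 1); under eq_fun do rewrite mulr1.
under eq_Rintegral do rewrite vol_sqr//.
rewrite RintZl; last exact: (rint_Fubini1 (rint_swap IF)).1.
congr (_ * _); rewrite -[LHS](Rint_Fubini IF) /=; apply: eq_Rintegral => t _.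
rewrite RintZr//; apply: (rint_bounded mu (M := 1)) => //.
exact: (measurableT_comp mZ (measurable_pair1 t)).
Qed.

Lemma Rint_vol_sqr_le h : bmf h -> \int[mu]_t (vol h t ^+ 2) <= \int[mu]_t (h t ^+ 2).
Proof.
move=> bh; apply: le_trans (Rint_pint_sqr (L2proc_Zvol R) (bmf_sqint bh)) _.
rewrite ler_piMr//; first by apply: Rint_ge0 => t; exact: sqr_ge0.
have [_ _ _ SZ] := L2proc_Zvol R.
rewrite /esq -[leRHS](Rint_cst (mu \x mu)%E); apply: le_Rint; [exact: SZ.2|exact: rint_cst|].
by case=> t c; rewrite ZvolE; case: ifP; rewrite ?expr1n ?expr0n.
Qed.

Lemma Rint_euler w eps h : bmf w -> bmf h ->
  \int[mu]_t (w t * euler eps h t ^+ 2) = \int[mu]_t (w t * h t ^+ 2) -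
    2 * eps * \int[mu]_t (w t * (h t * vol h t)) +
    eps ^+ 2 * \int[mu]_t (w t * vol h t ^+ 2).
Proof.
move=> bw bh; have bv := bmf_vol bh.
have I1 : rint mu (fun t => w t * h t ^+ 2).
  by apply: (sqint_rint mu); apply: bmf_sqint; do 2!apply: bmfM => //.
have I2 : rint mu (fun t => w t * (h t * vol h t)).
  by apply: (sqint_rint mu); apply: bmf_sqint; do 2!apply: bmfM => //.
have I3 : rint mu (fun t => w t * vol h t ^+ 2).
  by apply: (sqint_rint mu); apply: bmf_sqint; do 2!apply: bmfM => //.
rewrite -(RintZl (2 * eps) I2) -(RintZl (eps ^+ 2) I3) -RintB//; last exact: rintZl.
rewrite -RintD; [|by apply: rintB => //; exact: rintZl|exact: rintZl].
by apply: eq_Rintegral => t _; rewrite /euler; ring.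
Qed.

(** The term of first order is - eps (\int h)^2 by [Rint_vol], and V does not increase the L^2 norm;
    only eps^2 can make the norm grow. *)
Lemma euler_norm eps h : bmf h ->
  0 <= eps -> \int[mu]_t (euler eps h t ^+ 2) <= (1 + eps ^+ 2) * \int[mu]_t (h t ^+ 2).
Proof.
move=> bh eps0; have := Rint_euler eps (bmf_cst 1) bh.
have E (f : tR -> R) : \int[mu]_t (1 * f t) = \int[mu]_t f t.
  by apply: eq_Rintegral => t _; rewrite mul1r.
rewrite !E => ->; have := Rint_vol bh.
have := ler_wpM2l (sqr_ge0 eps) (Rint_vol_sqr_le bh).
have := sqr_ge0 (\int[mu]_t h t).
set i := \int[mu]_t (h t * vol h t) => + + hi.
rewrite hi => i0 le_v.
have : 0 <= eps * (2 * i) by rewrite mulr_ge0.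
rewrite mulrDl mul1r; lra.
Qed.

Lemma euler_energy eps h : bmf h ->
  \int[mu]_t (vweight t * euler eps h t ^+ 2) <= \int[mu]_t (vweight t * h t ^+ 2) -
    eps * \int[mu]_t (vol h t ^+ 2) + eps ^+ 2 * \int[mu]_t (h t ^+ 2).
Proof.
move=> bh; have bv := bmf_vol bh; rewrite (Rint_euler eps bmf_vweight bh).
rewrite [2 * eps]mulrC -[eps * 2 * _]mulrA -Rint_vol_sqr// lerD2l ler_wpM2l ?sqr_ge0//.
apply: le_trans (Rint_vol_sqr_le bh); apply: le_Rint; [|exact: (bmf_sqint bv).2|].
  apply: (sqint_rint mu); apply: bmf_sqint; apply: bmfM; first exact: bmf_vweight.
  exact: bmfM.
by move=> t; rewrite ler_piMl ?sqr_ge0//; have /andP[] := vweight_itv t.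
Qed.

Section iteration.
Variables (eps : R) (n : nat) (h : tR -> R).
Hypothesis bh : bmf h.
Hypothesis eps0 : 0 < eps.
Hypothesis n0 : (0 < n)%N.
Hypothesis n_eps : n%:R * eps ^+ 2 <= 1.

Let hs k := iter k (euler eps) h.
Let N0 := \int[mu]_t (h t ^+ 2).

Lemma bmf_iter_euler k : bmf (hs k).
Proof. by elim: k => //= k; exact: bmf_euler. Qed.

(** (1 + eps^2)^k <= exp (k eps^2) <= exp 1. *)
Lemma iter_euler_norm k : (k <= n)%N -> \int[mu]_t (hs k t ^+ 2) <= expR 1 * N0.
Proof.
have N00 : 0 <= N0 by apply: Rint_ge0 => t; exact: sqr_ge0.
move=> kn; apply: (@le_trans _ _ (expR (k%:R * eps ^+ 2) * N0)).
  elim: k {kn} => [|k ih]; first by rewrite mul0r expR0 mul1r.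
  apply: le_trans (euler_norm (bmf_iter_euler k) (ltW eps0)) _.
  rewrite -[k.+1%:R]natr1 [(k%:R + 1) * _]mulrDl mul1r expRD [_ * expR (eps ^+ 2)]mulrC -[leRHS]mulrA.
  apply: ler_pM => //; [by rewrite addr_ge0 ?sqr_ge0|by apply: Rint_ge0 => t; exact: sqr_ge0|].
  exact: expR_ge1Dx.
rewrite ler_wpM2r// ler_expR; apply: le_trans n_eps.
by rewrite ler_wpM2r ?sqr_ge0// ler_nat.
Qed.

(** Otherwise the weighted energy, at most N0 at the start, would lose eps c at each of n steps
    while gaining at most C in total, as n eps^2 <= 1. The numerator is chosen so that the loss n
    eps c = 2 C + 1 exceeds N0 + C and makes the energy negative. The argument yields smallness at
    some step only. *)
Lemma euler_small_vol : exists2 k, (k < n)%N &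
  \int[mu]_t (vol (hs k) t ^+ 2) <= (2 * (expR 1 * N0) + 1) / (n%:R * eps).
Proof.
set C := expR 1 * N0; set c := _ / _.
have N00 : 0 <= N0 by apply: Rint_ge0 => t; exact: sqr_ge0.
have NC : N0 <= C by rewrite ler_peMl// (le_trans _ (expR_ge1Dx 1))// lerDl.
apply: contrapT => nk.
have {}nk k : (k < n)%N -> c <= \int[mu]_t (vol (hs k) t ^+ 2).
  by move=> kn; rewrite leNgt; apply/negP => /ltW kc; apply: nk; exists k.
have phi k : (k <= n)%N -> \int[mu]_t (vweight t * hs k t ^+ 2) <=
    N0 - k%:R * (eps * c) + k%:R * (eps ^+ 2 * C).
  elim: k => [_|k ih kn].
    rewrite !mul0r subr0 addr0; apply: le_Rint; [|exact: (bmf_sqint bh).2|].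
      apply: (sqint_rint mu); apply: bmf_sqint; apply: bmfM; first exact: bmf_vweight.
      exact: bmfM.
    by move=> t; rewrite ler_piMl ?sqr_ge0//; have /andP[] := vweight_itv t.
  apply: le_trans (euler_energy eps (bmf_iter_euler k)) _.
  have := ih (ltnW kn).
  have := ler_wpM2l (ltW eps0) (nk k kn).
  have := ler_wpM2l (sqr_ge0 eps) (iter_euler_norm (ltnW kn)).
  by rewrite -[k.+1%:R]natr1 -/C ![(_ + 1) * _]mulrDl !mul1r; lra.
have := phi n (leqnn n); rewrite leNgt => /negP; apply.
apply: (@lt_le_trans _ _ 0); last first.
  by apply: Rint_ge0 => t; rewrite mulr_ge0 ?sqr_ge0//; have /andP[] := vweight_itv t.
have -> : n%:R * (eps * c) = 2 * C + 1.
  by rewrite mulrA mulrC divfK// mulf_neq0 ?gt_eqF ?ltr0n.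
have := ler_wpM2r (le_trans N00 NC) n_eps.
by rewrite mul1r -mulrA; lra.
Qed.

End iteration.

End euler_scheme.

(** The upper bound comes from exp u (1 - u) <= 1 and (1 - u) (1 + u + 2 u^2) = 1 + u^2 (1 - 2 u) >=
    1. *)
Lemma expR_taylor (R : realType) (u : R) : `|u| <= 1 / 2 -> 0 <= expR u - 1 - u <= 2 * u ^+ 2.
Proof.
rewrite ler_norml => /andP[u1 u2]; apply/andP; split.
  by have := expR_ge1Dx u; lra.
have := expR_ge1Dx (- u); have := expR_gt0 u => E0; rewrite expRN => Eu.
have {Eu} : expR u * (1 - u) <= 1 by rewrite -ler_pdivlMl// mulr1.
have : 0 <= u ^+ 2 * (1 - 2 * u) by rewrite mulr_ge0 ?sqr_ge0//; lra.
by nra.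
Qed.

(** The local error of one step: c and c' are the expectations of the cosine before and after, A =
    <k_h, k_{Vh}> and B = |k_{Vh}|^2. The integration by parts identity multiplies c by 1 + eps A up
    to second order, the Gaussian factor is multiplied by exp u, and the terms of first order
    cancel. *)
Lemma euler_step_bound (R : realType) (eps q e A B c c' : R) :
  0 <= eps <= 1 -> 4 * (eps * q) <= 1 -> 0 <= q -> 0 <= e -> `|A| <= q -> 0 <= B <= q ->
  `|c| <= 1 -> `|c' - (c + eps * (c * A))| <= 2 * eps ^+ 2 * e ->
  `|c' * expR (- (eps * A) + eps ^+ 2 * B / 2) - c| <= eps ^+ 2 * (q / 2 + 18 * q ^+ 2 + 4 * e).
Proof.
move=> /andP[eps0 eps1] eq1 q0 e0 Aq /andP[B0 Bq] c1 r1.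
set u := - (eps * A) + _.
have epsA : `|eps * A| <= eps * q by rewrite normrM (ger0_norm eps0) ler_wpM2l.
have epsB : eps ^+ 2 * B <= eps ^+ 2 * q by rewrite ler_wpM2l ?sqr_ge0.
have epsB0 : 0 <= eps ^+ 2 * B by rewrite mulr_ge0 ?sqr_ge0.
have eps2 : eps ^+ 2 * q <= eps * q by rewrite expr2 ler_wpM2r// ler_piMl.
have u2 : `|u| <= 2 * (eps * q).
  rewrite /u (le_trans (ler_normD _ _))// normrN (ger0_norm (divr_ge0 epsB0 _))//.
  by lra.
have u12 : `|u| <= 1 / 2 by apply: le_trans u2 _; lra.
have /andP[s0 s2] := expR_taylor u12.
have usq : u ^+ 2 <= 4 * (eps ^+ 2 * q ^+ 2).
  rewrite -[u ^+ 2]real_normK ?num_real// (_ : 4 * _ = (2 * (eps * q)) ^+ 2); last by ring.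
  by rewrite lerXn2r ?nnegrE ?mulr_ge0.
have usq4 : u ^+ 2 <= (1 / 2) ^+ 2.
  by rewrite -[u ^+ 2]real_normK ?num_real// lerXn2r ?nnegrE.
have Eu : expR u <= 2.
  by have := ler_norm u; lra.
(* The three terms after the factor c contribute q / 2, 2 q^2 and 2 * 8 q^2, using |u| <= 2 eps q;
   the remainder of c' contributes 2 e times the bound 2 for exp u. *)
have -> : c' * expR u - c =
    c * (eps ^+ 2 * B / 2 + eps * A * u + (1 + eps * A) * (expR u - 1 - u)) +
    (c' - (c + eps * (c * A))) * expR u.
  by move: (expR u) => E; rewrite /u; field.
have t1 : `|eps ^+ 2 * B / 2| <= eps ^+ 2 * (q / 2) by rewrite ger0_norm; lra.
have t2 : `|eps * A * u| <= 2 * (eps ^+ 2 * q ^+ 2).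
  rewrite normrM (_ : 2 * _ = (eps * q) * (2 * (eps * q))); last by ring.
  by apply: ler_pM.
have t3 : `|(1 + eps * A) * (expR u - 1 - u)| <= 16 * (eps ^+ 2 * q ^+ 2).
  rewrite normrM (ger0_norm s0) (_ : 16 * _ = 2 * (8 * (eps ^+ 2 * q ^+ 2))); last by ring.
  apply: ler_pM => //; last by lra.
  by rewrite (le_trans (ler_normD _ _))// normr1; lra.
rewrite (le_trans (ler_normD _ _))// [leRHS]mulrDr; apply: lerD; last first.
  rewrite normrM (gtr0_norm (expR_gt0 _)) (_ : _ * (4 * e) = 2 * eps ^+ 2 * e * 2); last by ring.
  by apply: ler_pM => //; exact: expR_ge0.
rewrite normrM -[leRHS]mul1r; apply: ler_pM => //.
rewrite (le_trans (ler_normD _ _))// (le_trans (lerD (ler_normD _ _) (lexx _)))//.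
by lra.
Qed.

Section euler_limit.
Context d (T : measurableType d) (R : realType) (P : probability T R).
Local Notation tR := (measurableTypeR R).
Local Notation mu := (@leb01 R).
Variables (X : tR * T -> R) (K : tR * tR -> R) (J : set R).
Hypothesis LX : L2proc P X.
Hypothesis LK : L2proc mu K.
Hypothesis fJ : full_times J.
Hypothesis ibp_steps : forall (th : R) (e : seq (R * R)),
  (forall p, p \in e -> J p.2) ->
  \int[P]_w (sin (psum X e w + th) * pint X (psum (@Zvol R) e) w) =
  \int[P]_w cos (psum X e w + th) * \int[mu]_s (psum K e s * pint K (psum (@Zvol R) e) s).
Implicit Types h : tR -> R.

Let Q h := \int[mu]_s (pint K h s ^+ 2).

(* Constant along the flow [h' = - vol h], hence equal to its limit [cos th]. *)
Let chi th h := \int[P]_w cos (pint X h w + th) * expR (Q h / 2).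

Let pint_euler d' (T' : measurableType d') (P' : probability T' R) Z eps h w :
  L2proc P' Z -> bmf h -> pint Z (euler eps h) w = pint Z h w - eps * pint Z (vol h) w.
Proof.
move=> LZ bh; have Sh := bmf_sqint bh; have Sv := bmf_sqint (bmf_vol bh).
by rewrite (pintB LZ) ?(pintZ LZ)//; exact: sqintZl.
Qed.

Let rint_cos (f : T -> R) th : measurable_fun setT f -> rint P (fun w => cos (f w + th)).
Proof.
move=> mf; apply: (rint_bounded P (M := 1)) => [|w]; last exact: cos_max.
apply: (measurableT_comp (continuous_measurable_fun (@continuous_cos R))).
exact: measurable_funD.
Qed.

Let chi_step th eps h q e : bmf h -> 0 <= eps <= 1 -> 4 * (eps * q) <= 1 ->
  Q h <= q -> Q (vol h) <= q -> \int[P]_w (pint X (vol h) w ^+ 2) <= e ->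
  `|chi th (euler eps h) - chi th h| <=
    eps ^+ 2 * (expR (q / 2) * (q / 2 + 18 * q ^+ 2 + 4 * e)).
Proof.
move=> bh /andP[eps0 eps1] eq1 Qq Bq Ye.
have Sh := bmf_sqint bh; have Sv := bmf_sqint (bmf_vol bh).
have SKh := sqint_pint LK Sh; have SKv := sqint_pint LK Sv.
have SXh := sqint_pint LX Sh; have SXv := sqint_pint LX Sv.
have q0 : 0 <= q by apply: le_trans Qq; apply: Rint_ge0 => s; exact: sqr_ge0.
pose A := \int[mu]_s (pint K h s * pint K (vol h) s).
pose B := Q (vol h).
pose c := \int[P]_w cos (pint X h w + th).
pose c' := \int[P]_w cos (pint X (euler eps h) w + th).
have B0 : 0 <= B by apply: Rint_ge0 => s; exact: sqr_ge0.
have Aq : `|A| <= q.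
  rewrite (le_trans (nrm_CS SKh SKv))// -[leRHS]sqr_sqrtr// expr2.
  apply: ler_pM (nrm_ge0 _ _) (nrm_ge0 _ _) _ _; [exact: ler_wsqrtr Qq|exact: ler_wsqrtr Bq].
have c1 : `|c| <= 1.
  apply: (ler_norm_Rint_bounded P) => [|w]; last exact: cos_max.
  exact: rint_measurable (rint_cos _ (sqint_measurable SXh)).
have QE : Q (euler eps h) = Q h - 2 * eps * A + eps ^+ 2 * B.
  rewrite /Q; under eq_Rintegral do rewrite (pint_euler _ _ LK bh).
  rewrite /A /B /Q -(RintZl (2 * eps) (sqintM SKh SKv)) -(RintZl (eps ^+ 2) SKv.2).
  rewrite -RintB; [|exact: SKh.2|by apply: rintZl; exact: sqintM].
  rewrite -RintD; [|apply: rintB; [exact: SKh.2|by apply: rintZl; exact: sqintM]|by apply: rintZl; exact: SKv.2].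
  by apply: eq_Rintegral => s _; ring.
(* [cos_taylor] at the increment - eps x_{Vh}: its linear term is evaluated by [ibp_functions], and
   its remainder is 2 eps^2 E x_{Vh}^2. *)
have r1 : `|c' - (c + eps * (c * A))| <= 2 * eps ^+ 2 * e.
  have Isin : rint P (fun w => sin (pint X h w + th) * pint X (vol h) w).
    apply: (rintMl (sqint_rint P SXv) _ (fun w => sin_max _)).
    apply: (measurableT_comp (continuous_measurable_fun (@continuous_sin R))).
    by apply: measurable_funD => //; exact: sqint_measurable SXh.
  have Ic := rint_cos th (sqint_measurable SXh).
  have Ic' := rint_cos th (sqint_measurable (sqint_pint LX (bmf_sqint (bmf_euler eps bh)))).
  rewrite /c /A -(ibp_functions LX LK fJ ibp_steps th bh) -(RintZl eps Isin).
  rewrite -RintD//; last exact: rintZl.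
  rewrite -RintB//; last by apply: rintD => //; exact: rintZl.
  rewrite (le_trans (ler_norm_Rint _))//.
    by apply: rintB => //; apply: rintD => //; exact: rintZl.
  apply: (@le_trans _ _ (2 * eps ^+ 2 * \int[P]_w (pint X (vol h) w ^+ 2))); last first.
    by rewrite ler_wpM2l// mulr_ge0// sqr_ge0.
  rewrite -RintZl; last exact: SXv.2.
  apply: le_Rint.
  - by apply: rint_abs; apply: rintB => //; apply: rintD => //; exact: rintZl.
  - by apply: rintZl; exact: SXv.2.
  move=> w; rewrite (pint_euler _ _ LX bh).
  have := cos_taylor (pint X h w + th) (- (eps * pint X (vol h) w)).
  by rewrite sqrrN exprMn !mulrA; apply: le_trans; rewrite le_eqVlt; apply/orP; left; apply/eqP;
    congr `|_|; rewrite (_ : pint X h w - _ + th = pint X h w + th - eps * pint X (vol h) w); ring.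
have e0 : 0 <= e by apply: le_trans Ye; apply: Rint_ge0 => w; exact: sqr_ge0.
have -> : chi th (euler eps h) - chi th h =
    expR (Q h / 2) * (c' * expR (- (eps * A) + eps ^+ 2 * B / 2) - c).
  rewrite /chi -/c -/c' QE mulrBr mulrCA -expRD [_ * c]mulrC; congr (_ * expR _ - _).
  by field.
rewrite normrM (gtr0_norm (expR_gt0 _)) mulrCA; apply: ler_pM => //.
  rewrite ler_expR; apply: ler_wpM2r; [by []|exact: Qq].
by apply: euler_step_bound => //; rewrite ?eps0 ?eps1 ?B0.
Qed.

Lemma pint_characteristic h th : bmf h ->
  \int[P]_w cos (pint X h w + th) * expR (Q h / 2) = cos th.
Proof.
move=> bh; rewrite -/(chi th h).
pose N0 := \int[mu]_t (h t ^+ 2); pose C := expR 1 * N0.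
pose q := C * esq mu K; pose e := C * esq P X.
pose D := expR (q / 2) * (q / 2 + 18 * q ^+ 2 + 4 * e).
(* With up to n = (m + 1)^3 steps of this size, the elapsed time n eps = m + 1 tends to infinity, as
   the decay of V h requires, while the accumulated error is of order n eps^2 = 1 / (m + 1). *)
pose eps m : R := m.+1%:R ^- 2.
have eps0 m : 0 < eps m by rewrite invr_gt0 exprn_gt0.
have eps_le m : eps m <= m.+1%:R^-1.
  by rewrite /eps exprS expr1 invfM ler_piMl// invf_le1// ler1n.
have C0 : 0 <= C by rewrite mulr_ge0 ?expR_ge0// Rint_ge0// => t; exact: sqr_ge0.
have q0 : 0 <= q by rewrite mulr_ge0// esq_ge0.
have e0 : 0 <= e by rewrite mulr_ge0// esq_ge0.
have D0 : 0 <= D.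
  apply: mulr_ge0; first exact: expR_ge0.
  by apply: addr_ge0; [apply: addr_ge0; [exact: divr_ge0|]|]; rewrite mulr_ge0 ?sqr_ge0.
have neps m : (m.+1 ^ 3)%:R * eps m ^+ 2 <= 1.
  rewrite /eps natrX -exprVn -exprM (_ : _ * _ = m.+1%:R^-1); last by field.
  by rewrite invf_le1// ler1n.
pose hs m k := iter k (euler (eps m)) h.
have hsC m k : (k <= m.+1 ^ 3)%N -> \int[mu]_t (hs m k t ^+ 2) <= C.
  exact: iter_euler_norm.
have bhs m k : bmf (hs m k) by exact: bmf_iter_euler.
have /choice[km kmP] m : exists k, (k < m.+1 ^ 3)%N /\
    \int[mu]_t (vol (hs m k) t ^+ 2) <= (2 * C + 1) / m.+1%:R.
  have [] := euler_small_vol bh (eps0 m) _ (neps m); first by rewrite expn_gt0.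
  move=> k kn Vk; exists k; split => //; apply: le_trans Vk _.
  by rewrite le_eqVlt; apply/orP; left; apply/eqP; rewrite -/N0 -/C /eps natrX; field.
(* The iterate at which V h is small; both [chi] at h and its limit cos th are reached along this
   sequence. *)
pose g m := hs m (km m).
have bg m : bmf (g m) by exact: bhs.
have gC m : \int[mu]_t (g m t ^+ 2) <= C by apply: hsC; exact: ltnW (kmP m).1.
have gv : nrm mu (vol (g m)) @[m --> \oo] --> (0 : R).
  apply: (@cvg0_sqrt_harmonic _ (2 * C + 1)) => m; first exact: nrm_ge0.
  by rewrite nrm_sqr; exact: (kmP m).2.
have cX := pint_weak_cvg LX bg gC gv.
have cK : Q (g m) @[m --> \oo] --> (0 : R) := pint_weak_cvg LK bg gC gv.
have QC h' : bmf h' -> \int[mu]_t (h' t ^+ 2) <= C -> Q h' <= q.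
  move=> bh' h'C; apply: le_trans (Rint_pint_sqr LK (bmf_sqint bh')) _.
  by rewrite ler_wpM2r ?esq_ge0.
have lim1 : chi th (g m) @[m --> \oo] --> chi th h.
  apply/cvgrPdist_le => a a0; near=> m.
  have m_eps : 4 * (eps m * q) <= 1.
    apply: (@le_trans _ _ (4 * (m.+1%:R^-1 * q))).
      by rewrite ler_pM2l// ler_wpM2r.
    rewrite mulrCA ler_pdivrMl// mulr1.
    rewrite (le_trans (y := m%:R)) ?ler_nat//.
    by near: m; exact: nbhs_infty_ger.
  have step k : (k <= m.+1 ^ 3)%N -> `|chi th (hs m k) - chi th h| <= k%:R * (eps m ^+ 2 * D).
    elim: k => [_|k ih kn]; first by rewrite subrr normr0 mul0r.
    apply: le_trans (ler_distD (chi th (hs m k)) _ _) _.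
    rewrite -[k.+1%:R]natr1 mulrDl mul1r addrC; apply: lerD.
      by apply: ih; exact: ltnW.
    have hk := hsC m k (ltnW kn); have bk := bhs m k.
    have vk := le_trans (Rint_vol_sqr_le bk) hk.
    apply: (chi_step th bk _ m_eps).
    - by rewrite (ltW (eps0 m))/= (le_trans (eps_le m))// invf_le1// ler1n.
    - exact: QC.
    - by apply: QC => //; exact: bmf_vol.
    - apply: le_trans (Rint_pint_sqr LX (bmf_sqint (bmf_vol bk))) _.
      by rewrite ler_wpM2r ?esq_ge0.
  rewrite distrC (le_trans (step _ (ltnW (kmP m).1)))//.
  apply: (@le_trans _ _ (D / m.+1%:R)).
    apply: (@le_trans _ _ ((m.+1 ^ 3)%:R * (eps m ^+ 2 * D))).
      apply: ler_wpM2r; first by apply: mulr_ge0 => //; exact: sqr_ge0.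
      by rewrite ler_nat (ltnW (kmP m).1).
    by rewrite le_eqVlt; apply/orP; left; apply/eqP; rewrite /eps natrX; field.
  rewrite ler_pdivrMr// -ler_pdivrMl//.
  rewrite (le_trans (y := m%:R)) ?ler_nat//.
  by near: m; exact: nbhs_infty_ger.
have lim2 : chi th (g m) @[m --> \oo] --> cos th.
  rewrite -[X in _ --> X]mulr1 -expR0 -[X in expR X](mul0r (2^-1)); apply: cvgM; last first.
    have cQ : Q (g m) / 2 @[m --> \oo] --> (0 / 2 : R) by apply: cvgM => //; exact: cvg_cst.
    exact: (cvg_comp _ _ cQ (@continuous_expR R _)).
  have sX : Num.sqrt (\int[P]_w (pint X (g m) w ^+ 2)) @[m --> \oo] --> (0 : R).
    rewrite -[X in _ --> X](@sqrtr0 R).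
    exact: (cvg_comp _ _ cX (@sqrt_continuous R _)).
  apply/cvgrPdist_le => a a0; have H := cvgr0_norm_le _ sX _ a0; near=> m.
  apply: (@le_trans _ _ `|Num.sqrt (\int[P]_w (pint X (g m) w ^+ 2))|); last by near: m; exact: H.
  have Sg := sqint_pint LX (bmf_sqint (bg m)).
  rewrite [leRHS]ger0_norm ?sqrtr_ge0// distrC (le_trans _ (Rint_abs_sqr P Sg))//.
  rewrite -[cos th](Rint_cst P) -RintB; [|exact: rint_cos (sqint_measurable Sg)|exact: rint_cst].
  have Id : rint P (fun w => cos (pint X (g m) w + th) - cos th).
    by apply: rintB; [exact: rint_cos (sqint_measurable Sg)|exact: rint_cst].
  rewrite (le_trans (ler_norm_Rint Id))//; apply: le_Rint; first exact: rint_abs.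
    by apply: rint_abs; exact: (sqint_rint P).
  by move=> w; rewrite (le_trans (cos_lipschitz _ _))// addrK.
exact: (cvg_unique _ lim1 lim2).
Unshelve. all: by end_near. Qed.

End euler_limit.

(** * From the integration by parts identity to Gaussian laws *)

Section characteristic_law.
Context d (T : measurableType d) (R : realType) (P : probability T R).
Variables (Q : probability (measurableTypeR R) R) (U : T -> R).
Hypothesis mU : measurable_fun setT U.
Hypothesis cosU : forall c th : R,
  \int[P]_w cos (c * U w + th) = \int[Q]_x cos (c * x + th).

(** Twice the positive part of x - a. *)
Let pos (a x : R) : R := (x - a) + `|x - a|.

(** Bounded continuous functions tending at every point, a included, to the indicator of the open
    ray above a. *)
Let ramp (a : R) n (x : R) : R := 1 - expR (- (n%:R * pos a x)).

Let pos_ge0 a x : 0 <= pos a x.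
Proof. by rewrite /pos; have := ler_norm (- (x - a)); rewrite normrN; lra. Qed.

Let continuous_ramp a n : continuous (ramp a n).
Proof.
have cx : continuous (fun x : R => x - a) by apply: contB; [move=> x; exact: cvg_id|exact: cont_cst].
apply: contB; first exact: cont_cst.
have cp : continuous (fun x : R => n%:R * pos a x).
  apply: contM; first exact: cont_cst.
  by apply: contD => // x; exact: (cvg_comp _ _ (cx x) (@norm_continuous _ R _)).
apply: (cont_comp (g := @expR R) (f := fun x => - (n%:R * pos a x))).
  by move=> x; apply: cvgN; exact: cp.
exact: continuous_expR.
Qed.

Let ramp_le1 a n x : `|ramp a n x| <= 1.
Proof.
have : 0 <= n%:R * pos a x by rewrite mulr_ge0.
rewrite -oppr_le0 -ler_expR expR0 => e1; have e0 := expR_gt0 (- (n%:R * pos a x)).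
by rewrite /ramp ger0_norm; lra.
Qed.

Let ramp_cvg a x : ramp a n x @[n --> \oo] --> (\1_(`]a, +oo[%classic) x : R).
Proof.
rewrite indicE; have [ax|xa] := ltP a x; last first.
  rewrite memNset/=; last by rewrite in_itv/= andbT; apply/negP; rewrite -leNgt.
  rewrite (_ : ramp a ^~ x = fun=> 0); first exact: cvg_cst.
  by apply/funext => n; rewrite /ramp /pos ler0_norm ?subr_le0// subrr mulr0 oppr0 expR0 subrr.
rewrite mem_set/=; last by rewrite in_itv/= ax.
have p0 : 0 < pos a x by rewrite /pos gtr0_norm ?subr_gt0// addr_gt0 ?subr_gt0.
apply/cvgrPdist_le => e e0; near=> n.
have np : e^-1 / pos a x <= n%:R by near: n; exact: nbhs_infty_ger.
have {}np : e^-1 <= n%:R * pos a x by rewrite -ler_pdivrMr.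
rewrite /ramp opprB addrC subrK gtr0_norm ?expR_gt0// expRN -[leRHS]invrK.
rewrite lef_pV2 ?posrE ?expR_gt0 ?invr_gt0//.
by apply: le_trans (expR_ge1Dx _); lra.
Unshelve. all: by end_near. Qed.

Let ramp_eq a n : \int[P]_w ramp a n (U w) = \int[Q]_x ramp a n x.
Proof.
pose xi w : 'rV[R]_1 := \row_(_ < 1) U w.
pose eta (x : measurableTypeR R) : 'rV[R]_1 := \row_(_ < 1) x.
have mxi i : measurable_fun setT (fun w => xi w 0 i).
  by under eq_fun do rewrite mxE; exact: mU.
have meta i : measurable_fun setT (fun x => eta x 0 i).
  by under eq_fun do rewrite mxE; exact: measurable_id.
pose G (v : 'rV[R]_1) := ramp a n (v 0 0).
have cG : continuous G by apply: cont_comp => //; exact: coord_continuous.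
have cos_eq (b : 'I_1 -> R) th :
    \int[P]_w cos (\sum_i b i * xi w 0 i + th) = \int[Q]_w cos (\sum_i b i * eta w 0 i + th).
  under eq_Rintegral do rewrite big_ord1 mxE.
  under [RHS]eq_Rintegral do rewrite big_ord1 mxE.
  exact: cosU.
have := @eq_Rint_of_eq_cos _ _ _ _ _ _ P Q xi eta mxi meta cos_eq G 1 0 cG.
rewrite /G /xi /eta; under eq_Rintegral do rewrite mxE.
under [X in _ -> _ -> _ -> _ = X]eq_Rintegral do rewrite mxE.
apply.
- by move=> x; rewrite expr0 mulr1.
- by under eq_fun do rewrite expr0; exact: rint_cst.
- by under eq_fun do rewrite expr0; exact: rint_cst.
Qed.

(** Open rays are stable under intersection and generate the Borel sets; their probabilities are
    limits of expectations of [ramp]. *)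
Lemma law_of_eq_cos (A : set (measurableTypeR R)) : measurable A -> P (U @^-1` A) = Q A.
Proof.
move=> mA; pose mixU := @isMeasurableFun.Build _ _ T (measurableTypeR R) U mU.
pose V : {mfun T >-> measurableTypeR R} := HB.pack (U : T -> measurableTypeR R) mixU.
have ray (a : R) : distribution P V `]a, +oo[%classic = Q `]a, +oo[%classic.
  rewrite /distribution /pushforward; have mr : measurable (`]a, +oo[%classic : set (measurableTypeR R)) by [].
  have mUr : measurable (U @^-1` `]a, +oo[%classic) by rewrite -[X in measurable X]setTI; exact: mU.
  rewrite -(setIT (U @^-1` _)) -[in RHS](setIT `]a, +oo[%classic) -!integral_indic//.
  have mR n := continuous_measurable_fun (@continuous_ramp a n).
  have [I1 c1] := @Rint_cvg _ _ _ P (fun n w => ramp a n (U w)) (fun w => \1_(`]a, +oo[%classic) (U w)) (fun=> 1)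
    (fun n => measurableT_comp (mR n) mU) (rint_cst P 1) (fun n w => ramp_le1 a n _) (fun w => @ramp_cvg a _).
  have [I2 c2] := @Rint_cvg _ _ _ Q (fun n w => ramp a n w) _ (fun=> 1)
    mR (rint_cst Q 1) (fun n w => ramp_le1 a n _) (fun w => @ramp_cvg a _).
  rewrite (funext (@ramp_eq a)) in c1.
  have E : \int[P]_w (\1_(`]a, +oo[%classic) (U w) : R) = \int[Q]_x (\1_(`]a, +oo[%classic) x : R).
    exact: (cvg_unique _ c1 c2).
  transitivity (\int[P]_w (\1_(`]a, +oo[%classic) (U w) : R))%:E.
    by rewrite (EFin_Rint I1).
  exact: (etrans (congr1 EFin E) (EFin_Rint I2)).
have := @measure_unique _ R (measurableTypeR R) (@RGenOInfty.G R)
  (fun n => `](- n%:R : R), +oo[%classic) (RGenOInfty.measurableE R) _ _ _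
  (distribution P V) Q _ _ A mA.
apply.
- move=> _ _ [a ->] [b ->]; exists (Num.max a b).
  by apply/seteqP; split => x /=; rewrite !in_itv/= !andbT gt_max => /andP.
- by move=> n; exists (- n%:R).
- apply/seteqP; split => // x _; have [n xn] : exists n, `|x| < n%:R.
    by exists (Num.truncn `|x|).+1; exact: truncnS_gt.
  by exists n => //=; rewrite in_itv/= andbT; move: xn; rewrite ltr_norml => /andP[].
- by move=> _ [a ->]; exact: ray.
- by move=> n; rewrite [ltLHS]ray (le_lt_trans (probability_le1 _ _)) ?ltry.
Qed.

End characteristic_law.

(** * Normal laws and covariances at almost every time *)

Section gaussian_limit.
Context d (T : measurableType d) (R : realType) (P : probability T R).
Local Notation tR := (measurableTypeR R).
Local Notation mu := (@leb01 R).
Variables (X : tR * T -> R) (K : tR * tR -> R) (J : set R).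
Hypothesis LX : L2proc P X.
Hypothesis LK : L2proc mu K.
Hypothesis fJ : full_times J.
Hypothesis ibp_steps : forall (th : R) (e : seq (R * R)),
  (forall p, p \in e -> J p.2) ->
  \int[P]_w (sin (psum X e w + th) * pint X (psum (@Zvol R) e) w) =
  \int[P]_w cos (psum X e w + th) * \int[mu]_s (psum K e s * pint K (psum (@Zvol R) e) s).

(** The pair (f, k) is a limit of pairs (x_h, k_h) with a common h, so that relations between the
    law of x_h and the norm of k_h pass to it. *)
Definition pint_closure (f : T -> R) (k : tR -> R) := forall eta, 0 < eta ->
  exists h, [/\ bmf h, nrm P (fun w => f w - pint X h w) <= eta &
    nrm mu (fun s => k s - pint K h s) <= eta].

(** The averaging errors of X and K are added so that one radius serves both. Their integral over
    time tends to 0, so by Markov's inequality the set [B j] of times whose error exceeds 1 / (j +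
    1) at every radius is null. Off these sets some radius is good for each tolerance, which is less
    than convergence along all radii but enough for the closure. *)
Lemma pint_closure_times : exists I : set R, full_times I /\
  forall u, I u -> pint_closure (fun w => X (u, w)) (fun s => K (u, s)).
Proof.
pose f r u := avg_err P X r u + avg_err mu K r u.
have If r : rint mu (f r) by apply: rintD; exact: rint_avg_err.
have f0 r u : 0 <= f r u by rewrite addr_ge0 ?avg_err_ge0.
have cf : \int[mu]_u f r u @[r --> \oo] --> (0 : R).
  rewrite -[X in _ --> X]addr0.
  rewrite (_ : (fun r => \int[mu]_u f r u) = fun r => \int[mu]_u avg_err P X r u + \int[mu]_u avg_err mu K r u).
    by apply: cvgD; exact: avg_err_cvg.
  by apply/funext => r; rewrite RintD//; exact: rint_avg_err.
pose B j := \bigcap_(r in [set: nat]) (f r @^-1` `](j.+1%:R^-1 : R), +oo[%classic : set tR).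
have mB j : measurable (B j).
  apply: bigcapT_measurable => r; rewrite -[X in measurable X]setTI.
  exact: (rint_measurable (If r)).
have B0 j : mu (B j) = 0%E.
  have fB : mu (B j) \is a fin_num by exact: fin_num_measure.
  apply/eqP; rewrite -(fineK fB) eqe eq_le fine_ge0// andbT.
  have c0 : 0 < j.+1%:R^-1 :> R by rewrite invr_gt0.
  have IB : rint mu (fun u => \1_(B j) u : R).
    apply: (rint_bounded mu (M := 1)); first exact: measurable_indic.
    by move=> u; rewrite ger0_norm indicE ?lern1 ?leq_b1.
  have le_f r : j.+1%:R^-1 * fine (mu (B j)) <= \int[mu]_u f r u.
    rewrite -Rint_indic// -RintZl//; apply: le_Rint => //; first exact: rintZl.
    move=> u; rewrite indicE; case: (boolP (u \in B j)) => uB; last by rewrite mulr0.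
    by rewrite mulr1; have /set_mem/(_ r I) := uB; rewrite /= in_itv/= andbT => /ltW.
  rewrite leNgt; apply/negP => m0; have cm : 0 < j.+1%:R^-1 * fine (mu (B j)) by exact: mulr_gt0.
  have [r _ H] := cvgr_lt _ cf _ cm.
  by have := lt_le_trans (H r (leqnn r)) (le_f r); rewrite ltxx.
exists (`[0, 1]%classic `\` \bigcup_j B j); split; first split.
- by move=> u [].
- rewrite setDE setCI setCK; apply: negligibleU; last first.
    by apply: negligible_bigcup => j; exists (B j); split; [exact: mB|exact: B0|].
  exists (~` `[0%R, 1%R]%classic); split => //; first exact: measurableC.
  transitivity (@lebesgue_measure R (~` `[0%R, 1%R]%classic `&` `[0%R, 1%R]%classic)) => //.
  by rewrite setICl measure0.
move=> u [_ nB] eta eta0.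
have [j jeta] : exists j : nat, j.+1%:R^-1 <= eta ^+ 2.
  exists (Num.truncn (eta ^- 2)).
  rewrite -[leRHS]invrK lef_pV2 ?posrE ?invr_gt0 ?exprn_gt0//.
  by rewrite ltW// truncnS_gt.
have [r fr] : exists r, f r u <= j.+1%:R^-1.
  apply: contrapT => nr; apply: nB; exists j => // r _ /=.
  by rewrite in_itv/= andbT ltNge; apply/negP => fr; apply: nr; exists r.
exists (fun s => ker r (u, s)); split; first exact: bmf_ker.
  apply: nrm_le; first exact: ltW.
  by apply: le_trans jeta; apply: le_trans fr; rewrite /f lerDl avg_err_ge0.
apply: nrm_le; first exact: ltW.
by apply: le_trans jeta; apply: le_trans fr; rewrite /f lerDr avg_err_ge0.
Qed.

Lemma nrmZ d' (T' : measurableType d') (P' : probability T' R) (c : R) f :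
  sqint P' f -> nrm P' (fun x => c * f x) = `|c| * nrm P' f.
Proof.
move=> [mf If]; rewrite /nrm; under eq_Rintegral do rewrite exprMn.
by rewrite RintZl// sqrtrM ?sqr_ge0// sqrtr_sqr.
Qed.

Lemma pint_closure_psum e :
  (forall p, p \in e -> pint_closure (fun w => X (p.2, w)) (fun s => K (p.2, s))) ->
  pint_closure (psum X e) (psum K e).
Proof.
elim: e => [_ eta eta0|[a u] e ih IH eta eta0].
  exists (fun=> 0); split; first exact: bmf_cst.
    apply: nrm_le; first exact: ltW.
    rewrite (_ : (fun w => _) = fun=> 0) ?Rint0 ?sqr_ge0//; apply/funext => w.
    rewrite /psum big_nil /pint; under eq_Rintegral do rewrite mul0r.
    by rewrite Rint0 subrr expr0n.
  apply: nrm_le; first exact: ltW.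
  rewrite (_ : (fun w => _) = fun=> 0) ?Rint0 ?sqr_ge0//; apply/funext => w.
  rewrite /psum big_nil /pint; under eq_Rintegral do rewrite mul0r.
  by rewrite Rint0 subrr expr0n.
have [h2 [b2 X2 K2]] : exists h, [/\ bmf h, nrm P (fun w => psum X e w - pint X h w) <= eta / 2 &
    nrm mu (fun s => psum K e s - pint K h s) <= eta / 2].
  by apply: ih; rewrite ?divr_gt0// => p pe; apply: IH; rewrite inE pe orbT.
have a0 : 0 < 2 * (`|a| + 1) by rewrite mulr_gt0// ltr_wpDl.
have [h1 [b1 X1 K1]] : exists h, [/\ bmf h,
    nrm P (fun w => X (u, w) - pint X h w) <= eta / (2 * (`|a| + 1)) &
    nrm mu (fun s => K (u, s) - pint K h s) <= eta / (2 * (`|a| + 1))].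
  by apply: (IH (a, u)); rewrite ?mem_head// divr_gt0.
have bah : bmf (fun t => a * h1 t) by apply: bmfM => //; exact: bmf_cst.
have close d' (T' : measurableType d') (P' : probability T' R) (Z : tR * T' -> R) :
    L2proc P' Z -> nrm P' (fun w => Z (u, w) - pint Z h1 w) <= eta / (2 * (`|a| + 1)) ->
    nrm P' (fun w => psum Z e w - pint Z h2 w) <= eta / 2 ->
    nrm P' (fun w => psum Z ((a, u) :: e) w - pint Z (fun t => a * h1 t + h2 t) w) <= eta.
  move=> LZ Z1 Z2; have [_ _ Zt _] := LZ.
  have S1 : sqint P' (fun w => Z (u, w) - pint Z h1 w).
    by apply: sqintB => //; exact: (sqint_pint LZ (bmf_sqint b1)).
  have S2 : sqint P' (fun w => psum Z e w - pint Z h2 w).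
    by apply: sqintB; [exact: sqint_psum|exact: (sqint_pint LZ (bmf_sqint b2))].
  rewrite (_ : (fun w => _) = fun w => a * (Z (u, w) - pint Z h1 w) + (psum Z e w - pint Z h2 w)).
    apply: le_trans (nrmD (sqintZl a S1) S2) _; rewrite (@nrmZ _ _ P' a _ S1).
    rewrite [leRHS]splitr; apply: lerD => //.
    apply: le_trans (ler_wpM2l (normr_ge0 a) Z1) _.
    rewrite mulrA ler_pdivrMr// (_ : _ * (2 * _) = `|a| * eta + eta); last by field.
    by rewrite lerDl ltW.
  apply/funext => w; rewrite /psum big_cons/= (pintD LZ); [|exact: bmf_sqint|exact: bmf_sqint].
  by rewrite (pintZ LZ)//; [ring|exact: bmf_sqint].
exists (fun t => a * h1 t + h2 t); split; first exact: bmfD.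
  exact: close.
exact: close.
Qed.

Lemma psum_characteristic e th : pint_closure (psum X e) (psum K e) ->
  \int[P]_w cos (psum X e w + th) * expR (\int[mu]_s (psum K e s ^+ 2) / 2) = cos th.
Proof.
move=> cl; have /choice[g gP] n : exists h, [/\ bmf h,
    nrm P (fun w => psum X e w - pint X h w) <= n.+1%:R^-1 &
    nrm mu (fun s => psum K e s - pint K h s) <= n.+1%:R^-1].
  by apply: cl; rewrite invr_gt0.
have bg n : bmf (g n) by have [] := gP n.
have c0 (v : nat -> R) : (forall n, 0 <= v n) -> (forall n, v n <= n.+1%:R^-1) ->
    v n @[n --> \oo] --> (0 : R).
  move=> v0 vn; apply: (@cvg0_sqrt_harmonic _ 1) => // n; rewrite mul1r.
  apply: le_trans (vn n); rewrite expr2 ler_piMl// (le_trans (vn n))//.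
  by rewrite invf_le1// ler1n.
have nrmC d' (T' : measurableType d') (P' : probability T' R) (f k : T' -> R) :
    nrm P' (fun x => f x - k x) = nrm P' (fun x => k x - f x).
  by congr Num.sqrt; apply: eq_Rintegral => x _; rewrite -sqrrN opprB.
have cX : nrm P (fun w => pint X (g n) w - psum X e w) @[n --> \oo] --> (0 : R).
  by apply: c0 => n; [exact: nrm_ge0|rewrite nrmC; have [] := gP n].
have cK : nrm mu (fun s => pint K (g n) s - psum K e s) @[n --> \oo] --> (0 : R).
  by apply: c0 => n; [exact: nrm_ge0|rewrite nrmC; have [] := gP n].
have SX := sqint_psum e LX; have SK := sqint_psum e LK.
have SXg n := sqint_pint LX (bmf_sqint (bg n)).
have SKg n := sqint_pint LK (bmf_sqint (bg n)).
have lim1 := inner_cvg SKg SKg SK SK cK cK.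
have Scos f : sqint P f -> sqint P (fun w => cos (f w + th)).
  move=> Sf; apply: (sqint_bounded P _ (fun w => cos_max (f w + th))).
  apply: (measurableT_comp (continuous_measurable_fun (@continuous_cos R))).
  by apply: measurable_funD => //; exact: sqint_measurable Sf.
have lim2 : \int[P]_w cos (pint X (g n) w + th) @[n --> \oo] --> \int[P]_w cos (psum X e w + th).
  apply/cvgrPdist_le => a a0; have H := cvgr0_norm_le _ cX _ a0; near=> n.
  have : `|nrm P (fun w => pint X (g n) w - psum X e w)| <= a by near: n; exact: H.
  apply: le_trans; rewrite [leRHS]ger0_norm ?nrm_ge0// distrC.
  have S1 := Scos _ (SXg n); have S2 := Scos _ SX.
  rewrite -RintB; [|exact: (sqint_rint P S1)|exact: (sqint_rint P S2)].
  have Sd := sqintB (SXg n) SX.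
  apply: le_trans (Rint_abs_sqr P Sd).
  apply: le_trans (ler_norm_Rint (sqint_rint P (sqintB S1 S2))) _.
  apply: le_Rint; [exact: (rint_abs (sqint_rint P (sqintB S1 S2)))|exact: (rint_abs (sqint_rint P Sd))|].
  move=> w; apply: le_trans (cos_lipschitz _ _) _.
  by rewrite opprD addrACA subrr addr0.
pose A n := \int[mu]_s (pint K (g n) s * pint K (g n) s).
pose A0 := \int[mu]_s (psum K e s * psum K e s).
have l1 : A n / 2 @[n --> \oo] --> A0 / 2 by apply: cvgM; [exact: lim1|exact: cvg_cst].
have l2 : expR (A n / 2) @[n --> \oo] --> expR (A0 / 2) := cvg_comp _ _ l1 (@continuous_expR R _).
have lim3 : \int[P]_w cos (pint X (g n) w + th) * expR (A n / 2)
    @[n --> \oo] --> \int[P]_w cos (psum X e w + th) * expR (A0 / 2) by exact: cvgM.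
rewrite (_ : (fun n => _) = fun=> cos th) in lim3; last first.
  by apply/funext => n; rewrite -(pint_characteristic LX LK fJ ibp_steps th (bg n)).
exact: (cvg_unique _ lim3 (cvg_cst (cos th))).
Unshelve. all: by end_near. Qed.

(** The closure is stable under scaling [e], which provides the characteristic function at every
    frequency c; [law_of_eq_cos] then identifies the law, with the Dirac mass as target when the
    norm of [psum K e] is 0. *)
Lemma psum_law e : pint_closure (psum X e) (psum K e) ->
  normal_law P (psum X e) (nrm mu (psum K e)).
Proof.
move=> cl.
have SX := sqint_psum e LX; have SK := sqint_psum e LK.
pose ce (c : R) : seq (R * R) := [seq (c * p.1, p.2) | p <- e].
have psumZ d' (T' : measurableType d') (Z : tR * T' -> R) c w : psum Z (ce c) w = c * psum Z e w.
  by rewrite /psum big_map mulr_sumr; apply: eq_bigr => p _; rewrite mulrA.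
have cZ c : pint_closure (psum X (ce c)) (psum K (ce c)).
  move=> eta eta0; have a0 : 0 < `|c| + 1 by rewrite ltr_wpDl.
  have [h [bh Xh Kh]] := cl (eta / (`|c| + 1)) (divr_gt0 eta0 a0).
  have close d' (T' : measurableType d') (P' : probability T' R) (Z : tR * T' -> R) :
      L2proc P' Z -> nrm P' (fun w => psum Z e w - pint Z h w) <= eta / (`|c| + 1) ->
      nrm P' (fun w => psum Z (ce c) w - pint Z (fun t => c * h t) w) <= eta.
    move=> LZ Zh; have Sh := bmf_sqint bh.
    rewrite (_ : (fun w => _) = fun w => c * (psum Z e w - pint Z h w)); last first.
      by apply/funext => w; rewrite psumZ (pintZ LZ)// mulrBr.
    have Sd : sqint P' (fun w => psum Z e w - pint Z h w).
      by apply: sqintB; [exact: sqint_psum|exact: (sqint_pint LZ Sh)].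
    rewrite (@nrmZ _ _ P' c _ Sd).
    apply: le_trans (ler_wpM2l (normr_ge0 c) Zh) _.
    rewrite mulrCA ler_piMr ?(ltW eta0)// ler_pdivrMr// mul1r lerDl//.
  exists (fun t => c * h t); split; [|exact: close|exact: close].
  by apply: bmfM => //; exact: bmf_cst.
set s := nrm mu (psum K e).
have char c th : \int[P]_w cos (c * psum X e w + th) = cos th * expR (- (c ^+ 2 * s ^+ 2 / 2)).
  have := psum_characteristic th (cZ c).
  under eq_Rintegral do rewrite psumZ.
  have -> : \int[mu]_x (psum K (ce c) x ^+ 2) = c ^+ 2 * s ^+ 2.
    rewrite nrm_sqr -RintZl; last exact: SK.2.
    by apply: eq_Rintegral => x _; rewrite psumZ exprMn.
  by move=> <-; rewrite -[RHS]mulrA expRN divff ?mulr1// gt_eqF// expR_gt0.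
move=> A mA; rewrite /centered_normal; case: ifPn => [/eqP s0|s0].
  apply: (law_of_eq_cos (Q := (\d_(0 : tR) : probability _ R)) (sqint_measurable SX)) => // c th.
  rewrite char s0 expr0n/= mulr0 mul0r oppr0 expR0 mulr1.
  rewrite /Rintegral integral_dirac// ?diracT ?mul1e/= ?mulr0 ?add0r//.
  apply/measurable_EFinP.
  apply: (measurableT_comp (continuous_measurable_fun (@continuous_cos R))).
  by apply: measurable_funD => //; exact: measurable_funM.
apply: (law_of_eq_cos (Q := (normal_prob 0 s : probability _ R)) (sqint_measurable SX)) => // c th.
by rewrite char (Rint_normal_cos s0 c th).
Qed.

Lemma psum_isometry e : pint_closure (psum X e) (psum K e) ->
  \int[P]_w (psum X e w ^+ 2) = \int[mu]_s (psum K e s ^+ 2).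
Proof.
move=> cl; rewrite -[RHS]nrm_sqr.
by have [_ -> _] := normal_law_facts (sqint_measurable (sqint_psum e LX)) (psum_law cl).
Qed.

(** Polarisation of [psum_isometry] over the two lists representing the sum and the difference. *)
Lemma pint_closure_covariance t s :
  pint_closure (fun w => X (t, w)) (fun u => K (t, u)) ->
  pint_closure (fun w => X (s, w)) (fun u => K (s, u)) ->
  \int[P]_w (X (t, w) * X (s, w)) = \int[mu]_u (K (t, u) * K (s, u)).
Proof.
move=> ct cs.
have cl (b : R) : pint_closure (psum X [:: (1, t); (b, s)]) (psum K [:: (1, t); (b, s)]).
  by apply: pint_closure_psum => p; rewrite !inE => /orP[]/eqP->.
have E d' (T' : measurableType d') (P' : probability T' R) (Z : tR * T' -> R) : L2proc P' Z ->
    \int[P']_w (Z (t, w) * Z (s, w)) =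
    (\int[P']_w (psum Z [:: (1, t); (1, s)] w ^+ 2) - \int[P']_w (psum Z [:: (1, t); (-1, s)] w ^+ 2)) / 4.
  move=> LZ; have S1 := sqint_psum [:: (1, t); (1, s)] LZ.
  have S2 := sqint_psum [:: (1, t); (-1, s)] LZ.
  rewrite -RintB; [|exact: S1.2|exact: S2.2].
  rewrite -RintZr; last by apply: rintB; [exact: S1.2|exact: S2.2].
  by apply: eq_Rintegral => w _; rewrite /psum !big_cons !big_nil/=; field.
by rewrite (E _ _ P X)// (E _ _ mu K)// !psum_isometry.
Qed.

End gaussian_limit.

(** * Versions with square integrable sections *)

Section regularization.
Context d (T : measurableType d) (R : realType) (P : probability T R).
Local Notation tR := (measurableTypeR R).
Local Notation mu := (@leb01 R).

(** By Fubini the bad times and the bad paths form null sets N and M; the version is 0 on both. At a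
    time off N it differs from Z only on M, and along a path off M only at times in N. *)
Lemma L2proc_version (Z : tR * T -> R) : sqint (mu \x P)%E Z ->
  exists Z' (F : set R), [/\ L2proc P Z', mu.-negligible (~` F),
    forall t, F t -> {ae P, forall w, Z' (t, w) = Z (t, w)} &
    {ae P, forall w, {ae mu, forall t, Z' (t, w) = Z (t, w)}}].
Proof.
move=> SZ; have [mZ IZ] := SZ.
have [N [mN N0 NZ]] : {ae mu, forall t, rint P (fun w => Z (t, w) ^+ 2)} by exact: ae_integrable1 IZ.
have [M [mM M0 MZ]] : {ae P, forall w, rint mu (fun t => Z (t, w) ^+ 2)} by exact: ae_integrable2 IZ.
have nN t : ~ N t -> rint P (fun w => Z (t, w) ^+ 2) by move=> Nt; apply: contrapT => h; exact/Nt/NZ.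
have nM w : ~ M w -> rint mu (fun t => Z (t, w) ^+ 2) by move=> Mw; apply: contrapT => h; exact/Mw/MZ.
have i1 (U : Type) (A : set U) x : `|\1_A x : R| <= 1.
  by rewrite indicE ger0_norm// lern1 leq_b1.
pose Z' (p : tR * T) : R := \1_(~` N) p.1 * (\1_(~` M) p.2 * Z p).
have mI1 : measurable_fun setT (\1_(~` N) : tR -> R) by apply: measurable_indic; exact: measurableC.
have mI2 : measurable_fun setT (\1_(~` M) : T -> R) by apply: measurable_indic; exact: measurableC.
have mZt t : measurable_fun setT (fun w => Z (t, w)) by exact: (measurableT_comp mZ (measurable_pair1 t)).
have mZw w : measurable_fun setT (fun t => Z (t, w)) by exact: (measurableT_comp mZ (measurable_pair2 w)).
have SZ' : sqint (mu \x P)%E Z'.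
  apply: (sqintMl _ (measurableT_comp mI1 measurable_fst) (fun p => i1 _ _ p.1)).
  exact: (sqintMl SZ (measurableT_comp mI2 measurable_snd) (fun p => i1 _ _ p.2)).
exists Z', (~` N); split.
- split; first exact: SZ'.1.
  + move=> w; rewrite /Z'/=; apply: (sqintMl _ mI1 (fun t => i1 _ _ t)).
    have [Mw|Mw] := pselect (M w).
      rewrite indicE memNset; last by move=> /(_ Mw).
      by under eq_fun do rewrite mul0r; exact: sqint0.
    by apply: sqintZl; split => //; exact: nM.
  + move=> t; rewrite /Z'/=; have [Nt|Nt] := pselect (N t).
      rewrite indicE memNset; last by move=> /(_ Nt).
      by under eq_fun do rewrite mul0r; exact: sqint0.
    apply: sqintZl; apply: (sqintMl _ mI2 (fun w => i1 _ _ w)).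
    by split => //; exact: nN.
  + exact: SZ'.
- by rewrite setCK; exists N; split.
- move=> t Nt; exists M; split => // w /= nE; apply: contrapT => Mw; apply: nE.
  by rewrite /Z'/= !indicE !mem_set// !mul1r.
- exists M; split => // w /= nE; apply: contrapT => Mw; apply: nE.
  exists N; split => // t /= nE; apply: contrapT => Nt; apply: nE.
  by rewrite /Z'/= !indicE !mem_set// !mul1r.
Qed.

End regularization.

(** * Trigonometric functionals *)

Section trigonometric_functional.
Variables (R : realType) (th : R).

(** A two-parameter family closed under differentiation, (a, b) becoming (b, - a), so that
    derivatives of all orders are handled at once. *)
Definition trig (a b : R) (z : 'rV[R]_1) : R := a * cos (z 0 0 + th) + b * sin (z 0 0 + th).

Let phi (a b x : R) : R := a * cos (x + th) + b * sin (x + th).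

Let is_derive_phi a b (x : R) : is_derive x (1 : R) (phi a b) (phi b (- a) x).
Proof.
have d0 : is_derive (x : R) (1 : R) (fun y : R => y + th) (1 : R).
  by refine (is_derive_eq (is_deriveD (is_derive_id _ _) (is_derive_cst _ _ _)) _); rewrite addr0.
have dc := @is_derive1_comp _ cos (fun y => y + th) _ _ _ (is_derive_cos (x + th)) d0.
have ds := @is_derive1_comp _ sin (fun y => y + th) _ _ _ (is_derive_sin (x + th)) d0.
refine (is_derive_eq (is_deriveD (is_deriveZ a dc) (is_deriveZ b ds)) _).
by rewrite /phi /GRing.scale/=; ring.
Qed.

Lemma differentiable_trig a b z : differentiable (trig a b) z.
Proof.
have dp : differentiable (phi a b) (z 0 0).
  by apply/derivable1_diffP; have := is_derive_phi a b (z 0 0) => -[].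
exact: (differentiable_comp (differentiable_coord z 0 0) dp).
Qed.

Lemma partial_trig k a b : partial k (trig a b) = trig b (- a).
Proof.
apply/funext => z; have [_ E] := is_derive_phi a b (z 0 0).
rewrite -[RHS]/(phi b (- a) (z 0 0)) -E.
have FE : (fun h : R => h^-1 *: (trig a b (h *: delta_mx 0 k + z) - trig a b z)) =
    (fun h : R => h^-1 *: (phi a b (h *: (1 : R) + z 0 0) - phi a b (z 0 0))).
  by apply/funext => h; rewrite /trig !mxE [k]ord1 !eqxx.
by rewrite /partial /derive FE.
Qed.

Lemma Cpinf_trig a b : Cpinf (trig a b).
Proof.
move=> ks /=.
have [a' [b' ->]] : exists a' b', foldr (@partial R 1) (trig a b) ks = trig a' b'.
  elim: ks => [|k ks [a' [b' ih]]]; first by exists a, b.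
  by exists b', (- a'); rewrite /= ih partial_trig.
split; first exact: differentiable_trig.
exists (`|a'| + `|b'|), 0%N => z; rewrite expr0 mulr1 (le_trans (ler_normD _ _))//.
by rewrite !normrM lerD// ler_piMr// ?cos_max ?sin_max.
Qed.

End trigonometric_functional.

(** * From the identity to a Gaussian process, through versions *)

Section converse.
Context d (T : measurableType d) (R : realType) (P : probability T R).
Variables (X : R -> T -> R) (K : R * R -> R) (I : set R).
Local Notation tR := (measurableTypeR R).
Local Notation mu := (@leb01 R).
Hypothesis mX : measurable_fun setT (fun p : tR * T => X p.1 p.2).
Hypothesis SK : sqint (mu \x mu)%E K.
Hypothesis fI : full_times I.
Hypothesis ibpI : forall f : smooth_functional I, ibp_identity P X K f.

Let mXt t : measurable_fun setT (X t).
Proof. exact: (measurableT_comp mX (measurable_pair1 t)). Qed.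

Let mXw w : measurable_fun setT (fun t : tR => X t w).
Proof. exact: (measurableT_comp mX (measurable_pair2 w)). Qed.

Let mK : measurable_fun setT K. Proof. by case: SK. Qed.

Let mstep_int e : measurable_fun setT (fun w => step_int e (X^~ w)).
Proof. by rewrite /step_int; apply: measurable_sum => p; exact: measurable_funM. Qed.

Let mKstep e : measurable_fun setT (Kstep K e : tR -> R).
Proof.
rewrite /Kstep; apply: measurable_sum => p; apply: measurable_funM => //.
exact: (measurableT_comp mK (measurable_pair1 p.2)).
Qed.

Lemma ibp_trig th (e : step R R) : step_on I e ->
  \int[P]_w \int[mu]_t (X t w * (sin (step_int e (X^~ w) + th) * step_fun e t)) =
  \int[P]_w \int[mu]_t \int[mu]_s
    (K (t, s) * (cos (step_int e (X^~ w) + th) * step_fun e t * Kstep K e s)).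
Proof.
move=> eI.
(* The real functional - cos (z + th), with zero imaginary part; its first two derivatives are sin
   (z + th) and cos (z + th). *)
pose g (z : 'rV[R]_1) : R[i] := Complex (trig th (-1) 0 z) (trig th 0 0 z).
have Cg : cCpinf g by split; exact: Cpinf_trig.
pose f := SmoothFunctional (fun _ : 'I_1 => eI) Cg.
have [_ _ _ _ /(congr1 (@complex.Re R))] := ibpI f; rewrite /cintegral/=.
have z0 w : (sf_z f (X^~ w) : 'rV_1) 0 0 = step_int e (X^~ w) by rewrite mxE.
move=> E; refine (etrans (etrans _ E) _).
  apply: eq_Rintegral => w _; apply: eq_Rintegral => t _.
  rewrite (Re_lhs X f) /real_lhs big_ord1/=; congr (_ * (_ * _)).
  rewrite (_ : (fun y => _) = trig th (-1) 0)// partial_trig /trig z0; ring.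
apply: eq_Rintegral => w _; apply: eq_Rintegral => t _; apply: eq_Rintegral => s _.
rewrite (Re_rhs X K f) /real_rhs !big_ord1/=; congr (_ * (_ * _ * _)).
rewrite (_ : (fun y => _) = trig th (-1) 0)// !partial_trig /trig z0; ring.
Qed.

Variables (X' : tR * T -> R) (K' : tR * tR -> R) (FX FK : set R).
Hypothesis LX' : L2proc P X'.
Hypothesis LK' : L2proc mu K'.
Hypothesis FX0 : mu.-negligible (~` FX).
Hypothesis FK0 : mu.-negligible (~` FK).
Hypothesis XX' : forall t, FX t -> {ae P, forall w, X' (t, w) = X t w}.
Hypothesis XX'w : {ae P, forall w, {ae mu, forall t, X' (t, w) = X t w}}.
Hypothesis KK' : forall t, FK t -> {ae mu, forall s, K' (t, s) = K (t, s)}.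

Lemma ae_psum d' (T' : measurableType d') (m : {measure set T' -> \bar R})
    (Z Z' : tR * T' -> R) (e : seq (R * R)) :
  (forall p, p \in e -> {ae m, forall w, Z' (p.2, w) = Z (p.2, w)}) ->
  {ae m, forall w, psum Z' e w = psum Z e w}.
Proof.
elim: e => [|p e ih] he; first by apply: aeW => w; rewrite /psum !big_nil.
have {}ih : {ae m, forall w, psum Z' e w = psum Z e w}.
  by apply: ih => q qe; apply: he; rewrite inE qe orbT.
move: (he p (mem_head _ _)) ih.
by apply: filterS2 => w pw ew; rewrite /psum !big_cons -/(psum Z' e w) ew pw.
Qed.

(** Times at which step functions may jump and evaluations of the versions are those of X and K; ]0,
    1] is the range that [step_on] prescribes. *)
Let J : set R := I `&` FX `&` FK `&` `]0, 1]%classic.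

Let fJ : full_times J.
Proof.
have [I01 nI] := fI; split; first by move=> t [[[/I01]]].
rewrite /J !setCI; do 3?[apply: negligibleU => //].
by have := ae_leb01_oo R; apply: negligibleS => t /= nt /andP[t0 t1]; apply: nt;
  rewrite in_itv/= t0 ltW.
Qed.

(** For fixed w the cosine is the constant c. After K is replaced by its version, integrating over t
    first turns \int e(t) K(t, s) dt into [pint K']. *)
Let kernel_side c (e : seq (R * R)) : (forall p, p \in e -> J p.2) ->
  \int[mu]_t \int[mu]_s (K (t, s) * (c * step_fun e t * Kstep K e s)) =
  c * \int[mu]_s (psum K' e s * pint K' (psum (@Zvol R) e) s).
Proof.
move=> eJ; have [mK' K'w K't SK'] := LK'.
have [M stepM] := step_fun_bounded e; have mstep := measurable_step_fun e.
have SKe := sqint_psum e LK'.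
have aeK : {ae mu, forall s, psum K' e s = psum K e s}.
  by apply: ae_psum => p /eJ[[[_ _] pK] _]; exact: KK'.
have mfst (h : tR -> R) : measurable_fun setT h -> measurable_fun setT (fun p : tR * tR => h p.1).
  by move=> mh; exact: (measurableT_comp mh measurable_fst).
have msnd (h : tR -> R) : measurable_fun setT h -> measurable_fun setT (fun p : tR * tR => h p.2).
  by move=> mh; exact: (measurableT_comp mh measurable_snd).
have mF : measurable_fun setT (fun p : tR * tR => K p * (c * step_fun e p.1 * Kstep K e p.2)).
  by apply: measurable_funM => //; apply: measurable_funM; [apply: measurable_funM => //; exact: mfst|exact: msnd].
have IF : rint (mu \x mu)%E (fun p => (step_fun e p.1 * K' p) * psum K' e p.2).
  apply: sqintM; first exact: (sqintMl SK' (mfst _ mstep) (fun p => stepM p.1)).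
  split; first exact: (msnd _ (sqint_measurable SKe)).
  by have := rint_prodM (rint_cst mu 1) SKe.2; under eq_fun do rewrite mul1r.
have mF' := rint_measurable (rintZl c IF).
transitivity (\int[mu]_t \int[mu]_s (c * ((step_fun e t * K' (t, s)) * psum K' e s))).
  apply: ae_Rint; [exact: (measurable_Rint1 mu mF)|exact: (measurable_Rint1 mu mF')|].
  have [N [mN N0 hN]] := FK0.
  exists N; split => // t /= nE; apply: hN => /= Ft; apply: nE; apply: ae_Rint.
  - exact: (measurableT_comp mF (measurable_pair1 t)).
  - exact: (measurableT_comp mF' (measurable_pair1 t)).
  move: aeK (KK' Ft); apply: filterS2 => s -> ->.
  by rewrite /psum -/(Kstep K e s); ring.
rewrite (Rint_Fubini (rintZl c IF)) -RintZl; last first.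
  by apply: sqintM => //; apply: sqint_pint => //; exact: (sqint_bounded mu mstep stepM).
apply: eq_Rintegral => s _ /=.
rewrite [psum K' e s * _]mulrC -RintZr; last first.
  by apply: sqintM; [exact: (sqint_bounded mu mstep stepM)|exact: K'w].
rewrite -RintZl//; apply: rintZr.
by apply: sqintM; [exact: (sqint_bounded mu mstep stepM)|exact: K'w].
Qed.

(** This discharges [ibp_steps] for the versions. The sums over jump times agree almost surely
    because finitely many times of [J] are involved; the time integrals agree because almost every
    path of [X'] equals that of X at almost every time. *)
Let ibp_versions th (e : seq (R * R)) : (forall p, p \in e -> J p.2) ->
  \int[P]_w (sin (psum X' e w + th) * pint X' (psum (@Zvol R) e) w) =
  \int[P]_w cos (psum X' e w + th) * \int[mu]_s (psum K' e s * pint K' (psum (@Zvol R) e) s).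
Proof.
move=> eJ; have [mX' X'w X't SX'] := LX'.
have [M stepM] := step_fun_bounded e; have mstep := measurable_step_fun e.
have eI : step_on I e.
  by move=> p /eJ[[[Ip _] _]]; rewrite /= in_itv/= => p01; split.
have SXe := sqint_psum e LX'.
have aeX : {ae P, forall w, psum X' e w = step_int e (X^~ w)}.
  have := @ae_psum _ _ P (fun p => X p.1 p.2) X' e; apply => p /eJ[[[_ pX] _] _].
  exact: XX'.
have mcos F (u : T -> R) : continuous F -> measurable_fun setT u ->
    measurable_fun setT (fun w => F (u w + th) : R).
  move=> cF mu'; apply: (measurableT_comp (continuous_measurable_fun cF)).
  exact: measurable_funD.
have mz := mstep_int e; have mpX := sqint_measurable SXe.
have Sstep := sqint_bounded mu mstep stepM.
transitivity (\int[P]_w \int[mu]_t (X t w * (sin (step_int e (X^~ w) + th) * step_fun e t))).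
  apply: ae_Rint.
  - apply: measurable_funM; first exact: mcos (@continuous_sin R) mpX.
    exact: sqint_measurable (sqint_pint LX' Sstep).
  - apply: (measurable_Rint2 mu (f := fun p : tR * T =>
      X p.1 p.2 * (sin (step_int e (X^~ p.2) + th) * step_fun e p.1))).
    apply: measurable_funM => //; apply: measurable_funM.
      exact: (measurableT_comp (mcos _ _ (@continuous_sin R) mz) measurable_snd).
    exact: (measurableT_comp mstep measurable_fst).
  move: aeX XX'w; apply: filterS2 => w -> Xw; rewrite /pint -RintZl; last first.
    by apply: sqintM => //; exact: X'w.
  apply: ae_Rint.
  - by apply: measurable_funM => //; apply: measurable_funM => //; exact: sqint_measurable (X'w w).
  - by apply: measurable_funM => //; exact: measurable_funM.
  apply: filterS Xw => t ->; rewrite (_ : psum (@Zvol R) e t = step_fun e t)//; ring.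
rewrite (ibp_trig th eI); under eq_Rintegral do rewrite kernel_side//.
rewrite RintZr; last first.
  apply: (rint_bounded P (M := 1)) => [|w]; last exact: cos_max.
  exact: mcos (@continuous_cos R) mz.
congr (_ * _); apply: ae_Rint.
- exact: mcos (@continuous_cos R) mz.
- exact: mcos (@continuous_cos R) mpX.
by apply: filterS aeX => w ->.
Qed.

Lemma prob_preimage_ae (U V : T -> R) (A : set tR) : measurable_fun setT U -> measurable_fun setT V ->
  {ae P, forall w, U w = V w} -> measurable A -> P (U @^-1` A) = P (V @^-1` A).
Proof.
move=> mU mV UV mA.
have mpre (W : T -> R) : measurable_fun setT W -> measurable (W @^-1` A).
  by move=> mW; rewrite -[X in measurable X]setTI; exact: mW.
rewrite -(setIT (U @^-1` A)) -(setIT (V @^-1` A)) -!integral_indic//; [|exact: mpre|exact: mpre].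
apply: ae_eq_integral => //.
- by apply/measurable_EFinP; apply: measurable_indic; exact: mpre.
- by apply/measurable_EFinP; apply: measurable_indic; exact: mpre.
apply: filterS UV => w UVw _; congr EFin; rewrite !indicE; congr (_ : bool)%:R.
by apply/idP/idP => /set_mem h; apply/mem_set; move: h; rewrite /= UVw.
Qed.

(** The times of [I'] are those reached by local averages, restricted to where the versions agree
    with X and K; they need not be the times of [I] at which the identity was assumed. Laws and
    covariances are computed for the versions and transferred almost everywhere. *)
Lemma fredholm_gaussian_versions :
  exists2 I' : set R, full_times I' & fredholm_gaussian_on P X K I'.
Proof.
have [I1 [fI1 cl]] := pint_closure_times LX' LK'.
pose I' : set R := I1 `&` FX `&` FK.
exists I'; first split.
- by have [I01 _] := fI1; move=> t [[/I01]].
- by have [_ nI] := fI1; rewrite !setCI; do 2?[apply: negligibleU => //].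
split.
- move=> m a t tI; pose e := [seq (a i, t i) | i <- index_enum 'I_m].
  have eI p : p \in e -> I' p.2 by move=> /mapP[i _ ->]; exact: tI.
  have law := psum_law LX' LK' fJ ibp_versions (e := e)
    (pint_closure_psum LX' LK' (fun p pe => cl p.2 (eI p pe).1.1)).
  exists (nrm mu (psum K' e)) => A mA; rewrite -law//.
  apply: prob_preimage_ae => //.
  + by apply: measurable_sum => i; exact: measurable_funM.
  + exact: sqint_measurable (sqint_psum e LX').
  have : {ae P, forall w, psum X' e w = psum (fun p : tR * T => X p.1 p.2) e w}.
    by apply: ae_psum => p /eI[[_ pX] _]; exact: XX'.
  by apply: filterS => w ->; rewrite /psum big_map.
move=> t s [[t1 tX] tK] [[s1 sX] sK].
have := congr1 EFin (pint_closure_covariance LX' LK' fJ ibp_versions (cl t t1) (cl s s1)).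
have [mX' X'w X't SX'] := LX'; have [mK' K'w K't SK'] := LK'.
rewrite (EFin_Rint (sqintM (X't t) (X't s))).
have mKt u : measurable_fun setT (fun v : tR => K (u, v)).
  exact: (measurableT_comp mK (measurable_pair1 u)).
have SK't u : sqint mu (fun v => K' (u, v)).
  by split; [exact: (measurableT_comp mK' (measurable_pair1 u))|exact: (K't u).2].
rewrite (EFin_Rint (sqintM (SK't t) (SK't s))).
have -> : (\int[P]_w (X' (t, w) * X' (s, w))%:E = \int[P]_w (X t w * X s w)%:E)%E.
  apply: ae_eq_integral => //.
  - by apply/measurable_EFinP; exact: measurable_funM (X't t).1 (X't s).1.
  - by apply/measurable_EFinP; exact: measurable_funM.
  by move: (XX' tX) (XX' sX); apply: filterS2 => w -> ->.
have -> // : (\int[mu]_w (K' (t, w) * K' (s, w))%:E = \int[mu]_w (K (t, w) * K (s, w))%:E)%E.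
apply: ae_eq_integral => //.
- by apply/measurable_EFinP; exact: measurable_funM (SK't t).1 (SK't s).1.
- by apply/measurable_EFinP; exact: measurable_funM.
by move: (KK' tK) (KK' sK); apply: filterS2 => w -> ->.
Qed.

End converse.

Lemma fredholm_gaussian_of_ibp d (T : measurableType d) (R : realType) (P : probability T R)
    (X : R -> T -> R) (K : R * R -> R) (I : set R) :
  measurable_fun setT (fun p : measurableTypeR R * T => X p.1 p.2) ->
  sqint (@leb01 R \x P)%E (fun p => X p.1 p.2) -> sqint (@leb01 R \x @leb01 R)%E K ->
  full_times I -> (forall f : smooth_functional I, ibp_identity P X K f) ->
  exists2 I' : set R, full_times I' & fredholm_gaussian_on P X K I'.
Proof.
move=> mX SX SK fI ibpI.
have [X' [FX [LX' FX0 XX' XX'w]]] := L2proc_version SX.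
have [K' [FK [LK' FK0 KK' _]]] := L2proc_version SK.
exact: (fredholm_gaussian_versions mX SK fI ibpI LX' LK' FX0 FK0 XX' XX'w KK').
Qed.

Theorem theorem4p2 (R : realType)
    (K : measurableTypeR R * measurableTypeR R -> R)
    (hK : K \in Lfun (@leb01 R \x @leb01 R)%E 2%:E)
    (P : probability (Omega R) R)
    (X : R -> Omega R -> R)
    (hX : coordinate_process X)
    (hX2 : (\int[@leb01 R]_t \int[P]_w ((X t w) ^+ 2)%:E < +oo)%E) :
  ((exists2 I : set R, full_times I & fredholm_gaussian_on P X K I) <->
   (exists2 I : set R, full_times I &
      forall f : smooth_functional I, ibp_identity P X K f)) /\
  (forall I : set R, full_times I -> fredholm_gaussian_on P X K I ->
     forall f : smooth_functional I, ibp_identity P X K f).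
Proof.
have [mX _] := hX.
(* Tonelli's theorem turns the iterated integral of the hypothesis into square integrability on the
   product. *)
have SX : sqint (@leb01 R \x P)%E (fun p => X p.1 p.2).
  split => //; apply/integrable12ltyP.
    by apply/measurable_EFinP; exact: measurable_funX.
  rewrite (_ : (fun t => _) = fun t => (\int[P]_w ((X t w) ^+ 2)%:E)%E)//.
  apply/funext => t; apply: eq_integral => w _ /=.
  by rewrite ger0_norm ?sqr_ge0.
have SK : sqint (@leb01 R \x @leb01 R)%E K.
  split; last exact: Lfun2_integrable_sqr.
  by move: hK; rewrite inE => -[/andP[]]; rewrite inE.
have ibp I : full_times I -> fredholm_gaussian_on P X K I ->
    forall f : smooth_functional I, ibp_identity P X K f.
  by move=> fI GX f; exact: (gaussian_ibp_identity f mX SX SK fI GX).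
split; last exact: ibp.
split=> [[I fI GX]|[I fI ibpI]]; first by exists I; [exact: fI|exact: ibp].
exact: fredholm_gaussian_of_ibp mX SX SK fI ibpI.
Qed.
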